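(* Let $d\ge2$ and let $X_1,X_2,\ldots$ be i.i.d. $\mathbb{R}^d$-valued random vectors with a spherically symmetric distribution with a density function $f(\mathbf{x})$ such that, as $|\mathbf{x}|\to\infty$, $$f(\mathbf{x})\sim c\,|\mathbf{x}|^{\alpha}e^{-\beta|\mathbf{x}|^{\gamma}}$$ for some $c,\beta,\gamma>0$ and $\alpha\in\mathbb{R}$. Let $M^{(2)}_n:=\max_{1\le i<j\le n}|X_i-X_j|$ and $$c'_d:=\frac{(d-1)2^{d-2}\pi^{d-1/2}}{\Gamma(d/2)}.$$ Then, as $n\to\infty$, $$\bigl(\beta^{1/\gamma}\gamma\log^{1-1/\gamma}n\bigr) M^{(2)}_n-\biggl(2\gamma\log n+\Bigl(2\frac{\alpha+d}{\gamma}-\frac{d+3}{2}\Bigr)\log\log n+\log\log\log n+\log\bigl(c'_d\,\beta^{-2(\alpha+d)/\gamma}\gamma^{-(d+3)/2}c^2\bigr)\biggr)\ \stackrel{d}{\longrightarrow}\ V,$$ where $V$ has the Gumbel distribution $\mathbb{P}(V\le x)=e^{-e^{-x}}$, $x\in\mathbb{R}$.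
   Context: $|\cdot|$ is the Euclidean norm on $\mathbb{R}^d$. $\stackrel{d}{\longrightarrow}$ denotes convergence in distribution. $\log^{p}n$ means $(\log n)^p$. $f(\mathbf{x})\sim h(\mathbf{x})$ means that the ratio tends to $1$. *)

(* Defs.v *)
From HB Require Import structures.
From mathcomp Require Import all_boot all_order all_algebra.
From mathcomp Require Import all_classical all_reals all_analysis.
From mathcomp Require Import measurable_realfun.

Set Implicit Arguments.
Unset Strict Implicit.
Unset Printing Implicit Defensive.

Import Order.TTheory GRing.Theory Num.Theory.
Import numFieldNormedType.Exports.

Local Open Scope classical_set_scope.
Local Open Scope ring_scope.

(* R^d is the type [d.-tuple R]: the library equips it with the product
   sigma-algebra of the Borel sigma-algebra of R. *)

Section euclidean.
Context {R : realType} {d : nat}.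
Implicit Types x y : d.-tuple R.

Definition enorm x : R := Num.sqrt (\sum_(i < d) tnth x i ^+ 2).

Definition tsub x y : d.-tuple R := [tuple tnth x i - tnth y i | i < d].

Definition mxact (Q : 'M[R]_d) x : d.-tuple R :=
  [tuple \sum_(j < d) Q i j * tnth x j | i < d].

(* The filter of neighbourhoods of infinity, i.e. "as |x| -> +oo". *)
Definition enorm_infty : set_system (d.-tuple R) :=
  filter_from [set: R] (fun M => [set x | M < enorm x]).

Global Instance enorm_infty_filter : Filter enorm_infty.
Proof.
apply: filter_from_filter; first by exists 0.
move=> M N _ _; exists (Num.max M N) => // x /=.
by rewrite gt_max => /andP[].
Qed.

Lemma measurable_enorm : measurable_fun [set: d.-tuple R] enorm.
Proof.
rewrite /enorm; apply: measurableT_comp => //=.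
  by apply: continuous_measurable_fun; exact: sqrt_continuous.
apply: measurable_sum => i; apply: measurable_funX.
exact: measurable_tnth.
Qed.

End euclidean.

Lemma measurable_tsub d0 (T : measurableType d0) (R : realType) (d : nat)
    (f g : T -> d.-tuple R) :
  measurable_fun [set: T] f -> measurable_fun [set: T] g ->
  measurable_fun [set: T] (fun w => tsub (f w) (g w)).
Proof.
move=> mf mg; apply/measurable_fun_tnthP => i.
rewrite [X in measurable_fun _ X](_ : _ =
  (fun w => tnth (f w) i - tnth (g w) i)); last first.
  by apply/funext => w /=; rewrite tnth_mktuple.
by apply: measurable_funB; apply: (measurableT_comp (measurable_tnth i)).
Qed.

Section lebesgue_tuple.
Context {R : realType}.
Local Open Scope ereal_scope.

Section cons.
Variables (n : nat) (m : {sigma_finite_measure set (n.-tuple R) -> \bar R}).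

Let tcons (p : measurableTypeR R * n.-tuple R) : n.+1.-tuple R := [the n.+1.-tuple R of p.1 :: p.2].

Let behead_tcons p : [tuple of behead (tcons p)] = p.2.
Proof. exact/val_inj. Qed.

Let measurable_tcons : measurable_fun [set: measurableTypeR R * n.-tuple R] tcons.
Proof. exact: measurable_cons. Qed.

HB.instance Definition _ := isMeasurableFun.Build _ _ _ _ tcons measurable_tcons.

Definition lebesgue_cons : set (n.+1.-tuple R) -> \bar R :=
  pushforward (@lebesgue_measure R \x m) tcons.

Let lebesgue_cons0 : lebesgue_cons set0 = 0.
Proof. exact: measure0. Qed.

Let lebesgue_cons_ge0 A : 0 <= lebesgue_cons A.
Proof. exact: measure_ge0. Qed.

Let lebesgue_cons_sigma_additive : semi_sigma_additive lebesgue_cons.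
Proof. exact: measure_semi_sigma_additive. Qed.

HB.instance Definition _ := isMeasure.Build _ _ _ lebesgue_cons
  lebesgue_cons0 lebesgue_cons_ge0 lebesgue_cons_sigma_additive.

Lemma lebesgue_consE (A : set R) (B : set (n.-tuple R)) :
  measurable A -> measurable B ->
  lebesgue_cons [set x | A (thead x) /\ B [tuple of behead x]] =
  lebesgue_measure A * m B.
Proof.
move=> mA mB; rewrite /lebesgue_cons /pushforward -product_measure1E//.
congr (product_measure1 _ _ _); apply/seteqP.
by split => p; rewrite /= behead_tcons theadE.
Qed.

Let lebesgue_cons_sigma_finite : sigma_finite setT lebesgue_cons.
Proof.
have /sigma_finiteP[F [FT ndF Foo]] := sigma_finiteT (@lebesgue_measure R).
have /sigma_finiteP[G [GT ndG Goo]] := sigma_finiteT m.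
exists (fun k => [set x : n.+1.-tuple R |
    F k (thead x) /\ G k [tuple of behead x]]).
  apply/seteqP; split => // x _.
  have [i _ Fix] : (\bigcup_i F i) (thead x) by rewrite -FT.
  have [j _ Gjx] : (\bigcup_i G i) [tuple of behead x] by rewrite -GT.
  exists (maxn i j) => //; split.
  - by move: Fix; exact/subsetPset/ndF/leq_maxl.
  - by move: Gjx; exact/subsetPset/ndG/leq_maxr.
move=> k; have [mF Fk] := Foo k; have [mG Gk] := Goo k; split.
  apply: measurableI.
  - by rewrite -[X in measurable X]setTI; exact: measurable_tnth.
  - by rewrite -[X in measurable X]setTI; exact: measurable_behead.
by rewrite lebesgue_consE// lte_mul_pinfty// ge0_fin_numE.
Qed.

HB.instance Definition _ :=
  Measure_isSigmaFinite.Build _ _ _ lebesgue_cons lebesgue_cons_sigma_finite.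

End cons.

(* Lebesgue measure on R^n, as an iterated product. *)
Fixpoint lebesgue_tuple n : {sigma_finite_measure set (n.-tuple R) -> \bar R} :=
  match n with
  | 0 => \d_([tuple] : 0.-tuple R)
  | n.+1 => lebesgue_cons (lebesgue_tuple n)
  end.

Lemma lebesgue_tuple_box n (a b : n.-tuple R) :
  (forall i, tnth a i <= tnth b i)%R ->
  lebesgue_tuple n
    [set x | forall i, tnth x i \in `]tnth a i, tnth b i]%R] =
  (\prod_(i < n) (tnth b i - tnth a i))%:E.
Proof.
have mbox k (u v : k.-tuple R) : measurable
    [set x : k.-tuple R | forall i, tnth x i \in `]tnth u i, tnth v i]%R].
  rewrite (_ : [set x | _] = \bigcap_(i in [set: 'I_k])
      ((@tnth _ R ^~ i) @^-1` `]tnth u i, tnth v i]%classic)); last first.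
    by apply/seteqP; split => x /= h i; [move=> _; exact: h|exact: h].
  apply: fin_bigcap_measurable => // i _.
  by rewrite -[X in measurable X]setTI; exact: measurable_tnth.
elim: n => [|n IH] in a b *.
  by move=> _; rewrite big_ord0 /= diracE mem_set//= => -[].
move=> ab /=.
pose a' : n.-tuple R := [tuple of behead a].
pose b' : n.-tuple R := [tuple of behead b].
have tnth' (x : n.+1.-tuple R) i :
    tnth [tuple of behead x] i = tnth x (lift ord0 i).
  by rewrite [x in RHS]tuple_eta tnthS.
rewrite (_ : [set x | _] = [set x : n.+1.-tuple R |
    `]tnth a ord0, tnth b ord0]%classic (thead x) /\
    [set y : n.-tuple R | forall i, tnth y i \in `]tnth a' i, tnth b' i]%R]
      [tuple of behead x]]); last first.
  apply/seteqP; split => x /= h.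
    split; first exact: h.
    by move=> i; rewrite !tnth'; exact: h.
  case: h => h0 h i; have [->|i0] := eqVneq i ord0; first exact: h0.
  have [j ->] : exists j, i = lift ord0 j.
    by case: (unliftP ord0 i) i0 => [j ->|->]; [exists j|rewrite eqxx].
  by have := h j; rewrite !tnth'.
rewrite (lebesgue_consE (lebesgue_tuple n) (measurable_itv _) (mbox _ a' b')).
rewrite IH; last by move=> i; rewrite !tnth'.
rewrite lebesgue_measure_itv/= big_ord_recl EFinM lte_fin.
congr (_ * _)%E; last first.
  by congr EFin; apply: eq_bigr => i _; rewrite !tnth'.
case: ltP => // ba; congr EFin; apply/esym/eqP.
by rewrite subr_eq0 eq_le ba ab.
Qed.

End lebesgue_tuple.

Section random_vectors.
Context {disp : measure_display} {T : measurableType disp} {R : realType}.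
Context (P : probability T R).

Section law.
Context {d : nat}.

(* Mutual independence: the product rule over all finite subfamilies. *)
Definition mutually_independent (X : nat -> {RV P >-> d.-tuple R}) : Prop :=
  forall (J : seq nat) (A : nat -> set (d.-tuple R)), uniq J ->
    (forall i, measurable (A i)) ->
    P (\bigcap_(i in [set` J]) X i @^-1` A i) =
    (\prod_(i <- J) P (X i @^-1` A i))%E.

Definition identically_distributed (X : nat -> {RV P >-> d.-tuple R}) : Prop :=
  forall i j A, measurable A ->
    distribution P (X i) A = distribution P (X j) A.

Definition spherically_symmetric (Y : {RV P >-> d.-tuple R}) : Prop :=
  forall Q : 'M[R]_d, Q *m Q^T = 1%:M ->
  forall A, measurable A ->
    distribution P Y (mxact Q @^-1` A) = distribution P Y A.

Definition has_density (Y : {RV P >-> d.-tuple R}) (f : d.-tuple R -> R) :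
    Prop :=
  [/\ measurable_fun setT f, forall x, 0 <= f x &
    forall A, measurable A ->
      distribution P Y A = (\int[lebesgue_tuple d]_(x in A) (f x)%:E)%E].

(* M^(2)_n for the points X 0, ..., X (n - 1). The distances are nonnegative,
   so that the default value 0 of the maximum only matters when n < 2. *)
Definition max_dist (X : nat -> {RV P >-> d.-tuple R}) (n : nat) : T -> R :=
  fun w => \big[Num.max/0]_(p : 'I_n * 'I_n | (p.1 < p.2)%N)
    enorm (tsub (X p.1 w) (X p.2 w)).

Lemma measurable_max_dist X n : measurable_fun setT (max_dist X n).
Proof.
rewrite /max_dist; elim: (index_enum _) => [|p s IH].
  by under eq_fun do rewrite big_nil; exact: measurable_cst.
under eq_fun do rewrite big_cons.
case: (p.1 < p.2)%N => //.
apply: measurable_maxr => //; apply: (measurableT_comp measurable_enorm).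
by apply: measurable_tsub; exact: measurable_funPT.
Qed.

HB.instance Definition _ X n := isMeasurableFun.Build _ _ _ _ (max_dist X n)
  (measurable_max_dist X n).

End law.

End random_vectors.

Arguments mutually_independent {disp T R} P {d} X.
Arguments identically_distributed {disp T R} P {d} X.
Arguments spherically_symmetric {disp T R} P {d} Y.
Arguments has_density {disp T R} P {d} Y f.
Arguments max_dist {disp T R} P {d} X n.

Section affine.
Context {disp : measure_display} {T : measurableType disp} {R : realType}.

Definition affine_fun (a b : R) (Y : T -> R) : T -> R := fun w => a * Y w - b.

Lemma measurable_affine_fun a b (Y : {mfun T >-> R}) :
  measurable_fun setT (affine_fun a b Y).
Proof. by apply: measurable_funB => //; exact: measurable_funM. Qed.

HB.instance Definition _ a b (Y : {mfun T >-> R}) := isMeasurableFun.Build _ _ _ _ (affine_fun a b Y)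
  (measurable_affine_fun a b Y).

End affine.

(* Convergence in distribution; the limit may live on another space. *)
Definition cvg_in_distribution d1 d2 (T1 : measurableType d1)
    (T2 : measurableType d2) (R : realType) (P : probability T1 R)
    (Q : probability T2 R) (Y : nat -> {RV P >-> R}) (V : {RV Q >-> R}) : Prop :=
  forall x, {for x, continuous (cdf V)} ->
    cdf (Y n) x @[n --> \oo] --> cdf V x.

Definition gumbel_distributed d (T : measurableType d) (R : realType)
    (Q : probability T R) (V : {RV Q >-> R}) : Prop :=
  forall x, cdf V x = (expR (- expR (- x)))%:E.

Definition Gamma {R : realType} (z : R) : R :=
  \int[lebesgue_measure]_(t in `]0, +oo[) (t `^ (z - 1) * expR (- t)).

Definition cprime {R : realType} (d : nat) : R :=
  (d%:R - 1) * 2 ^+ (d - 2) * pi `^ (d%:R - 2^-1) / Gamma (d%:R / 2).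

Arguments cvg_in_distribution {d1 d2 T1 T2 R} P Q Y V.
Arguments gumbel_distributed {d T R} Q V.

(* Main.v *)
From HB Require Import structures.
Require Import Defs.
From mathcomp Require Import all_boot all_order all_algebra.
From mathcomp Require Import all_classical all_reals all_analysis.
From mathcomp Require Import measurable_realfun ring lra zify.

Set Implicit Arguments.
Unset Strict Implicit.
Unset Printing Implicit Defensive.

Import Order.TTheory GRing.Theory Num.Theory.
Import numFieldNormedType.Exports.

Local Open Scope classical_set_scope.
Local Open Scope ring_scope.

(** Put l = log n. Let A be the radius at which beta A ^ gamma = l and let
    b = A / (gamma l) be the length over which the density falls by a factor e
    near that radius. In the normalized radius s = (|x| - A) / b the density is
    close to peak * e ^ (- s), uniformly for |s| = O(log l) ([density_window]).
    The multiplier of the maximal distance in the theorem is exactly 1 / b and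
    2 A / b = 2 gamma l, so the event to be studied is that no two points are
    further apart than 2 A + b w, where w is the quantity [level].

    The probability p that two points are that far apart is found as follows.
    By symmetry the first point may be rotated to - (A + b s1) e_1
    ([householder], [far_region_rotate]). A second point y = (t, y') is then far
    enough when t exceeds a bound of the form z0 - |y'| ^ 2 / (4 A), whereas
    |y| = t + |y'| ^ 2 / (2 A) to the relevant order. Integrating the density is
    thus an exponential integral in t followed by a Gaussian integral in y', with
    value cross_mass * e ^ (s1 - w) ([pair_upper], [pair_lower]). The factor
    e ^ s1 cancels the decay of the density at the first point, so every unit of
    normalized radius contributes equally, and with both points restricted to
    normalized radius at most sS the variable s1 ranges over an interval of
    length 2 sS - w ([link_upper], [link_lower]). For sS = [cutoff], which is
    about the largest normalized radius among n points, this length is close to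
    (d - 1) / 2 * log l: this is where the term log log log n comes from. The
    constants are such that n ^ 2 p tends to 2 e ^ (- x) ([mass_level]).

    The number of pairs of far points is asymptotically Poisson. With W this
    number and phi (t) = E t ^ W, the local dependence between the pairs gives
    phi' = lambda phi up to a small error on [0, 1], hence P (W = 0) = phi (0) is
    close to e ^ (- lambda) ([poisson_dependency_graph]). The error is of order
    n ^ 3 (p ^ 2 + q), where q is the probability that a point is far from two
    others ([poisson_random_graph]). Restricting the points to normalized radius
    at most sS keeps n ^ 3 q small, because an exceptionally remote point would be
    far from many others; and it changes nothing in the limit, because
    n P (|X| >= A + b sS) tends to 0 ([tail_bound], [max_dist_far_pairs]). *)

(** * Independence of blocks of coordinates *)

(** Both sides of the product formula are finite measures in A which agree on a
    pi-system. *)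
Lemma pi_system_indep {disp : measure_display} {T : measurableType disp}
    {R : realType} (P : probability T R) (G : set (set T)) (H : set T) :
  setI_closed G -> G setT -> (forall A, G A -> measurable A) ->
  measurable H -> (forall A, G A -> P (A `&` H) = (P A * P H)%E) ->
  forall A, <<s G >> A -> P (A `&` H) = (P A * P H)%E.
Proof.
move=> GI GT Gm mH GH A sA.
have PH : P H \is a fin_num by exact: fin_num_measure.
pose c := fine (P H).
have c0 : 0 <= c by apply: fine_ge0; exact: measure_ge0.
pose m2 : {measure set T -> \bar R} := mscale (NngNum c0) P.
pose m1 : {measure set T -> \bar R} := mrestr P mH.
suff -> : P (A `&` H) = m2 A.
  by rewrite /m2 /= /mscale /= fineK // muleC.
rewrite -[LHS]/(m1 A).
apply: (@g_sigma_algebra_measure_unique _ _ _ G _ (fun=> setT)) => //.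
- by rewrite bigcup_const.
- move=> B GB; rewrite /m1 /m2 /= /mrestr /mscale /= GH //.
  by rewrite fineK // muleC.
- move=> k; rewrite /m1/= /mrestr setTI.
  by rewrite (le_lt_trans (probability_le1 P mH)) // ltry.
Qed.

Section independence.
Context {disp : measure_display} {T : measurableType disp} {R : realType}.
Context {dE : measure_display} {E : measurableType dE}.
Variables (P : probability T R) (X : nat -> T -> E).
Hypothesis mX : forall k, measurable_fun setT (X k).

Definition cylinders (J : seq nat) : set (set T) :=
  [set B | exists2 A : nat -> set E, (forall i, measurable (A i)) &
    B = \bigcap_(i in [set` J]) X i @^-1` A i].

Lemma cylinders_setI J : setI_closed (cylinders J).
Proof.
move=> _ _ [A mA ->] [B mB ->]; exists (fun i => A i `&` B i).
  by move=> i; exact: measurableI.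
apply/seteqP; split=> [w [wA wB] i Ji|w wAB]; first by split; [exact: wA|exact: wB].
by split=> i Ji; have [] := wAB i Ji.
Qed.

Lemma cylinders_setT J : cylinders J setT.
Proof. by exists (fun=> setT) => //; apply/seteqP; split. Qed.

Lemma cylinders_measurable J B : cylinders J B -> measurable B.
Proof.
move=> [A mA ->]; apply: fin_bigcap_measurable; first exact: finite_seq.
by move=> i _; rewrite -[X in measurable X]setTI; exact: mX.
Qed.

Lemma measurable_cylinders J i : i \in J ->
  measurable_fun [set: g_sigma_algebraType (cylinders J)] (X i).
Proof.
move=> Ji _ A mA; rewrite setTI; apply: sub_sigma_algebra.
exists (fun k => if k == i then A else setT).
  by move=> k; case: ifP.
apply/seteqP; split=> [w wA k _|w /(_ i Ji)] /=; last by rewrite eqxx.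
by case: ifPn => // /eqP ->.
Qed.

Lemma sigma_cylinders_measurable J B : <<s cylinders J >> B -> measurable B.
Proof.
move: B; apply: smallest_sub; last by move=> B; exact: cylinders_measurable.
exact: sigma_algebra_measurable.
Qed.

Hypothesis indepX : forall (J : seq nat) (A : nat -> set E), uniq J ->
  (forall i, measurable (A i)) ->
  P (\bigcap_(i in [set` J]) X i @^-1` A i) =
  (\prod_(i <- J) P (X i @^-1` A i))%E.

Lemma cylinders_indep J J' B B' : uniq (J ++ J') ->
  cylinders J B -> cylinders J' B' -> P (B `&` B') = (P B * P B')%E.
Proof.
move=> uJ [A mA ->] [A' mA' ->].
have := uJ; rewrite cat_uniq => /and3P[uJ1 JJ' uJ2].
rewrite (indepX uJ1 mA) (indepX uJ2 mA').
pose D i := if i \in J then A i else A' i.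
have -> : \bigcap_(i in [set` J]) X i @^-1` A i `&`
    \bigcap_(i in [set` J']) X i @^-1` A' i =
    \bigcap_(i in [set` J ++ J']) X i @^-1` D i.
  apply/seteqP; split=> [w [wA wA'] i /=|w wD].
    rewrite mem_cat /D => /orP[iJ|iJ'].
      by rewrite iJ; exact: wA.
    case: ifPn => iJ; first exact: wA.
    exact: wA'.
  split=> i /= iJ.
    by have := wD i; rewrite /= mem_cat iJ /D iJ; exact.
  have := wD i; rewrite /= mem_cat iJ orbT /D; case: ifPn => [iJ1|_]; last exact.
  by move/hasPn : JJ' => /(_ i iJ); rewrite iJ1.
rewrite indepX //; last by move=> i; rewrite /D; case: ifP.
rewrite big_cat /=; congr (_ * _)%E; rewrite !big_seq; apply: eq_bigr => i iJ.
  by rewrite /D iJ.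
rewrite /D; case: ifPn => // iJ1.
by move/hasPn : JJ' => /(_ i iJ); rewrite iJ1.
Qed.

(** The product rule gives the independence of cylinders over disjoint blocks;
    cylinders form a pi-system, so it extends to one block and then to the other. *)
Lemma sigma_cylinders_indep J J' B B' : uniq (J ++ J') ->
  <<s cylinders J >> B -> <<s cylinders J' >> B' ->
  P (B `&` B') = (P B * P B')%E.
Proof.
move=> uJ sB sB'.
apply: (@pi_system_indep _ _ _ _ (cylinders J)) => //.
- exact: cylinders_setI.
- exact: cylinders_setT.
- exact: cylinders_measurable.
- exact: sigma_cylinders_measurable sB'.
move=> A cA; rewrite setIC muleC.
apply: (@pi_system_indep _ _ _ _ (cylinders J')) => //.
- exact: cylinders_setI.
- exact: cylinders_setT.
- exact: cylinders_measurable.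
- exact: cylinders_measurable cA.
by move=> A' cA'; rewrite setIC muleC; exact: cylinders_indep uJ cA cA'.
Qed.

End independence.

(** Product measures are determined by their values on rectangles. *)
Lemma law_pair {disp : measure_display} {T : measurableType disp}
    {R : realType} (P : probability T R)
    d1 d2 (E1 : measurableType d1) (E2 : measurableType d2)
    (m1 : probability E1 R)
    (m2 : probability E2 R)
    (Y : T -> E1) (Z : T -> E2) :
  measurable_fun setT Y -> measurable_fun setT Z ->
  (forall A B, measurable A -> measurable B ->
    P (Y @^-1` A `&` Z @^-1` B) = (m1 A * m2 B)%E) ->
  forall G, measurable G ->
    P ((fun w => (Y w, Z w)) @^-1` G) = (m1 \x m2)%E G.
Proof.
move=> mY mZ YZ G mG; apply/esym.
have mYZ : measurable_fun setT (fun w => (Y w, Z w)).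
  exact: measurable_fun_pair.
pose f : {mfun T >-> (E1 * E2)%type} := HB.pack (fun w => (Y w, Z w))
  (isMeasurableFun.Build _ _ _ _ _ mYZ).
pose m' : {measure set (E1 * E2) -> \bar R} := distribution P f.
rewrite -[RHS]/(m' G); apply: product_measure_unique => // A B mA mB.
Qed.

(** * Poisson approximation under local dependence *)

(** The function p (t) e ^ (- lambda t) has a derivative of absolute value at
    most B on [0, 1]. *)
Lemma mvt_gronwall {R : realType} (p : {poly R}) (lambda B : R) :
  0 <= lambda -> (forall t, 0 <= t <= 1 -> `|p^`().[t] - lambda * p.[t]| <= B) ->
  `|p.[0] - p.[1] * expR (- lambda)| <= B.
Proof.
move=> l0 pB.
pose f t := p.[t] * expR (- lambda * t).
have df (t : R) : is_derive t 1 f ((p^`().[t] - lambda * p.[t]) * expR (- lambda * t)).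
  rewrite /f; apply: is_derive_eq.
  rewrite /GRing.scale/= -!/(GRing.mul _ _); ring.
have [t t01] : exists2 t, t \in `](0:R), 1[%R & f 1 - f 0 = ((p^`().[t] - lambda * p.[t]) * expR (- lambda * t)) * (1 - 0).
  apply: MVT => //.
  apply: continuous_subspaceT => x.
  by apply: differentiable_continuous; apply/derivable1_diffP; case: (df x).
move: t01; rewrite in_itv/= => /andP[t0 t1].
rewrite /f subr0 !mulr1 mulr0 expR0 mulr1 => E.
rewrite distrC E normrM (ger0_norm (expR_ge0 _)).
apply: le_trans (pB t _); last by rewrite !ltW.
rewrite ler_piMr // -expR0 ler_expR mulNr oppr_le0 mulr_ge0 //; exact: ltW.
Qed.

Lemma expr_subD_le {R : realType} (t : R) (m k : nat) : 0 <= t <= 1 ->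
  0 <= t ^+ m - t ^+ (m + k) <= k%:R.
Proof.
move=> /andP[t0 t1].
have a0 : 0 <= t ^+ m by exact: exprn_ge0.
have a1 : t ^+ m <= 1 by exact: exprn_ile1.
have b0 : 0 <= t ^+ k by exact: exprn_ge0.
have b1 : t ^+ k <= 1 by exact: exprn_ile1.
rewrite exprD; case: k => [|k] in b0 b1 *.
  by rewrite expr0 mulr1 subrr lexx.
have k1 : 1 <= k.+1%:R :> R by rewrite ler1n.
apply/andP; split; nra.
Qed.

Section dependency_graph.
Context {R : realType} {I : finType}.
Variables (pi : {set I} -> R) (D : I -> {set I}).
Hypothesis pi_ge0 : forall F, 0 <= pi F.
Hypothesis pi_sum1 : \sum_F pi F = 1.

(** [pi] is the law of a random subset of [I]; [D a] is a set outside of which the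
    random subset is independent of the presence of [a]. *)
Definition edge_prob (a : I) : R := \sum_(F : {set I} | a \in F) pi F.
Definition edge2_prob (a b : I) : R :=
  \sum_(F : {set I} | (a \in F) && (b \in F)) pi F.

Hypothesis D_refl : forall a, a \in D a.
Hypothesis D_indep : forall a (S : {set I}),
  \sum_(F : {set I} | (a \in F) && (F :\: D a == S)) pi F =
  edge_prob a * \sum_(F : {set I} | F :\: D a == S) pi F.

Lemma indep_expect a (g : {set I} -> R) :
  \sum_(F : {set I} | a \in F) pi F * g (F :\: D a) =
  edge_prob a * \sum_F pi F * g (F :\: D a).
Proof.
rewrite (partition_big (fun F : {set I} => F :\: D a) predT) //=.
rewrite [in RHS](partition_big (fun F : {set I} => F :\: D a) predT) //=.
rewrite mulr_sumr; apply: eq_bigr => S _.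
rewrite (eq_bigr (fun F => pi F * g S)); last by move=> F /andP[_ /eqP ->].
rewrite -mulr_suml D_indep -mulrA; congr (_ * _).
by rewrite mulr_suml; apply: eq_bigr => F /eqP ->.
Qed.

Lemma sum_card_edge (Q : pred {set I}) (A : {set I}) :
  \sum_(F : {set I} | Q F) pi F * #|F :&: A|%:R =
  \sum_(b in A) \sum_(F : {set I} | Q F && (b \in F)) pi F.
Proof.
under [RHS]eq_bigr do rewrite big_mkcondr.
rewrite exchange_big /=; apply: eq_bigr => F QF.
rewrite -big_mkcondr /= sumr_const mulr_natr; congr (_ *+ _).
by apply: eq_card => b; rewrite !inE andbC.
Qed.

Lemma edge_prob_ge0 a : 0 <= edge_prob a.
Proof. by apply: sumr_ge0. Qed.

(** The generating function phi (t) = E t ^ |F| is a polynomial with phi (0) the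
    probability of the empty set and phi (1) = 1. In
    phi' (t) = sum_a E [a in F] t ^ (|F| - 1), replacing F by F minus D a makes
    the two factors independent, and going back gives lambda phi (t); on [0, 1]
    both replacements cost at most the expected number of elements that were
    removed. *)
Lemma poisson_dependency_graph :
  `|pi finset.set0 - expR (- \sum_a edge_prob a)| <=
  \sum_a \sum_(b in D a) edge_prob a * edge_prob b +
  \sum_a \sum_(b in D a :\ a) edge2_prob a b.
Proof.
pose p : {poly R} := \sum_F pi F *: 'X^#|F|.
have p1 : p.[1] = 1.
  rewrite /p horner_sum -[RHS]pi_sum1; apply: eq_bigr => F _.
  by rewrite hornerZ hornerXn expr1n mulr1.
have p0 : p.[0] = pi finset.set0.
  rewrite /p horner_sum (bigD1 (finset.set0 : {set I})) //= hornerZ hornerXn cards0 expr0 mulr1.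
  rewrite big1 ?addr0 // => F F0; rewrite hornerZ hornerXn expr0n.
  by rewrite cards_eq0 (negbTE F0) mulr0.
have pt t : p.[t] = \sum_F pi F * t ^+ #|F|.
  by rewrite /p horner_sum; apply: eq_bigr => F _; rewrite hornerZ hornerXn.
have dpt t : p^`().[t] = \sum_a \sum_(F : {set I} | a \in F) pi F * t ^+ #|F|.-1.
  rewrite /p raddf_sum horner_sum.
  rewrite (exchange_big_dep predT) //=; apply: eq_bigr => F _.
  rewrite derivZ derivXn hornerZ hornerMn hornerXn sumr_const.
  by rewrite -mulrnAr.
set lambda := \sum_a _.
rewrite -p0 -[X in _ - X]mul1r -p1; apply: mvt_gronwall.
  by apply: sumr_ge0 => a _; exact: edge_prob_ge0.
move=> t t01; rewrite dpt /lambda mulr_suml -sumrB -big_split /=.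
apply: (le_trans (ler_norm_sum _ _ _)); apply: ler_sum => a _.
have -> : \sum_(F : {set I} | a \in F) pi F * t ^+ #|F|.-1 - edge_prob a * p.[t]
  = edge_prob a * (\sum_F pi F * (t ^+ #|F :\: D a| - t ^+ #|F|)) -
    \sum_(F : {set I} | a \in F) pi F * (t ^+ #|F :\: D a| - t ^+ #|F|.-1).
  under [in RHS]eq_bigr do rewrite mulrBr.
  under [X in _ = _ - X]eq_bigr do rewrite mulrBr.
  rewrite !sumrB (indep_expect a (fun F => t ^+ #|F|)) pt; ring.
have -> : \sum_(b in D a) edge_prob a * edge_prob b =
    edge_prob a * \sum_F pi F * #|F :&: D a|%:R.
  by rewrite -mulr_sumr (sum_card_edge predT).
have -> : \sum_(b in D a :\ a) edge2_prob a b =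
    \sum_(F : {set I} | a \in F) pi F * #|F :&: (D a :\ a)|%:R.
  by rewrite sum_card_edge.
apply: (le_trans (ler_normB _ _)); apply: lerD.
  rewrite normrM (ger0_norm (edge_prob_ge0 a)) ler_wpM2l ?edge_prob_ge0 //.
  apply: (le_trans (ler_norm_sum _ _ _)); apply: ler_sum => F _.
  rewrite normrM (ger0_norm (pi_ge0 F)) ler_wpM2l //.
  have /andP[h1 h2] := expr_subD_le #|F :\: D a| #|F :&: D a| t01.
  by rewrite -(cardsID (D a) F) addnC ger0_norm.
apply: (le_trans (ler_norm_sum _ _ _)); apply: ler_sum => F aF.
rewrite normrM (ger0_norm (pi_ge0 F)) ler_wpM2l //.
have /andP[h1 h2] := expr_subD_le #|F :\: D a| #|F :&: (D a :\ a)| t01.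
suff -> : #|F|.-1 = (#|F :\: D a| + #|F :&: (D a :\ a)|)%N by rewrite ger0_norm.
rewrite -(cardsID (D a) F) (cardsD1 a (F :&: D a)) inE aF D_refl /= addnC.
by rewrite finset.setIDA.
Qed.

End dependency_graph.

Section random_graph.
Context {disp : measure_display} {T : measurableType disp} {R : realType}.
Context {dE : measure_display} {E : measurableType dE}.
Variables (P : probability T R) (X : nat -> T -> E) (mu : probability E R).
Variable G : set (E * E).
Hypothesis mX : forall k, measurable_fun setT (X k).
Hypothesis lawX : forall k A, measurable A -> P (X k @^-1` A) = mu A.
Hypothesis indepX : forall (J : seq nat) (A : nat -> set E), uniq J ->
  (forall i, measurable (A i)) ->
  P (\bigcap_(i in [set` J]) X i @^-1` A i) =
  (\prod_(i <- J) P (X i @^-1` A i))%E.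
Hypothesis mG : measurable G.
Hypothesis symG : forall x y, G (x, y) -> G (y, x).

(** Vertices i and j are joined when [G (X i, X j)] holds. *)
Let link i j : set T := [set w | G (X i w, X j w)].

Definition star_set : set (E * (E * E)) :=
  [set u | G (u.1, u.2.1) /\ G (u.1, u.2.2)].

Definition link_prob : R := fine ((mu \x mu)%E G).
Definition star_prob : R := fine ((mu \x (mu \x mu))%E star_set).

(** Events are tracked through the sigma-algebra of the coordinates on which they
    depend, as independence is between such sigma-algebras. *)
Let sigma_link J i j : i \in J -> j \in J ->
  @measurable _ (g_sigma_algebraType (cylinders X J)) (link i j).
Proof.
move=> iJ jJ.
have h : measurable_fun [set: g_sigma_algebraType (cylinders X J)]
    (fun w => (X i w, X j w)).
  by apply: measurable_fun_pair; exact: measurable_cylinders.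
by have := h measurableT _ mG; rewrite setTI.
Qed.

Let symlink i j : link i j = link j i.
Proof. by apply/seteqP; split=> w; exact: symG. Qed.

Let sigma_preimage i A : measurable A ->
  @measurable _ (g_sigma_algebraType (cylinders X [:: i])) (X i @^-1` A).
Proof.
move=> mA; have iJ : i \in [:: i] by rewrite inE.
have h : measurable_fun [set: g_sigma_algebraType (cylinders X [:: i])] (X i).
  exact: measurable_cylinders.
by have := h measurableT _ mA; rewrite setTI.
Qed.

Lemma law_couple i j : i != j -> forall H, measurable H ->
  P ((fun w => (X i w, X j w)) @^-1` H) = (mu \x mu)%E H.
Proof.
move=> ij; apply: law_pair => // A B mA mB.
transitivity (P (X i @^-1` A) * P (X j @^-1` B))%E; last by rewrite !lawX.
apply: (@sigma_cylinders_indep _ _ _ _ _ _ _ mX indepX [:: i] [:: j]).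
- by rewrite /= inE ij.
- exact: sigma_preimage.
- exact: sigma_preimage.
Qed.

Lemma link_probE i j : i != j -> fine (P (link i j)) = link_prob.
Proof. by move=> ij; rewrite /link_prob -(law_couple ij mG). Qed.

Lemma star_probE i j k : uniq [:: i; j; k] ->
  fine (P (link i j `&` link i k)) = star_prob.
Proof.
move=> /=; rewrite !inE negb_or andbT => /andP[/andP[ij ik] jk].
have mS : measurable star_set.
  apply: measurableI.
    rewrite -[X in measurable X]setTI.
    apply: (measurable_fun_pair measurable_fst (measurableT_comp measurable_fst measurable_snd)) => //.
  rewrite -[X in measurable X]setTI.
  by apply: (measurable_fun_pair measurable_fst (measurableT_comp measurable_snd measurable_snd)).
rewrite /star_prob; congr fine.
rewrite -[LHS]/(P ((fun w => (X i w, (X j w, X k w))) @^-1` star_set)).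
pose mu2 : probability (E * E)%type R := (mu \x mu)%E.
apply: (@law_pair _ _ _ P _ _ _ _ mu mu2) => //.
  exact: measurable_fun_pair.
move=> A B mA mB.
transitivity (P (X i @^-1` A) * P ((fun w => (X j w, X k w)) @^-1` B))%E;
  last by rewrite lawX // law_couple.
apply: (@sigma_cylinders_indep _ _ _ _ _ _ _ mX indepX [:: i] [:: j; k]).
- by rewrite /= !inE negb_or ij ik jk.
- exact: sigma_preimage.
- have h : measurable_fun [set: g_sigma_algebraType (cylinders X [:: j; k])]
      (fun w => (X j w, X k w)).
    by apply: measurable_fun_pair; apply: measurable_cylinders; rewrite !inE eqxx ?orbT.
  by have := h measurableT _ mB; rewrite setTI.
Qed.

Variable n : nat.
Let I := ('I_n * 'I_n)%type.

(** The random edge set; only ordered pairs i < j count, so the other elements of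
    the index type are never present. *)
Let xi (w : T) : {set I} := [set a : I | (a.1 < a.2)%N & w \in link a.1 a.2].

(** Two edges without a common endpoint are independent. *)
Let D (a : I) : {set I} := [set b : I | (b.1 \in [:: a.1; a.2]) || (b.2 \in [:: a.1; a.2])].

Let pi (F : {set I}) : R := fine (P (xi @^-1` [set F])).

Let sigma_xi J (a : I) (c : bool) : val a.1 \in J -> val a.2 \in J ->
  @measurable _ (g_sigma_algebraType (cylinders X J)) [set w | (a \in xi w) = c].
Proof.
move=> a1 a2.
have [a12|a12] := boolP (a.1 < a.2)%N; last first.
  case: c.
    rewrite [X in measurable X](_ : _ = set0) //; apply/seteqP; split=> // w /=.
    by rewrite inE (negbTE a12).
  rewrite [X in measurable X](_ : _ = setT) //; apply/seteqP; split=> // w _ /=.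
  by rewrite inE (negbTE a12).
have := sigma_link a1 a2; case: c => mL.
  rewrite [X in measurable X](_ : _ = link a.1 a.2) //; apply/seteqP; split=> w /=.
    by rewrite inE a12 /= => /set_mem.
  by move=> h; rewrite inE a12 /=; exact/mem_set.
rewrite [X in measurable X](_ : _ = ~` link a.1 a.2); first exact: measurableC.
apply/seteqP; split=> w /=.
  by rewrite inE a12 /= => h /mem_set; rewrite h.
by move=> h; rewrite inE a12 /=; apply/negbTE/negP => /set_mem.
Qed.

Let measurable_xi (Q : pred {set I}) : measurable [set w | Q (xi w)].
Proof.
have -> : [set w | Q (xi w)] =
    \bigcup_(F in [set F | Q F]) \bigcap_(a in [set: I]) [set w | (a \in xi w) = (a \in F)].
  apply/seteqP; split=> [w /= Qw|w [F /= QF wF]].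
    by exists (xi w).
  suff -> : xi w = F by [].
  by apply/setP => a; exact: wF.
apply: fin_bigcup_measurable; first exact: finite_finset.
move=> F _; apply: fin_bigcap_measurable; first exact: finite_finset.
move=> a _.
apply: (@sigma_cylinders_measurable _ _ _ _ _ mX [:: val a.1; val a.2]).
by apply: sigma_xi; rewrite !inE eqxx ?orbT.
Qed.

Let pi_sum (Q : pred {set I}) : \sum_(F | Q F) pi F = fine (P [set w | Q (xi w)]).
Proof.
have finP A : measurable A -> P A \is a fin_num by move=> mA; exact: fin_num_measure.
have mpi F : measurable (xi @^-1` [set F]).
  by have := measurable_xi (pred1 F); congr (measurable _); apply/seteqP; split=> w /= /eqP.
rewrite /pi sum_fine; last by move=> F _; exact: finP.
congr fine; have -> : [set w | Q (xi w)] = \bigcup_(F in [set F | Q F]) (xi @^-1` [set F]).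
  by apply/seteqP; split=> [w /= Qw|w [F /= QF ->] //]; exists (xi w).
pose r := [seq F <- index_enum {set I} | Q F].
have -> : [set F | Q F] = [set` r].
  by apply/seteqP; split=> F /=; rewrite mem_filter mem_index_enum andbT.
rewrite measure_fin_bigcup //.
  by rewrite -fsbig_seq ?filter_uniq ?index_enum_uniq // big_filter.
by move=> F F' _ _ [w [/= <- <-]].
Qed.

Let pi_ge0 F : 0 <= pi F.
Proof. by apply: fine_ge0. Qed.

Let pi_sum1 : \sum_F pi F = 1.
Proof.
rewrite (pi_sum predT) (_ : [set w | predT (xi w)] = setT) ?probability_setT //.
by apply/seteqP; split.
Qed.

Let edge_probE (a : I) : edge_prob pi a = if (a.1 < a.2)%N then link_prob else 0.
Proof.
rewrite /edge_prob (pi_sum (fun F : {set I} => a \in F)).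
case: ifPn => a12; last first.
  rewrite [X in P X](_ : _ = set0) ?measure0 //; apply/seteqP; split=> // w /=.
  by rewrite inE (negbTE a12).
rewrite -(@link_probE (val a.1) (val a.2)) ?neq_ltn ?a12 //; congr (fine (P _)).
by apply/seteqP; split=> w /=; rewrite inE a12 /=; [exact: set_mem|exact: mem_set].
Qed.

Let pi_edge0 (a : I) (F : {set I}) : ~~ (a.1 < a.2)%N -> a \in F -> pi F = 0.
Proof.
move=> a12 aF; rewrite /pi [X in P X](_ : _ = set0) ?measure0 //.
apply/seteqP; split=> // w /= wF.
by move: aF; rewrite -wF inE (negbTE a12).
Qed.

Let D_indep (a : I) (S : {set I}) :
  \sum_(F : {set I} | (a \in F) && (F :\: D a == S)%SET) pi F =
  edge_prob pi a * \sum_(F : {set I} | (F :\: D a == S)%SET) pi F.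
Proof.
have [a12|a12] := boolP (a.1 < a.2)%N; last first.
  rewrite edge_probE (negbTE a12) mul0r big1 // => F /andP[aF _].
  exact: pi_edge0 aF.
rewrite /edge_prob (pi_sum (fun F : {set I} => a \in F)).
rewrite (pi_sum (fun F : {set I} => F :\: D a == S)%SET).
rewrite (pi_sum (fun F : {set I} => (a \in F) && (F :\: D a == S)%SET)).
rewrite -fineM; last first.
- exact/fin_num_measure/(measurable_xi (fun F : {set I} => F :\: D a == S)%SET).
- exact/fin_num_measure/(measurable_xi (fun F : {set I} => a \in F)).
congr fine.
pose J := [:: val a.1; val a.2].
pose J' := [seq k <- iota 0 n | k \notin J].
have -> : [set w | (a \in xi w) && (xi w :\: D a == S)%SET] =
    [set w | a \in xi w] `&` [set w | (xi w :\: D a == S)%SET].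
  by apply/seteqP; split=> w /= => [/andP[]|[-> ->]].
apply: (@sigma_cylinders_indep _ _ _ _ _ _ _ mX indepX J J').
- rewrite cat_uniq filter_uniq ?iota_uniq // andbT.
  rewrite /J /= inE neq_ltn a12 /=; apply/hasPn => k.
  by rewrite mem_filter => /andP[].
- by apply: (@sigma_xi _ _ true); rewrite !inE eqxx ?orbT.
- have -> : [set w | (xi w :\: D a == S)%SET] = \bigcap_(b in [set: I])
      [set w | (b \in xi w :\: D a)%SET = (b \in S)].
    apply/seteqP; split=> [w /= /eqP <- //|w /= h].
    by apply/eqP/setP => b; exact: h.
  apply: (@fin_bigcap_measurable _ (g_sigma_algebraType (cylinders X J'))); first exact: finite_finset.
  move=> b _; have [bD|bD] := boolP (b \in D a).
    have [bS|bS] := boolP (b \in S).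
      rewrite [X in measurable X](_ : _ = set0) //; apply/seteqP; split=> // w /=.
      by rewrite finset.in_setD bD.
    rewrite [X in measurable X](_ : _ = setT) //; apply/seteqP; split=> // w _ /=.
    by rewrite finset.in_setD bD.
  rewrite [X in measurable X](_ : _ = [set w | (b \in xi w) = (b \in S)]); last first.
    by apply/seteqP; split=> w /=; rewrite finset.in_setD bD.
  by move: bD; rewrite inE negb_or => /andP[b1 b2]; apply: sigma_xi;
    rewrite mem_filter mem_iota /= ltn_ord andbT.
Qed.

Let edge2_prob_le (a b : I) : b \in (D a :\ a)%SET -> edge2_prob pi a b <= star_prob.
Proof.
have s0 : 0 <= star_prob.
  by apply: fine_ge0; apply: integral_ge0 => x _; exact: measure_ge0.
have [a12|a12] := boolP (a.1 < a.2)%N; last first.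
  by move=> _; rewrite /edge2_prob big1 // => F /andP[aF _]; exact: pi_edge0 aF.
have [b12|b12] := boolP (b.1 < b.2)%N; last first.
  by move=> _; rewrite /edge2_prob big1 // => F /andP[_ bF]; exact: pi_edge0 bF.
rewrite /edge2_prob (pi_sum (fun F : {set I} => (a \in F) && (b \in F))).
have -> : [set w | (a \in xi w) && (b \in xi w)] = link a.1 a.2 `&` link b.1 b.2.
  apply/seteqP; split=> w /=; rewrite !inE a12 b12 /=.
    by move=> /andP[/set_mem h1 /set_mem h2].
  by move=> [h1 h2]; apply/andP; split; exact/mem_set.
case: a a12 => i j /= ij; case: b b12 => k l /= kl.
rewrite !inE /= xpair_eqE -!(inj_eq val_inj) /=.
have [ki|ki] := eqVneq (k : nat) i.
  rewrite ki /= => lj; rewrite star_probE //= !inE negb_or; lia.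
have [kj|kj] := eqVneq (k : nat) j.
  rewrite kj /= => lj; rewrite (symlink i j) star_probE //= !inE negb_or; lia.
have [li|li] := eqVneq (l : nat) i.
  rewrite li /= => lj; rewrite (symlink k i) star_probE //= !inE negb_or; lia.
have [lj|lj] := eqVneq (l : nat) j; last by rewrite !andbF.
by rewrite lj /= => _; rewrite (symlink k j) (symlink i j) star_probE //= !inE negb_or; lia.
Qed.

Let sum_pairs (p : R) : \sum_(a : I) (if (a.1 < a.2)%N then p else 0) =
  'C(n, 2)%:R * p.
Proof.
rewrite -(pair_bigA _ (fun i j : 'I_n => if (i < j)%N then p else 0)) /=.
rewrite exchange_big /= -bin2_sum natr_sum mulr_suml.
rewrite big_mkord; apply: eq_bigr => j _.
rewrite -big_mkcond /= -(big_ord_widen _ (fun=> p) (ltnW (ltn_ord j))).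
by rewrite sumr_const card_ord mulr_natl.
Qed.

Let card_D (a : I) : (#|D a| <= 4 * n)%N.
Proof.
pose S2 : {set 'I_n} := [set a.1; a.2]%SET.
have sub : D a \subset finset.setU (finset.setX S2 finset.setT) (finset.setX finset.setT S2).
  by apply/fintype.subsetP => -[k l]; rewrite !inE /= !andbT.
apply: (leq_trans (subset_leq_card sub)).
apply: (leq_trans (leq_card_setU _ _)).
rewrite !cardsX cardsT card_ord cards2; case: (_ != _) => /=; lia.
Qed.

(** There are at most n ^ 2 edges, each with at most 4 n neighbours; two edges
    sharing an endpoint are both present with probability [star_prob]. *)
Lemma poisson_random_graph :
  `|fine (P [set w | forall i j, (i < j < n)%N -> ~ G (X i w, X j w)]) -
    expR (- ('C(n, 2)%:R * link_prob))| <=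
  4 * n%:R ^+ 3 * (link_prob ^+ 2 + star_prob).
Proof.
have l0 : 0 <= link_prob.
  by apply: fine_ge0; apply: integral_ge0 => x _; exact: measure_ge0.
have s0 : 0 <= star_prob.
  by apply: fine_ge0; apply: integral_ge0 => x _; exact: measure_ge0.
have := @poisson_dependency_graph R I pi D pi_ge0 pi_sum1 _ D_indep.
move=> /(_ _)/wrap[].
  by move=> a; rewrite inE /= !inE eqxx.
rewrite (eq_bigr (fun a : I => if (a.1 < a.2)%N then link_prob else 0)); last first.
  by move=> a _; rewrite edge_probE.
rewrite sum_pairs => h.
have -> : [set w | forall i j, (i < j < n)%N -> ~ G (X i w, X j w)] =
    xi @^-1` [set finset.set0].
  apply/seteqP; split=> w /= hw.
    apply/setP => -[i j]; rewrite !inE /=; apply/negbTE/negP => /andP[ij /set_mem].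
    by apply: hw; rewrite ij ltn_ord.
  move=> i j /andP[ij jn] Gij.
  have : (Ordinal (ltn_trans ij jn), Ordinal jn) \in xi w.
    by rewrite inE /= ij /=; exact/mem_set.
  by rewrite hw inE.
apply: (le_trans h).
have bnd (g : I -> I -> R) (D' : I -> {set I}) (B : R) : 0 <= B ->
    (forall a, D' a \subset D a) ->
    (forall a b, b \in D' a -> g a b <= B) ->
    \sum_a \sum_(b in D' a) g a b <= 4 * n%:R ^+ 3 * B.
  move=> B0 sD gB; apply: (@le_trans _ _ (\sum_(a : I) (4 * n)%:R * B)).
    apply: ler_sum => a _; apply: (@le_trans _ _ (\sum_(b in D' a) B)).
      by apply: ler_sum => b; exact: gB.
    rewrite sumr_const -[B *+ _]mulr_natl ler_wpM2r // ler_nat.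
    exact: leq_trans (subset_leq_card (sD a)) (card_D a).
  rewrite sumr_const card_prod card_ord -[leLHS]mulr_natl mulrA ler_wpM2r //.
  by rewrite -natrX -!natrM ler_nat; lia.
rewrite mulrDr; apply: lerD; apply: bnd.
- exact: sqr_ge0.
- by [].
- move=> a b _; rewrite !edge_probE expr2.
  by case: ifP => _; case: ifP => _; rewrite ?mul0r ?mulr0 ?mulr_ge0.
- exact: s0.
- by move=> a; exact: finset.subsetDl.
- exact: edge2_prob_le.
Qed.

End random_graph.

(** * Integration on tuples and the volume of balls *)

Lemma integral_expR_tail {R : realType} (k z : R) : 0 < k ->
  (\int[lebesgue_measure]_(t in `]z, +oo[) (expR (- (k * t)))%:E)%E =
  (k^-1 * expR (- (k * z)))%:E.
Proof.
move=> k0.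
have ce : continuous (fun t : R => expR (- (k * t))).
  move=> t; apply: (@continuous_comp _ _ _ (fun t => - (k * t)) expR); last exact: continuous_expR.
  by apply: (@continuousN _ R^o); apply: mulrl_continuous.
rewrite integral_itv_obnd_cbnd; last first.
  by apply/measurable_EFinP; apply: measurable_funTS; exact: continuous_measurable_fun.
rewrite (@ge0_continuous_FTC2y _ _ (fun t => - (k^-1 * expR (- (k * t)))) _ 0).
- by rewrite -EFinB sub0r opprK.
- by move=> x _; exact: expR_ge0.
- exact: continuous_subspaceT.
- rewrite -oppr0 -(mulr0 k^-1); apply: cvgN; apply: cvgMr.
  rewrite (_ : (fun t => _) = (fun z => expR (- z)) \o (fun z => k * z)) //.
  apply: (@cvg_comp _ _ _ _ _ _ (pinfty_nbhs R)); last exact: cvgr_expR.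
  exact: gt0_cvgMry.
- by move=> x _; exact: ex_derive.
- apply: cvg_at_right_filter; apply: cvgN; apply: cvgMr; exact: ce.
- move=> x _; rewrite derive1E.
  have H : is_derive x 1 (fun t : R => - (k^-1 * expR (- (k * t)))) (expR (- (k * x))).
    by apply: is_derive_eq; rewrite /GRing.scale/=; field; exact: lt0r_neq0.
  exact: derive_val.
Qed.

(** The image of Lebesgue measure under a dilation is determined on intervals. *)
Lemma ge0_integral_scale {R : realType} (r : R) (f : R -> \bar R) : 0 < r ->
  measurable_fun setT f -> (forall x, 0 <= f x)%E ->
  (\int[lebesgue_measure]_t f t = r%:E * \int[lebesgue_measure]_t f (r * t)%R)%E.
Proof.
move=> r0 mf f0.
have mr : measurable_fun [set: R] (fun t : R => r * t) by exact: measurable_funM.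
have mr' : @measurable_fun _ _ (measurableTypeR R) (measurableTypeR R) setT (fun t : R => r * t).
  exact: mr.
pose s := (fun t : R => r * t) : measurableTypeR R -> measurableTypeR R.
pose m0 : {measure set (measurableTypeR R) -> \bar R} :=
  mscale (NngNum (ltW r0)) (pushforward lebesgue_measure s).
pose m := m0 mr'.
rewrite (eq_measure_integral m); last first.
  move=> A mA _; apply: lebesgue_measure_unique => // _ [[a b] _ <-].
  rewrite /m /m0 /= /mscale /= /pushforward.
  have -> : s @^-1` `]a, b]%classic = `]r^-1 * a, r^-1 * b]%classic.
    apply/seteqP; split=> t; rewrite /= !in_itv /= => /andP[h1 h2]; apply/andP; split;
     by rewrite ?ltr_pdivrMl ?ler_pdivlMl // -?ltr_pdivrMl -?ler_pdivlMl.
  rewrite !lebesgue_measure_itv /= !lte_fin ltr_pM2l ?invr_gt0 //.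
  case: ifP => _; last by rewrite mule0.
  by rewrite -EFinB -EFinM; congr EFin; field; exact: lt0r_neq0.
rewrite ge0_integral_mscale // ge0_integral_pushforward //.
Qed.

Section tuples.
Context {R : realType}.
Local Notation lam := (@lebesgue_tuple R).
Local Notation mu := (@lebesgue_measure R).

Definition tcons n (t : R) (y : n.-tuple R) : n.+1.-tuple R := [tuple of t :: y].

Lemma measurable_tcons n :
  measurable_fun setT (fun p : measurableTypeR R * n.-tuple R => tcons p.1 p.2).
Proof. exact: measurable_cons. Qed.

Lemma measurable_tconsl n (y : n.-tuple R) :
  measurable_fun [set: measurableTypeR R] (fun t => tcons t y).
Proof. by apply: measurable_cons; [exact: measurable_id|exact: measurable_cst]. Qed.

Lemma ge0_integral_tcons n (f : n.+1.-tuple R -> \bar R) :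
  measurable_fun setT f -> (forall x, 0 <= f x)%E ->
  (\int[lam n.+1]_x f x = \int[lam n]_y \int[mu]_t f (tcons t y))%E.
Proof.
move=> mf f0.
transitivity (\int[pushforward (mu \x lam n)%E (fun p : measurableTypeR R * n.-tuple R => tcons p.1 p.2)]_x f x)%E.
  by [].
rewrite ge0_integral_pushforward //; last exact: measurable_tcons.
rewrite preimage_setT fubini_tonelli2 //.
- exact: (measurableT_comp mf (@measurable_tcons n)).
- by move=> x; exact: f0.
Qed.

Lemma enorm_sq n (x : n.-tuple R) : enorm x ^+ 2 = \sum_(i < n) tnth x i ^+ 2.
Proof. by rewrite sqr_sqrtr // sumr_ge0 // => i _; exact: sqr_ge0. Qed.

Lemma enorm_ge0 n (x : n.-tuple R) : 0 <= enorm x.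
Proof. exact: sqrtr_ge0. Qed.

Lemma enorm_tcons n t (y : n.-tuple R) : enorm (tcons t y) ^+ 2 = t ^+ 2 + enorm y ^+ 2.
Proof.
rewrite !enorm_sq big_ord_recl /tcons; congr (_ + _).
by apply: eq_bigr => i _; rewrite tnthS.
Qed.

Definition tscale n (r : R) (x : n.-tuple R) : n.-tuple R := [tuple r * tnth x i | i < n].

Lemma measurable_tscale n r : measurable_fun setT (@tscale n r).
Proof.
apply/measurable_fun_tnthP => i.
rewrite [X in measurable_fun _ X](_ : _ = (fun w => r * tnth w i)); last first.
  by apply/funext => w /=; rewrite tnth_mktuple.
by apply: measurable_funM => //; exact: measurable_tnth.
Qed.

Lemma enorm_tscale n r (x : n.-tuple R) : 0 <= r -> enorm (tscale r x) = r * enorm x.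
Proof.
move=> r0; rewrite /enorm -[r in RHS]ger0_norm // -sqrtr_sqr -sqrtrM ?sqr_ge0 //.
congr Num.sqrt; rewrite mulr_sumr; apply: eq_bigr => i _.
by rewrite tnth_mktuple exprMn.
Qed.

Lemma ge0_integral_tscale n r (f : n.-tuple R -> \bar R) : 0 < r ->
  measurable_fun setT f -> (forall x, 0 <= f x)%E ->
  (\int[lam n]_x f x = (r ^+ n)%:E * \int[lam n]_x f (tscale r x))%E.
Proof.
move=> r0; elim: n f => [|n IH] f mf f0.
  rewrite expr0 mul1e; apply: eq_integral => x _; congr f.
  by rewrite (tuple0 (tscale r x)) (tuple0 x).
have mfs : measurable_fun setT (fun x => f (tscale r x)).
  by apply: measurableT_comp => //; exact: measurable_tscale.
rewrite ge0_integral_tcons // [in RHS]ge0_integral_tcons //.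
have mfc y : measurable_fun setT (fun t : R => f (tcons t y)).
  exact: (measurableT_comp mf (@measurable_tconsl n y)).
have sE t y : tscale r (tcons t y) = tcons (r * t) (tscale r y).
  apply: eq_from_tnth => i; rewrite tnth_mktuple /tcons.
  have [->|[j ->]] : i = ord0 \/ exists j, i = lift ord0 j.
    by case: (unliftP ord0 i) => [j ->|->]; [right; exists j|left].
    by rewrite !tnth0.
  by rewrite !tnthS tnth_mktuple.
pose g y := (\int[mu]_t f (tcons t y))%E.
have g0 y : (0 <= g y)%E by apply: integral_ge0.
have mg : measurable_fun setT g.
  apply: (@measurable_fun_fubini_tonelli_G _ _ _ _ _ mu (fun p : R * n.-tuple R => f (tcons p.1 p.2))) => //.
  exact: (measurableT_comp mf (@measurable_tcons n)).
rewrite -/g IH // exprSr EFinM -muleA; congr (_ * _)%E.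
rewrite -ge0_integralZl //; last 3 first.
- apply: (@measurable_fun_fubini_tonelli_G _ _ _ _ _ mu (fun p : R * n.-tuple R => f (tscale r (tcons p.1 p.2)))) => //.
  exact: (measurableT_comp mfs (@measurable_tcons n)).
- by move=> y _; apply: integral_ge0.
- by rewrite lee_fin ltW.
apply: eq_integral => y _; rewrite /g (ge0_integral_scale r0) //.
by congr (_ * _)%E; apply: eq_integral => t _; rewrite sE.
Qed.

(** Rescaling of the total mass of the normal density. *)
Lemma integral_gaussian s : 0 < s ->
  (\int[mu]_t (expR (- (t ^+ 2 / s)))%:E = (Num.sqrt (pi * s))%:E)%E.
Proof.
move=> s0; pose sg := Num.sqrt (s / 2).
have sg0 : sg != 0 by rewrite gt_eqF // sqrtr_gt0 divr_gt0.
have sg2 : sg ^+ 2 *+ 2 = s by rewrite sqr_sqrtr ?divr_ge0 ?ltW // -mulr_natr divfK.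
have pk : normal_peak sg != 0 by rewrite gt_eqF // normal_peak_gt0.
have -> : (fun t => (expR (- (t ^+ 2 / s)))%:E) = (fun t => (normal_peak sg)^-1%:E * (normal_pdf 0 sg t)%:E)%E.
  apply/funext => t; rewrite normal_pdfE // /normal_fun -EFinM mulKf // subr0 sg2.
  by rewrite mulNr.
rewrite ge0_integralZl //.
- by rewrite integral_normal_pdf mule1 /normal_peak invrK -mulrnAl sg2 mulrC.
- by apply/measurable_EFinP; exact: measurable_normal_pdf.
- by move=> x _; rewrite lee_fin normal_pdf_ge0.
- by rewrite lee_fin invr_ge0 normal_peak_ge0.
Qed.

Lemma integral_gaussian_tuple n s : 0 < s ->
  (\int[lam n]_y (expR (- (enorm y ^+ 2 / s)))%:E = (Num.sqrt (pi * s) ^+ n)%:E)%E.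
Proof.
move=> s0.
have me k : measurable_fun setT (fun y : k.-tuple R => (expR (- (enorm y ^+ 2 / s)))%:E).
  apply/measurable_EFinP; apply: measurableT_comp => //; apply: measurable_funN => //.
  apply: measurable_funM => //; apply: measurable_funX; exact: measurable_enorm.
elim: n => [|n IH].
  rewrite expr0; transitivity (\int[lam 0]_y (cst 1%E y))%E.
    by apply: eq_integral => y _; rewrite enorm_sq big_ord0 mul0r oppr0 expR0.
  by rewrite integral_cst // mul1e /= diracE mem_set.
rewrite ge0_integral_tcons //.
rewrite exprSr EFinM -IH [RHS]muleC -ge0_integralZl //.
- apply: eq_integral => y _.
  rewrite -(integral_gaussian s0) [in RHS]muleC -ge0_integralZl //.
  + apply: eq_integral => t _; rewrite enorm_tcons -EFinM -expRD; congr (expR _)%:E.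
    by rewrite mulrDl opprD addrC.
  + apply/measurable_EFinP; apply: measurableT_comp => //; apply: measurable_funN => //.
    by apply: measurable_funM => //; exact: measurable_funX.
- exact: me.
Qed.

End tuples.

Lemma measurable_ltset d (T : measurableType d) (R : realType) (f g : T -> R) :
  measurable_fun setT f -> measurable_fun setT g -> measurable [set x | f x < g x].
Proof.
move=> mf mg; have := measurable_fun_ltr mf mg measurableT (Y := [set true]) I.
by rewrite setTI; congr measurable; apply/seteqP; split.
Qed.

Lemma indic_lt d (T : measurableType d) (R : realType) (f g : T -> R) x :
  \1_[set x | f x < g x] x = (f x < g x)%R%:R :> R.
Proof.
rewrite indicE; suff -> : (x \in [set x | f x < g x]) = (f x < g x) by [].
by apply/idP/idP => [/set_mem //|h]; exact/mem_set.
Qed.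

Section layer_cake.
Local Open Scope ereal_scope.
Context d (T : measurableType d) (R : realType).
Variables (m : {sigma_finite_measure set T -> \bar R}) (phi h : T -> R) (g : R -> R).
Hypothesis mphi : measurable_fun setT phi.
Hypothesis mh : measurable_fun setT h.
Hypothesis mg : measurable_fun setT g.
Hypothesis h0 : forall y, (0 <= h y)%R.
Hypothesis g0 : forall u, (0 <= g u)%R.

(** Tonelli on the region below the graph: the set of (y, u) with phi y < u. This
    is the single tool used below to pass from volumes of sublevel sets to
    integrals. *)
Lemma layer_cake_weight :
  \int[m]_y ((h y)%:E * \int[lebesgue_measure]_(u in `](phi y), +oo[) (g u)%:E) =
  \int[lebesgue_measure]_u ((g u)%:E * \int[m]_(y in [set y | (phi y < u)%R]) (h y)%:E).
Proof.
pose F (p : T * measurableTypeR R) : \bar R := (h p.1 * g p.2 * (phi p.1 < p.2)%R%:R)%:E.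
have mlt : measurable [set p : T * measurableTypeR R | (phi p.1 < p.2)%R].
  by apply: measurable_ltset; [exact: measurableT_comp|exact: measurable_snd].
have mF : measurable_fun setT F.
  apply/measurable_EFinP; apply: measurable_funM.
    by apply: measurable_funM; exact: measurableT_comp.
  rewrite (_ : (fun _ => _) = \1_[set p : T * measurableTypeR R | (phi p.1 < p.2)%R]).
    exact: measurable_indic.
  by apply/funext => p; rewrite indic_lt.
have F0 p : 0 <= F p by rewrite lee_fin !mulr_ge0.
transitivity (\int[m]_y \int[lebesgue_measure]_u F (y, u)).
  apply: eq_integral => y _; rewrite -ge0_integralZl //; last 3 first.
  - by apply/measurable_EFinP; exact: measurable_funTS.
  - by move=> u _; rewrite lee_fin.
  - by rewrite lee_fin.
  rewrite [LHS]integral_mkcond; apply: eq_integral => u _.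
  rewrite patchE /F /=; case: ifPn.
    by move=> /set_mem /=; rewrite in_itv /= andbT => ->; rewrite mulr1.
  move=> yu'; case: ltP => [yu|]; last by rewrite mulr0.
  by move: yu'; rewrite mem_set //= in_itv /= yu.
rewrite fubini_tonelli //; apply: eq_integral => u _.
have mA : measurable [set y | (phi y < u)%R] by exact: measurable_ltset.
rewrite -ge0_integralZl //; last 3 first.
- by apply/measurable_EFinP; exact: measurable_funTS.
- by move=> y _; rewrite lee_fin.
- by rewrite lee_fin.
rewrite [RHS]integral_mkcond; apply: eq_integral => y _; rewrite patchE /F /=; case: ifPn.
  by move=> /set_mem /= ->; rewrite mulr1 mulrC.
move=> yu'; case: ltP => [yu|]; last by rewrite mulr0.
by move: yu'; rewrite mem_set.
Qed.

End layer_cake.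

Lemma layer_cake d (T : measurableType d) (R : realType)
  (m : {sigma_finite_measure set T -> \bar R}) (phi : T -> R) (g : R -> R) :
  measurable_fun setT phi -> measurable_fun setT g -> (forall u, 0 <= g u) ->
  (\int[m]_y \int[lebesgue_measure]_(u in `](phi y), +oo[) (g u)%:E =
  \int[lebesgue_measure]_u ((g u)%:E * m [set y | (phi y < u)%R]))%E.
Proof.
move=> mphi mg g0; have := @layer_cake_weight _ _ _ m phi (fun=> 1) g mphi (measurable_cst _) mg (fun=> ler01) g0.
rewrite (eq_integral (fun y => \int[lebesgue_measure]_(u in `](phi y), +oo[) (g u)%:E))%E; last first.
  by move=> y _; rewrite mul1e.
move=> ->; apply: eq_integral => u _; congr (_ * _)%E.
by rewrite integral_cst ?mul1e //; exact: measurable_ltset.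
Qed.

Section gamma_function.
Context {R : realType}.
Local Notation mu := (@lebesgue_measure R).

Definition gamma_integral (z : R) : \bar R :=
  (\int[mu]_(t in `]0%R, +oo[) (t `^ (z - 1) * expR (- t))%:E)%E.

Lemma powR_LRcontinuous (z u : R) : 0 < z -> 0 < u ->
  derivable_oo_LRcontinuous (fun s => s `^ z) 0 u.
Proof.
move=> z0 u0; split.
- move=> s; rewrite in_itv /= => /andP[s0 _]; apply: derivable_powR.
  by rewrite in_itv /= s0.
- by rewrite powR0 ?gt_eqF //; exact: powR_cvg0.
- suff h : {for u, continuous (fun s : R => s `^ z)} by apply: cvg_at_left_filter; exact: h.
  apply: differentiable_continuous.
  by apply/derivable1_diffP; apply: derivable_powR; rewrite in_itv /= u0.
Qed.

Lemma integral_powR (z u : R) : 1 <= z -> 0 < u ->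
  (\int[mu]_(s in `]0%R, u[) (z * s `^ (z - 1))%:E = (u `^ z)%:E)%E.
Proof.
move=> z1 u0; have z0 : 0 < z by exact: lt_le_trans z1.
have mf (D : set R) : measurable D -> measurable_fun D (fun s : R => (z * s `^ (z - 1))%:E).
  move=> mD; apply/measurable_EFinP; apply: measurable_funM => //.
  by apply: measurable_funTS; exact: measurable_powR.
rewrite integral_itv_bndo_bndc; last exact: mf.
rewrite integral_itv_obnd_cbnd; last exact: mf.
rewrite (@continuous_FTC2 _ _ (fun s => s `^ z)) //.
- by rewrite powR0 ?gt_eqF // sube0.
- suff h : {within `[0, u], continuous (fun s : R => s `^ (z - 1))}.
    by move=> s; apply: cvgMr; exact: h.
  have [->|zn1] := eqVneq z 1.
    rewrite subrr (_ : (fun s : R => s `^ 0) = cst 1); last first.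
      by apply/funext => s; rewrite powRr0.
    by apply: continuous_subspaceT => s; exact: cvg_cst.
  apply: derivable_oo_LRcontinuous_within; apply: powR_LRcontinuous => //.
  by rewrite subr_gt0 lt_neqAle eq_sym zn1.
- exact: powR_LRcontinuous.
- by move=> s; rewrite in_itv /= => /andP[s0 _]; rewrite powR_derive1 // in_itv /= s0.
Qed.

(** Writing t ^ z as the integral of z s ^ (z - 1) over 0 < s < t and exchanging
    the integrals replaces an integration by parts. *)
Lemma gamma_integralS (z : R) : 1 <= z ->
  gamma_integral (z + 1) = (z%:E * gamma_integral z)%E.
Proof.
move=> z1; have z0 : 0 < z by exact: lt_le_trans z1.
pose h (s : R) := z * s `^ (z - 1) * (0 < s)%R%:R.
pose g (u : R) := expR (- u) * (0 < u)%R%:R.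
have m0 : measurable_fun [set: R] (fun u : R => (0 < u)%R%:R : R).
  rewrite (_ : (fun _ => _) = \1_[set u : R | 0 < u]); last first.
    by apply/funext => u; rewrite (@indic_lt _ _ _ (fun=> 0) id).
  by apply: measurable_indic; exact: measurable_ltset.
have mh : measurable_fun setT h.
  by apply: measurable_funM => //; apply: measurable_funM => //; exact: measurable_powR.
have mg : measurable_fun setT g.
  by apply: measurable_funM => //; apply: measurableT_comp => //; exact: measurable_funN.
have h0 y : 0 <= h y by rewrite !mulr_ge0 ?powR_ge0 // ltW.
have g0 y : 0 <= g y by rewrite mulr_ge0 ?expR_ge0.
have := @layer_cake_weight _ _ _ mu id h g (@measurable_id _ _ _) mh mg h0 g0.
rewrite /gamma_integral -ge0_integralZl //; last 3 first.
- apply/measurable_EFinP; apply: measurable_funTS; apply: measurable_funM; first exact: measurable_powR.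
  by apply: measurableT_comp => //; exact: measurable_funN.
- by move=> t _; rewrite lee_fin mulr_ge0 ?powR_ge0 ?expR_ge0.
- by rewrite lee_fin ltW.
move=> E; apply: (etrans _ (etrans (esym E) _)).
  rewrite [LHS]integral_mkcond; apply: eq_integral => u _; rewrite patchE.
  case: ifPn => [/set_mem /=|hu]; last first.
    rewrite /g; case: ltP => [u0|]; last by rewrite mulr0 mul0e.
    by move: hu; rewrite mem_set //= in_itv /= u0.
  rewrite in_itv /= andbT => u0; rewrite addrK /g u0 mulr1 mulrC EFinM; congr (_ * _)%E.
  rewrite -(integral_powR z1 u0) [LHS]integral_mkcond [RHS]integral_mkcond.
  apply: eq_integral => s _; rewrite !patchE /h.
  have -> : (s \in `]0, u[%classic) = (0 < s) && (s \in [set y | y < u]).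
    apply/idP/andP => [/set_mem /=|[s0 /set_mem /= su]].
      by rewrite in_itv /= => /andP[-> su]; split => //; exact/mem_set.
    by apply/mem_set; rewrite /= in_itv /= s0.
  case: (0 < s) => /=; last by rewrite mulr0; case: ifP.
  by rewrite mulr1.
rewrite [RHS]integral_mkcond; apply: eq_integral => s _; rewrite patchE.
case: ifPn => [/set_mem /=|hs]; last first.
  rewrite /h; case: ltP => [s0|]; last by rewrite mulr0 mul0e.
  by move: hs; rewrite mem_set //= in_itv /= s0.
rewrite in_itv /= andbT => s0; rewrite /h s0 mulr1 -EFinM mulrA EFinM; congr (_ * _)%E.
have := @integral_expR_tail R 1 s ltr01; rewrite invr1 !mul1r => <-.
apply: eq_integral => u /set_mem /=; rewrite in_itv /= andbT => su.
by rewrite /g (lt_trans s0 su) mulr1 mul1r.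
Qed.

Lemma gamma_integral_ge0 z : (0 <= gamma_integral z)%E.
Proof. by apply: integral_ge0 => t _; rewrite lee_fin mulr_ge0 ?powR_ge0 ?expR_ge0. Qed.

End gamma_function.

Section ball_volume.
Context {R : realType}.
Local Notation lam := (@lebesgue_tuple R).
Local Notation mu := (@lebesgue_measure R).

Lemma measurable_ball n (r : R) : measurable [set x : n.-tuple R | enorm x < r].
Proof. by apply: measurable_ltset; [exact: measurable_enorm|exact: measurable_cst]. Qed.

Lemma ball_scale n (r : R) : 0 < r ->
  lam n [set x | enorm x < r] = ((r ^+ n)%:E * lam n [set x | (enorm x < 1)%R])%E.
Proof.
move=> r0; rewrite -[LHS]mule1 -[X in (_ * X)%E]/(1%:E) muleC -integral_cst; last exact: measurable_ball.
rewrite integral_mkcond (ge0_integral_tscale r0); last 2 first.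
- by rewrite restrict_EFin; apply/measurable_EFinP; apply/measurable_restrict => //; exact: measurable_ball.
- by move=> x; rewrite patchE; case: ifP.
congr (_ * _)%E; rewrite -[RHS]mul1e -integral_cst; last exact: measurable_ball.
rewrite [RHS]integral_mkcond; apply: eq_integral => x _; rewrite !patchE.
have -> // : (tscale r x \in [set x : n.-tuple R | enorm x < r]) = (x \in [set x : n.-tuple R | enorm x < 1]).
apply/idP/idP => /set_mem /= h; apply/mem_set => /=; move: h.
  by rewrite enorm_tscale ?ltW // -[ltRHS]mulr1 ltr_pM2l.
by move=> h; rewrite enorm_tscale ?ltW // -[ltRHS](mulr1 r) ltr_pM2l.
Qed.

(** The Gaussian integral over the space, computed as a product and by layers
    |y| ^ 2 < u, whose volume is that of the unit ball times u ^ (n / 2). *)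
Lemma ball_gamma n :
  (lam n [set x | (enorm x < 1)%R] * gamma_integral (n%:R / 2 + 1) =
   (Num.sqrt pi ^+ n)%:E)%E.
Proof.
have := integral_gaussian_tuple n (@ltr01 R); rewrite mulr1.
under eq_integral do rewrite divr1; move=> <-.
pose phi (y : n.-tuple R) := enorm y ^+ 2.
have mphi : measurable_fun setT phi by apply: measurable_funX; exact: measurable_enorm.
have me : measurable_fun setT (fun u : R => expR (- u)).
  by apply: measurableT_comp => //; exact: measurable_funN.
have e0 (u : R) : 0 <= expR (- u) by exact: expR_ge0.
have := layer_cake (lam n) mphi me e0 => E.
transitivity (\int[mu]_u ((expR (- u))%:E * lam n [set y | (phi y < u)%R]))%E.
  rewrite muleC -ge0_integralZr //; last 2 first.
  - apply/measurable_EFinP; apply: measurable_funTS; apply: measurable_funM => //; exact: measurable_powR.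
  - by move=> t _; rewrite lee_fin mulr_ge0 ?powR_ge0.
  rewrite [LHS]integral_mkcond; apply: eq_integral => u _; rewrite patchE.
  case: ifPn => [/set_mem /=|hu]; last first.
    rewrite [X in lam n X](_ : _ = set0) ?measure0 ?mule0 //.
    apply/seteqP; split=> // y /=; apply/negP; rewrite -leNgt.
    apply: (le_trans _ (sqr_ge0 _)); rewrite leNgt; apply/negP => u0.
    by move: hu; rewrite mem_set //= in_itv /= u0.
  rewrite in_itv /= andbT => u0; rewrite addrK mulrC EFinM -muleA; congr (_ * _)%E.
  rewrite [X in _ = lam n X](_ : _ = [set y | enorm y < Num.sqrt u]).
    rewrite (@ball_scale n (Num.sqrt u)) ?sqrtr_gt0 //; congr (_%:E * _)%E.
    by rewrite -powR12_sqrt ?ltW // -powR_mulrn ?powR_ge0 // -powRrM mulrC.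
  have key y : (phi y < u) = (enorm y < Num.sqrt u).
    transitivity (enorm y ^+ 2 < Num.sqrt u ^+ 2); first by rewrite sqr_sqrtr ?ltW.
    by rewrite ltr_pXn2r // nnegrE ?enorm_ge0 ?sqrtr_ge0.
  by apply/seteqP; split=> y /=; rewrite key.
rewrite -E; apply: eq_integral => y _.
have := @integral_expR_tail R 1 (phi y) ltr01; rewrite invr1 !mul1r => <-.
by apply: eq_integral => u _; rewrite mul1r.
Qed.

(** The volume of the ball is pi ^ (n / 2) / Gamma (n / 2 + 1); it is stated with
    the recursion of Gamma already applied, as this is the value of Gamma that
    enters the limiting constant. The bound on [n] keeps the exponent n / 2 - 1
    nonnegative. *)
Lemma ball_volume n : (2 <= n)%N -> exists2 v : R, 0 < v &
  (forall r, 0 < r -> lam n [set x | enorm x < r] = (v * r ^+ n)%:E) /\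
  v * (n%:R / 2 * Gamma (n%:R / 2)) = Num.sqrt pi ^+ n.
Proof.
move=> n2; have z1 : 1 <= n%:R / 2 :> R by rewrite ler_pdivlMr // mul1r ler_nat.
have := ball_gamma n; rewrite gamma_integralS //.
have : (0 <= lam n [set x | (enorm x < 1)%R])%E by exact: measure_ge0.
have := ball_scale n; have := gamma_integral_ge0 (n%:R / 2 : R).
have -> : Gamma (n%:R / 2) = fine (gamma_integral (n%:R / 2 : R)) by [].
have p0 : 0 < Num.sqrt (pi : R) ^+ n by rewrite exprn_gt0 // sqrtr_gt0 pi_gt0.
have zp : 0 < n%:R / 2 :> R by exact: lt_le_trans z1.
move=> g0 sc v0 E; move: g0 sc v0 E.
case: (lam n _) => [v| |]; case: (gamma_integral _) => [w| |] // g0 sc v0.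
- move: g0 v0; rewrite !lee_fin => w0 v0 /= [E]; exists v.
    by rewrite lt_neqAle v0 andbT; apply/eqP => v00; move: E p0; rewrite -v00 mul0r => <-; rewrite ltxx.
  by split => // r r0; rewrite sc // -EFinM mulrC.
- have [v00|v00] := eqVneq v 0.
    by rewrite v00 mul0e => -[E]; move: p0; rewrite -E ltxx.
  by rewrite gt0_muley ?lte_fin // gt0_muley // lte_fin lt_neqAle eq_sym v00 -lee_fin.
- have [w00|w00] := eqVneq w 0.
    by rewrite w00 mule0 mule0 => -[E]; move: p0; rewrite -E ltxx.
  by rewrite -EFinM gt0_mulye // lte_fin mulr_gt0 // lt_neqAle eq_sym w00 -lee_fin.
- by rewrite gt0_muley ?lte_fin // gt0_muley.
Qed.

End ball_volume.

(** * Local expansions of the distance and of the density *)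

Lemma sqr_le (R : realType) (x y : R) : 0 <= x -> x <= y -> x ^+ 2 <= y ^+ 2.
Proof. by move=> x0 xy; rewrite lerXn2r // nnegrE // (le_trans x0). Qed.

Lemma sqr_lt (R : realType) (x y : R) : 0 <= x -> x < y -> x ^+ 2 < y ^+ 2.
Proof. by move=> x0 xy; rewrite ltrXn2r // ltW. Qed.

Notation gamma_tail R c alpha beta gamma f :=
  (f x / (c * enorm x `^ alpha * expR (- beta * enorm x `^ gamma))
     @[x --> @enorm_infty R _] --> (1 : R)) (only parsing).

Notation within_factor ep u v :=
  (expR (- ep) * v <= u <= expR ep * v) (only parsing).

Section taylor.
Context {R : realType}.
Implicit Types d t : R.

Lemma ln1D_bounds d : `|d| <= 2^-1 -> d - 2 * d ^+ 2 <= ln (1 + d) <= d.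
Proof.
rewrite ler_norml => /andP[d1 d2].
have d0 : 0 < 1 + d by lra.
apply/andP; split; last by have := le_ln1Dx (x := d); apply; lra.
have : ln ((1 + d)^-1) <= (1 + d)^-1 - 1.
  have := @le_ln1Dx R ((1 + d)^-1 - 1); rewrite addrCA subrr addr0; apply.
  by rewrite ltrBrDl subrr invr_gt0.
rewrite lnV ?posrE // lerNl; apply: le_trans.
have -> : - ((1 + d)^-1 - 1) = d / (1 + d) by field; exact: lt0r_neq0.
by rewrite ler_pdivlMr //; nra.
Qed.

Lemma expR_le_quadratic t : `|t| <= 2^-1 -> expR t <= 1 + t + 2 * t ^+ 2.
Proof.
rewrite ler_norml => /andP[t1 t2].
have h := expR_ge1Dx (- t).
have t0 : 0 < 1 - t by lra.
have : expR t <= (1 - t)^-1.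
  by rewrite -[expR t]invrK -expRN lef_pV2 ?posrE ?expR_gt0.
move=> /le_trans; apply; rewrite -div1r ler_pdivrMr //; nra.
Qed.

Lemma expRN_le t : 0 < t <= 1 -> expR (- t) <= 1 - t / 2.
Proof.
move=> /andP[t0 t1]; rewrite expRN -div1r ler_pdivrMr ?expR_gt0 //.
have h : (1 - t / 2) * (1 + t) <= (1 - t / 2) * expR t.
  by rewrite ler_wpM2l ?expR_ge1Dx //; lra.
by apply: le_trans h; nra.
Qed.

End taylor.

Section geometry.
Context {R : realType}.
Variables m mu t r rho y1 Y q : R.
(** Lengths are measured in units of A. The first point is at - r on the first
    axis, the second one has first coordinate y1 and squared transversal norm Y,
    and q is its norm. All radii are within m of 1 and distances within m of 2,
    so y1 is of order 1 and Y is of order m; mu absorbs the second order terms,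
    which are of size m ^ 2. *)
Lemma geom_upper : 0 < m -> 100 * m <= 1 -> 0 < mu -> mu <= m -> 100 * m ^+ 2 <= mu ->
  0 <= Y -> 0 <= q -> q ^+ 2 = y1 ^+ 2 + Y ->
  1 - m <= r <= 1 + m -> 2 - m <= rho -> q <= 1 + m ->
  rho ^+ 2 < (r + y1) ^+ 2 + Y ->
  [/\ rho - r - mu - Y / 4 < y1, y1 + Y / 2 - mu <= q & 1 - 2 * m <= q].
Proof.
move=> m0 m1 mu0 mue mum Y0 q0 qE /andP[r1 r2] rho2 q1 h.
(* by the distance condition, 2 r y1 > rho ^ 2 - r ^ 2 - q ^ 2, about 4 - 1 - 1 *)
have A1 : 1 - 5 * m <= y1.
  rewrite leNgt; apply/negP => y15.
  have : rho ^+ 2 < r ^+ 2 + 2 * r * y1 + q ^+ 2 by rewrite qE; move: h; congr (_ < _); ring.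
  apply/negP; rewrite -leNgt.
  have a1 : (2 - m) ^+ 2 <= rho ^+ 2 by apply: sqr_le; lra.
  have a2 : r ^+ 2 <= (1 + m) ^+ 2 by apply: sqr_le; lra.
  have a3 : q ^+ 2 <= (1 + m) ^+ 2 by apply: sqr_le; lra.
  have a4 : 2 * r * y1 <= 2 * r * (1 - 5 * m) by rewrite ler_pM2l; lra.
  have a5 : 2 * r * (1 - 5 * m) <= 2 * (1 + m) * (1 - 5 * m) by rewrite ler_pM2r; lra.
  nra.
have A2 : y1 <= q.
  rewrite leNgt; apply/negP => yq.
  have yq2 : q ^+ 2 < y1 ^+ 2 by apply: sqr_lt.
  lra.
have A3 : Y <= 12 * m.
  have a3 : q ^+ 2 <= (1 + m) ^+ 2 by apply: sqr_le; lra.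
  have a4 : (1 - 5 * m) ^+ 2 <= y1 ^+ 2 by apply: sqr_le; lra.
  nra.
have Ym : Y * m <= 12 * m ^+ 2 by rewrite expr2 mulrA ler_pM2r.
have YY : Y ^+ 2 <= 144 * m ^+ 2.
  have -> : 144 * m ^+ 2 = (12 * m) ^+ 2 by ring.
  by apply: sqr_le; lra.
split.
- rewrite ltNge; apply/negP => a.
  have b1 : (r + y1 + Y / 4 + mu) ^+ 2 <= rho ^+ 2 by apply: sqr_le; lra.
  have b2 : Y * (2 - 6 * m) <= Y * (r + y1) by rewrite ler_wpM2l //; lra.
  have b3 : mu * (2 - 6 * m) <= mu * (r + y1) by rewrite ler_pM2l //; lra.
  have b4 := sqr_ge0 (Y / 4 + mu).
  have b5 : mu * m <= mu * 1 by rewrite ler_pM2l //; lra.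
  have : (r + y1 + Y / 4 + mu) ^+ 2 = (r + y1) ^+ 2 + Y * (r + y1) / 2 + 2 * (mu * (r + y1)) + (Y / 4 + mu) ^+ 2 by field.
  nra.
- rewrite leNgt; apply/negP => a.
  have b1 : q ^+ 2 < (y1 + Y / 2 - mu) ^+ 2 by apply: sqr_lt; lra.
  have b2 : Y * y1 <= Y * (1 + m) by rewrite ler_wpM2l //; lra.
  have b3 : mu * (1 - 5 * m) <= mu * y1 by rewrite ler_pM2l //; lra.
  have b4 : mu * mu <= mu * m by rewrite ler_pM2l.
  have b5 : 0 <= mu * Y by rewrite mulr_ge0 // ltW.
  have b6 : mu * m <= mu * 100^-1 by rewrite ler_pM2l //; lra.
  have E : (y1 + Y / 2 - mu) ^+ 2 = y1 ^+ 2 + Y * y1 + Y ^+ 2 / 4 - 2 * (mu * y1) - mu * Y + mu * mu by field.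
  nra.
- have : r + y1 <= r + q by lra.
  have b1 : rho ^+ 2 < (r + q) ^+ 2.
    apply: (lt_le_trans h); have : r * y1 <= r * q by rewrite ler_pM2l; lra.
    nra.
  have : rho < r + q by rewrite -(@ltr_pXn2r _ 2) // nnegrE; lra.
  lra.
Qed.

(** Conversely, the distance condition holds above the critical value of y1 raised
    by mu; the bounds by t confine the point to the vicinity of the antipode, so
    that its norm is controlled. *)
Lemma geom_lower : 0 < m -> 100 * m <= 1 -> 0 < mu -> mu <= m -> 100 * m ^+ 2 <= mu ->
  0 <= Y -> 0 <= q -> q ^+ 2 = y1 ^+ 2 + Y ->
  1 - m <= r <= 1 + m -> 2 - m <= rho <= 2 + m ->
  0 < t <= m -> Y <= 4 * t ->
  rho - r + mu - Y / 4 < y1 <= rho - r + mu - Y / 4 + t ->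
  [/\ rho ^+ 2 < (r + y1) ^+ 2 + Y, q <= y1 + Y / 2 + mu,
      q <= rho - r + 2 * mu + 2 * t & 1 - 3 * m <= q].
Proof.
move=> m0 m1 mu0 mue mum Y0 q0 qE /andP[r1 r2] /andP[h1 h2] /andP[eM0 eM] YM.
move=> /andP[y11 y12].
have A1 : 1 - 3 * m <= y1 by lra.
have A2 : y1 <= q.
  rewrite leNgt; apply/negP => yq.
  have yq2 : q ^+ 2 < y1 ^+ 2 by apply: sqr_lt.
  lra.
have Ym : Y * m <= 4 * m ^+ 2.
  by rewrite expr2 mulrA ler_pM2r // (le_trans YM) // ler_pM2l.
have B : q <= y1 + Y / 2 + mu.
  rewrite leNgt; apply/negP => a.
  have b1 : (y1 + Y / 2 + mu) ^+ 2 < q ^+ 2 by apply: sqr_lt; lra.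
  have b2 : Y * (1 - 3 * m) <= Y * y1 by rewrite ler_wpM2l.
  have b3 : mu * (1 - 3 * m) <= mu * y1 by rewrite ler_pM2l.
  have b4 : mu * m <= mu * 100^-1 by rewrite ler_pM2l //; lra.
  have b5 := sqr_ge0 (Y / 2 + mu).
  have E : (y1 + Y / 2 + mu) ^+ 2 = y1 ^+ 2 + Y * y1 + 2 * (mu * y1) + (Y / 2 + mu) ^+ 2 by field.
  nra.
split => //; last 2 first.
- lra.
- lra.
have b1 : (rho + mu - Y / 4) ^+ 2 < (r + y1) ^+ 2 by apply: sqr_lt; lra.
have b2 : Y * rho <= Y * (2 + m) by rewrite ler_wpM2l.
have b3 : mu * (2 - m) <= mu * rho by rewrite ler_pM2l.
have b4 : mu * m <= mu * 100^-1 by rewrite ler_pM2l //; lra.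
have b5 := sqr_ge0 (mu - Y / 4).
have E : (rho + mu - Y / 4) ^+ 2 = rho ^+ 2 + 2 * (mu * rho) - Y * rho / 2 + (mu - Y / 4) ^+ 2 by field.
lra.
Qed.

End geometry.

Section window.
Context {R : realType}.
Variables (c alpha beta gamma : R).
Hypothesis hc : 0 < c.
Hypothesis hbeta : 0 < beta.
Hypothesis hgamma : 0 < gamma.

Definition rad_density (q : R) := c * q `^ alpha * expR (- beta * q `^ gamma).

(** At A (1 + d) the exponent is l (1 + d) ^ gamma = l + gamma l d + O(l d ^ 2) and
    the power contributes a factor e ^ O(d). *)
Lemma rad_density_window (l A d ep : R) : 0 < A -> beta * A `^ gamma = l -> 0 < l ->
  `|d| <= 2^-1 -> `|gamma * d| <= 2^-1 ->
  2 * `|alpha| * `|d| + 2 * (gamma ^+ 2 + gamma) * l * d ^+ 2 <= ep ->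
  within_factor ep (rad_density (A * (1 + d))) (c * A `^ alpha * expR (- l) * expR (- (gamma * l * d))).
Proof.
move=> A0 AE l0 d1 gd epE.
have d0 : 0 < 1 + d by move: d1; rewrite ler_norml => /andP[]; lra.
have /andP[ln1 ln2] := ln1D_bounds d1.
have lna : `|alpha * ln (1 + d)| <= 2 * `|alpha| * `|d|.
  have -> : 2 * `|alpha| * `|d| = `|alpha| * (2 * `|d|) by ring.
  rewrite normrM ler_wpM2l //.
  have : `|ln (1 + d)| <= `|d| + 2 * d ^+ 2.
    rewrite ler_norml; have := ler_norm d; have := ler_norm (- d); rewrite normrN.
    have := sqr_ge0 d; lra.
  move=> /le_trans; apply.
  have -> : d ^+ 2 = `|d| * `|d| by rewrite -expr2 real_normK // num_real.
  have : `|d| * `|d| <= `|d| * 2^-1 by rewrite ler_wpM2l.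
  lra.
have pw : `|(1 + d) `^ gamma - 1 - gamma * d| <= 2 * (gamma ^+ 2 + gamma) * d ^+ 2.
  rewrite /powR gt_eqF // ler_norml.
  have a1 : expR (gamma * ln (1 + d)) <= expR (gamma * d) by rewrite ler_expR ler_pM2l.
  have a2 := expR_le_quadratic gd.
  have a3 := expR_ge1Dx (gamma * ln (1 + d)).
  have a4 : gamma * (d - 2 * d ^+ 2) <= gamma * ln (1 + d) by rewrite ler_pM2l.
  have a5 := sqr_ge0 d.
  have a6 : 0 <= gamma * d ^+ 2 by rewrite mulr_ge0 // ltW.
  have a7 : 0 <= gamma ^+ 2 * d ^+ 2 by rewrite mulr_ge0 // sqr_ge0.
  by apply/andP; split; nra.
have E : rad_density (A * (1 + d)) = c * A `^ alpha * expR (- l) * expR (- (gamma * l * d)) *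
   expR (alpha * ln (1 + d) - l * ((1 + d) `^ gamma - 1 - gamma * d)).
  rewrite /rad_density !powRM ?ltW //.
  have -> : - beta * (A `^ gamma * (1 + d) `^ gamma) = - l * (1 + d) `^ gamma.
    by rewrite mulrA mulNr AE.
  have -> : (1 + d) `^ alpha = expR (alpha * ln (1 + d)) by rewrite /powR gt_eqF.
  rewrite -!mulrA; congr (_ * (_ * _)).
  rewrite -!expRD; congr expR; ring.
have err : `|alpha * ln (1 + d) - l * ((1 + d) `^ gamma - 1 - gamma * d)| <= ep.
  apply: le_trans epE; apply: (le_trans (ler_normB _ _)); apply: lerD => //.
  rewrite normrM gtr0_norm //.
  have -> : 2 * (gamma ^+ 2 + gamma) * l * d ^+ 2 = l * (2 * (gamma ^+ 2 + gamma) * d ^+ 2) by ring.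
  by rewrite ler_pM2l.
move: err; rewrite ler_norml => /andP[err1 err2].
rewrite E; set h := c * A `^ alpha * expR (- l) * _.
have h0 : 0 < h by rewrite !mulr_gt0 ?expR_gt0 // powR_gt0.
by rewrite ![_ * h]mulrC !ler_pM2l // !ler_expR err1.
Qed.

End window.

(** * Exponential integrals above a paraboloid *)

Section half_space.
Context {R : realType} {k : nat}.
Local Notation lam := (@lebesgue_tuple R).
Local Notation mu := (@lebesgue_measure R).
Variables (A b C z0 : R) (F : k.+1.-tuple R -> R).

Let measurable_expN (a : R) : measurable_fun [set: R] (fun t : R => expR (- (a * t))).
Proof. by apply: measurableT_comp => //; apply: measurable_funN => //; exact: measurable_funM. Qed.

Let measurable_expsq (a : R) : measurable_fun [set: k.-tuple R] (fun y : k.-tuple R => expR (- (enorm y ^+ 2 / a))).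
Proof.
apply: measurableT_comp => //; apply: measurable_funN => //.
by apply: measurable_funM => //; apply: measurable_funX; exact: measurable_enorm.
Qed.

Ltac mexp := first
  [ apply/measurable_EFinP; apply: measurable_funTS; exact: measurable_expN
  | apply/measurable_EFinP; apply: measurable_funTS; exact: measurable_expsq
  | apply: measurable_funeM; apply/measurable_EFinP; apply: measurable_funTS; exact: measurable_expN
  | apply: measurable_funeM; apply/measurable_EFinP; apply: measurable_funTS; exact: measurable_expsq ].

Lemma measurable_integral_tcons : measurable_fun setT F -> (forall y, 0 <= F y) ->
  measurable_fun setT (fun y : k.-tuple R => \int[mu]_t (F (tcons t y))%:E)%E.
Proof.
move=> mF F0.
apply: (@measurable_fun_fubini_tonelli_G _ _ _ _ _ mu (fun p : R * k.-tuple R => (F (tcons p.1 p.2))%:E)) => //.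
- apply/measurable_EFinP; exact: (measurableT_comp mF (@measurable_tcons R k)).
- by move=> p; rewrite lee_fin.
Qed.

Lemma integral_expR_segment (M z : R) : 0 < b -> 0 < M ->
  (\int[mu]_(t in `]z, (z + b * M)%R]) (expR (- (b^-1 * t)))%:E =
  (b * expR (- (z / b)) * (1 - expR (- M)))%:E)%E.
Proof.
move=> b0 M0.
have bi0 : 0 < b^-1 by rewrite invr_gt0.
have bM : z < z + b * M by rewrite ltrDl mulr_gt0.
have := integral_expR_tail z bi0.
rewrite (_ : `]z, +oo[%classic = `]z, (z + b * M)] `|` `](z + b * M), +oo[); last first.
  apply/seteqP; split => t /=; rewrite !in_itv /= ?andbT.
    by move=> zt; rewrite zt /=; case: (leP t (z + b * M)) => h; [left|right].
  by move=> [/andP[]//|]; exact: lt_trans.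
rewrite ge0_integral_setU //=; last first.
- apply/disj_setPS => t [] /=; rewrite !in_itv /= andbT => /andP[_ h1] h2.
  by move: (le_lt_trans h1 h2); rewrite ltxx.
- mexp.
rewrite (integral_expR_tail _ bi0) invrK => E.
have -> : b * expR (- (z / b)) * (1 - expR (- M)) =
  b * expR (- (b^-1 * z)) - b * expR (- (b^-1 * (z + b * M))).
  have -> : b^-1 * (z + b * M) = z / b + M by field; exact: lt0r_neq0.
  rewrite opprD expRD (mulrC _ z); ring.
by rewrite EFinB -E addeK.
Qed.

(** Integrating e ^ (- t / b) above the paraboloid t = z0 - |y| ^ 2 / (4 A)
    produces e ^ (|y| ^ 2 / (4 A b)), which cancels half of the Gaussian exponent
    |y| ^ 2 / (2 A b); a Gaussian integral with exponent |y| ^ 2 / (4 A b) remains. *)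
Lemma half_space_upper : 0 < A -> 0 < b -> 0 <= C ->
  measurable_fun setT F -> (forall y, 0 <= F y) ->
  (forall t y, F (tcons t y) <=
    C * expR (- (b^-1 * t)) * expR (- (enorm y ^+ 2 / (2 * A * b))) *
    (z0 - enorm y ^+ 2 / (4 * A) < t)%R%:R) ->
  (\int[lam k.+1]_y (F y)%:E <=
   (C * b * expR (- (z0 / b)) * Num.sqrt (pi * (4 * A * b)) ^+ k)%:E)%E.
Proof.
move=> A0 b0 C0 mF F0 FU.
have bi0 : 0 < b^-1 by rewrite invr_gt0.
have s0 : 0 < 4 * A * b by rewrite !mulr_gt0.
rewrite ge0_integral_tcons //; last by apply/measurable_EFinP.
have -> : ((C * b * expR (- (z0 / b)) * Num.sqrt (pi * (4 * A * b)) ^+ k)%:E =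
  \int[lam k]_y ((C * b * expR (- (z0 / b)))%:E * (expR (- (enorm y ^+ 2 / (4 * A * b))))%:E))%E.
  rewrite ge0_integralZl //.
  - by rewrite integral_gaussian_tuple // EFinM.
  - mexp.
  - by rewrite lee_fin mulr_ge0 ?expR_ge0 // mulr_ge0 // ltW.
apply: ge0_le_integral => //.
- by move=> y _; apply: integral_ge0 => t _; rewrite lee_fin.
- exact: measurable_integral_tcons.
- mexp.
move=> y _.
set z := z0 - enorm y ^+ 2 / (4 * A).
set D := C * expR (- (enorm y ^+ 2 / (2 * A * b))).
have D0 : 0 <= D by rewrite mulr_ge0 ?expR_ge0.
apply: (@le_trans _ _ (\int[mu]_(t in `]z, +oo[) (D%:E * (expR (- (b^-1 * t)))%:E)))%E.
  rewrite [leRHS]integral_mkcond; apply: ge0_le_integral => //.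
  - by move=> t _; rewrite lee_fin.
  - apply/measurable_EFinP; exact: (measurableT_comp mF (@measurable_tconsl R k y)).
  - apply/(measurable_restrictT _ _).1 => //; mexp.
  - move=> t _; rewrite patchE; case: ifPn => [/set_mem /=|ht].
      rewrite in_itv /= andbT => zt; rewrite lee_fin (le_trans (FU _ _)) // zt mulr1 /D.
      by rewrite mulrAC.
    rewrite lee_fin (le_trans (FU _ _)) //.
    by case: ltP => [zt|]; [move: ht; rewrite mem_set //= in_itv /= zt|rewrite mulr0].
rewrite ge0_integralZl //; last by mexp.
rewrite integral_expR_tail // -EFinM lee_fin invrK /D.
have -> : expR (- (b^-1 * z)) = expR (- (z0 / b)) * expR (enorm y ^+ 2 / (4 * A * b)).
  by rewrite -expRD; congr expR; rewrite /z; field; rewrite !gt_eqF.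
have -> : expR (- (enorm y ^+ 2 / (2 * A * b))) =
   expR (- (enorm y ^+ 2 / (4 * A * b))) * expR (- (enorm y ^+ 2 / (4 * A * b))).
  by rewrite -expRD; congr expR; field; rewrite !gt_eqF.
rewrite le_eqVlt; apply/orP; left; apply/eqP.
have E : expR (- (enorm y ^+ 2 / (4 * A * b))) * expR (enorm y ^+ 2 / (4 * A * b)) = 1.
  by rewrite -expRD addNr expR0.
transitivity (C * b * expR (- (z0 / b)) * expR (- (enorm y ^+ 2 / (4 * A * b))) *
  (expR (- (enorm y ^+ 2 / (4 * A * b))) * expR (enorm y ^+ 2 / (4 * A * b)))).
  ring.
by rewrite E mulr1.
Qed.

(** On the removed set, half of the exponent is at least M / 2, and the other half
    is a Gaussian of twice the variance. *)
Lemma gaussian_truncated (s M : R) : 0 < s -> 0 < M ->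
  ((Num.sqrt (pi * s) ^+ k * (1 - expR (- (M / 2)) * Num.sqrt 2 ^+ k))%:E <=
   \int[lam k]_(y in [set y | (enorm y ^+ 2 < s * M)%R]) (expR (- (enorm y ^+ 2 / s)))%:E)%E.
Proof.
move=> s0 M0.
have s20 : 0 < 2 * s by rewrite mulr_gt0.
have mS : measurable [set y : k.-tuple R | enorm y ^+ 2 < s * M].
  by apply: measurable_ltset; [apply: measurable_funX; exact: measurable_enorm|exact: measurable_cst].
rewrite mulrBr mulr1 EFinB leeBlDr //.
have -> : (Num.sqrt (pi * s) ^+ k * (expR (- (M / 2)) * Num.sqrt 2 ^+ k))%:E =
  (\int[lam k]_y ((expR (- (M / 2)))%:E * (expR (- (enorm y ^+ 2 / (2 * s))))%:E))%E.
  rewrite ge0_integralZl //.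
  - rewrite integral_gaussian_tuple // -EFinM mulrCA -exprMn -sqrtrM.
      by congr ((_ * _ ^+ _)%:E); rewrite mulrCA mulrC.
    by rewrite mulr_ge0 ?pi_ge0 // ltW.
  - mexp.
rewrite -(integral_gaussian_tuple k s0) [X in (_ <= X + _)%E]integral_mkcond -ge0_integralD //; last 3 first.
- by move=> y _; rewrite patchE; case: ifP.
- by apply/(measurable_restrictT _ _).1 => //; mexp.
- mexp.
apply: ge0_le_integral => //.
- mexp.
- apply: emeasurable_funD.
    by apply/(measurable_restrictT _ _).1 => //; mexp.
  mexp.
move=> y _; rewrite patchE; case: ifPn => [_|hy].
  by rewrite leeDl // lee_fin mulr_ge0 ?expR_ge0.
rewrite add0e -EFinM lee_fin -expRD ler_expR -opprD lerN2.
have Ys : s * M <= enorm y ^+ 2.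
  by rewrite leNgt; apply/negP => h; move: hy; rewrite mem_set.
have -> : enorm y ^+ 2 / (2 * s) = enorm y ^+ 2 / s / 2 by field; exact: lt0r_neq0.
have : M <= enorm y ^+ 2 / s by rewrite ler_pdivlMr // mulrC.
lra.
Qed.

(** The lower bound on F is only available near the vertex of the paraboloid and
    close to its surface; the parameter M, to be taken large, measures both. *)
Lemma half_space_lower (M : R) : 0 < A -> 0 < b -> 0 <= C -> 0 < M ->
  measurable_fun setT F -> (forall y, 0 <= F y) ->
  (forall t y, enorm y ^+ 2 < 4 * A * b * M ->
     z0 - enorm y ^+ 2 / (4 * A) < t <= z0 - enorm y ^+ 2 / (4 * A) + b * M ->
    C * expR (- (b^-1 * t)) * expR (- (enorm y ^+ 2 / (2 * A * b))) <= F (tcons t y)) ->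
  ((C * b * expR (- (z0 / b)) * (1 - expR (- M)) *
   (Num.sqrt (pi * (4 * A * b)) ^+ k * (1 - expR (- (M / 2)) * Num.sqrt 2 ^+ k)))%:E
   <= \int[lam k.+1]_y (F y)%:E)%E.
Proof.
move=> A0 b0 C0 M0 mF F0 FL.
have bi0 : 0 < b^-1 by rewrite invr_gt0.
have s0 : 0 < 4 * A * b by rewrite !mulr_gt0.
rewrite ge0_integral_tcons //; last by apply/measurable_EFinP.
have mS : measurable [set y : k.-tuple R | enorm y ^+ 2 < 4 * A * b * M].
  by apply: measurable_ltset; [apply: measurable_funX; exact: measurable_enorm|exact: measurable_cst].
have K0 : 0 <= C * b * expR (- (z0 / b)) * (1 - expR (- M)).
  rewrite mulr_ge0 ?mulr_ge0 ?expR_ge0 ?(ltW b0) // subr_ge0 -expR0 ler_expR oppr_le0 ltW //.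
apply: (@le_trans _ _ (\int[lam k]_(y in [set y | (enorm y ^+ 2 < 4 * A * b * M)%R])
  ((C * b * expR (- (z0 / b)) * (1 - expR (- M)))%:E * (expR (- (enorm y ^+ 2 / (4 * A * b))))%:E)))%E.
  rewrite ge0_integralZl //; last by mexp.
  by rewrite EFinM lee_wpmul2l // gaussian_truncated.
rewrite integral_mkcond; apply: ge0_le_integral => //.
- by move=> y _; rewrite patchE; case: ifP => // _; rewrite -EFinM lee_fin mulr_ge0 ?expR_ge0.
- apply/(measurable_restrictT _ _).1 => //; mexp.
- exact: measurable_integral_tcons.
move=> y _; rewrite patchE; case: ifPn => [/set_mem /= hy|_]; last by apply: integral_ge0 => t _; rewrite lee_fin.
set z := z0 - enorm y ^+ 2 / (4 * A).
set D := C * expR (- (enorm y ^+ 2 / (2 * A * b))).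
have D0 : 0 <= D by rewrite mulr_ge0 ?expR_ge0.
apply: (@le_trans _ _ (\int[mu]_(t in `]z, (z + b * M)%R]) (D%:E * (expR (- (b^-1 * t)))%:E)))%E; last first.
  rewrite [leLHS]integral_mkcond; apply: ge0_le_integral => //.
  - by move=> t _; rewrite patchE; case: ifP => // _; rewrite -EFinM lee_fin mulr_ge0 ?expR_ge0.
  - apply/(measurable_restrictT _ _).1 => //; mexp.
  - apply/measurable_EFinP; exact: (measurableT_comp mF (@measurable_tconsl R k y)).
  - move=> t _; rewrite patchE; case: ifPn => [/set_mem /=|ht]; last by rewrite lee_fin.
    rewrite in_itv /= => zt; rewrite lee_fin (le_trans _ (FL _ _ hy zt)) // /D.
    by rewrite mulrAC.
rewrite ge0_integralZl //; last by mexp.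
rewrite integral_expR_segment // -!EFinM lee_fin /D.
have -> : expR (- (z / b)) = expR (- (z0 / b)) * expR (enorm y ^+ 2 / (4 * A * b)).
  by rewrite -expRD; congr expR; rewrite /z; field; rewrite !gt_eqF.
have -> : expR (- (enorm y ^+ 2 / (2 * A * b))) =
   expR (- (enorm y ^+ 2 / (4 * A * b))) * expR (- (enorm y ^+ 2 / (4 * A * b))).
  by rewrite -expRD; congr expR; field; rewrite !gt_eqF.
rewrite le_eqVlt; apply/orP; left; apply/eqP.
have E : expR (- (enorm y ^+ 2 / (4 * A * b))) * expR (enorm y ^+ 2 / (4 * A * b)) = 1.
  by rewrite -expRD addNr expR0.
transitivity (C * b * expR (- (z0 / b)) * (1 - expR (- M)) * expR (- (enorm y ^+ 2 / (4 * A * b))) *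
  (expR (- (enorm y ^+ 2 / (4 * A * b))) * expR (enorm y ^+ 2 / (4 * A * b)))).
  by rewrite E mulr1.
ring.
Qed.

End half_space.

(** * The density around the typical radius *)

Section near_infinity.
Context {R : realType}.

Lemma near_pinfty_ge (M : R) : \forall l \near +oo, M <= l.
Proof. by apply: nbhs_pinfty_ge; exact: num_real. Qed.

Lemma near_ln_ge (M : R) : \forall l \near +oo, M <= ln l.
Proof.
near=> l.
have h : expR M <= l by near: l; exact: near_pinfty_ge.
by rewrite -[M]expRK ler_ln ?posrE ?expR_gt0 // (lt_le_trans _ h) ?expR_gt0.
Unshelve. all: by end_near. Qed.

Lemma near_lnln_ge (M : R) : \forall l \near +oo, M <= ln (ln l).
Proof.
near=> l.
have h : expR M <= ln l by near: l; exact: near_ln_ge.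
by rewrite -[M]expRK ler_ln ?posrE ?expR_gt0 // (lt_le_trans _ h) ?expR_gt0.
Unshelve. all: by end_near. Qed.

Lemma near_ln_sqr_le (ep : R) : 0 < ep -> \forall l \near +oo, ln l ^+ 2 <= ep * l.
Proof.
move=> ep0; near=> l.
have l1 : 1 <= l by near: l; exact: near_pinfty_ge.
have l0 : 0 < l by exact: lt_le_trans l1.
have h : (16 / ep) ^+ 2 <= l by near: l; exact: near_pinfty_ge.
(* log l = 4 log t <= 4 t for t the fourth root of l *)
pose s := Num.sqrt l; pose t := Num.sqrt s.
have s0 : 0 < s by rewrite sqrtr_gt0.
have t0 : 0 < t by rewrite sqrtr_gt0.
have st : s = t ^+ 2 by rewrite sqr_sqrtr // ltW.
have ls : l = s ^+ 2 by rewrite sqr_sqrtr // ltW.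
have lt4 : ln l = 4 * ln t by rewrite ls st -exprM lnXn // mulr_natl.
have ln0 : 0 <= ln l by exact: ln_ge0.
have : ln l <= 4 * t.
  rewrite lt4 ler_pM2l //.
  have := @le_ln1Dx R (t - 1); rewrite addrCA subrr addr0 => lnt.
  have : ln t <= t - 1 by apply: lnt; lra.
  lra.
move=> h4; have h5 : ln l ^+ 2 <= 16 * s.
  have -> : 16 * s = (4 * t) ^+ 2 by rewrite st; ring.
  by apply: sqr_le.
apply: (le_trans h5).
have e16 : 0 <= 16 / ep by rewrite divr_ge0 // ltW.
have : 16 / ep <= s.
  by move: h; rewrite [X in _ <= X]ls ler_pXn2r // nnegrE // ltW.
rewrite ler_pdivrMr // => h6.
by rewrite [X in _ <= _ * X]ls expr2 mulrA ler_pM2r // mulrC.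
Unshelve. all: by end_near. Qed.

End near_infinity.

Section scales.
Context {R : realType}.
Variables (c alpha beta gamma : R).

(** The radius at which the exponent beta |x| ^ gamma equals l. *)
Definition scaleA (l : R) := (l / beta) `^ gamma^-1.
(** The inverse of the derivative of beta |x| ^ gamma at the radius [scaleA l]. *)
Definition scaleb (l : R) := scaleA l / (gamma * l).
(** The asymptotic form of the density at the radius [scaleA l]. *)
Definition peak (l : R) := c * scaleA l `^ alpha * expR (- l).

Lemma scaleA_gt0 l : 0 < beta -> 0 < l -> 0 < scaleA l.
Proof. by move=> b0 l0; rewrite powR_gt0 // divr_gt0. Qed.

Lemma scaleb_gt0 l : 0 < beta -> 0 < gamma -> 0 < l -> 0 < scaleb l.
Proof. by move=> b0 g0 l0; rewrite divr_gt0 ?scaleA_gt0 // mulr_gt0. Qed.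

Lemma scaleAE l : 0 < beta -> 0 < gamma -> 0 < l -> beta * scaleA l `^ gamma = l.
Proof.
move=> b0 g0 l0; rewrite -powRrM mulVf ?gt_eqF // powRr1; last by rewrite divr_ge0 // ltW.
by rewrite mulrCA mulfV ?mulr1 // gt_eqF.
Qed.

Lemma near_scaleA_ge (M : R) : 0 < beta -> 0 < gamma -> \forall l \near +oo, M <= scaleA l.
Proof.
move=> b0 g0; near=> l.
have h : beta * `|M| `^ gamma <= l by near: l; exact: near_pinfty_ge.
apply: (le_trans (ler_norm M)); rewrite /scaleA.
have -> : `|M| = (`|M| `^ gamma) `^ gamma^-1.
  by rewrite -powRrM mulfV ?gt_eqF // powRr1.
have a1 : `|M| `^ gamma <= l / beta by rewrite ler_pdivlMr // mulrC.
have a2 : 0 <= `|M| `^ gamma by exact: powR_ge0.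
by apply: ge0_ler_powR; rewrite ?invr_ge0 ?nnegrE ?(le_trans a2 a1) // ltW.
Unshelve. all: by end_near. Qed.

(** Here d = s / (gamma l) is O(log l / l), so the error terms of
    [rad_density_window] are O((log l) ^ 2 / l). The third conclusion is the
    inequality needed to apply the geometric expansions with m = K log l / (gamma l)
    and mu = ep / (gamma l). *)
Lemma window_near (K ep : R) : 0 < c -> 0 < beta -> 0 < gamma -> 0 < K -> 0 < ep <= 1 ->
  \forall l \near +oo, [/\ 0 < l, 1 <= K * ln l,
    100 * ((gamma * l)^-1 * (K * ln l) ^+ 2) <= ep &
    forall s, `|s| <= K * ln l ->
      within_factor ep (rad_density c alpha beta gamma (scaleA l + scaleb l * s)) (peak l * expR (- s))].
Proof.
move=> c0 b0 g0 K0 /andP[ep0 ep1].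
pose T := 100 / gamma + 2 + 2 * `|alpha| / gamma + 2 * (gamma ^+ 2 + gamma) / gamma ^+ 2.
have T1 : 0 <= 100 / gamma by rewrite divr_ge0 // ltW.
have T2 : 0 <= 2 * `|alpha| / gamma by rewrite divr_ge0 // ltW.
have T3 : 0 <= 2 * (gamma ^+ 2 + gamma) / gamma ^+ 2.
  by rewrite divr_ge0 ?sqr_ge0 // mulr_ge0 // addr_ge0 ?sqr_ge0 // ltW.
have T0 : 0 < T by rewrite /T; lra.
near=> l.
have l0 : 0 < l by near: l; exact: nbhs_pinfty_gt.
have L1 : K^-1 <= ln l by near: l; exact: near_ln_ge.
have L2 : ln l ^+ 2 <= (ep / T / K ^+ 2) * l.
  by near: l; apply: near_ln_sqr_le; rewrite !divr_gt0 // exprn_gt0.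
have KL : 1 <= K * ln l by rewrite -ler_pdivrMl // mulr1.
set Lam := K * ln l in KL *.
set X := Lam ^+ 2 / l.
have XT : X * T <= ep.
  rewrite -ler_pdivlMr // /X ler_pdivrMr // /Lam exprMn.
  have -> : ep / T * l = K ^+ 2 * (ep / T / K ^+ 2 * l).
    by field; rewrite !gt_eqF.
  by rewrite ler_pM2l // exprn_gt0.
have X0 : 0 <= X by rewrite divr_ge0 ?sqr_ge0 // ltW.
have X1 : X * (100 / gamma) <= ep.
  by apply: le_trans XT; rewrite ler_wpM2l // /T; lra.
have X2 : X * 2 <= ep.
  by apply: le_trans XT; rewrite ler_wpM2l // /T; lra.
have X3 : X * (2 * `|alpha| / gamma + 2 * (gamma ^+ 2 + gamma) / gamma ^+ 2) <= ep.
  by apply: le_trans XT; rewrite ler_wpM2l // /T; lra.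
have LX : Lam / l <= X.
  by rewrite /X ler_pM2r ?invr_gt0 // expr2 ler_peMl // (le_trans ler01).
split => //.
  apply: le_trans X1; rewrite le_eqVlt; apply/orP; left; apply/eqP.
  by rewrite /X; field; rewrite !gt_eqF.
move=> s sL; pose d := s / (gamma * l).
have gl0 : 0 < gamma * l by rewrite mulr_gt0.
have dl : `|d| <= Lam / l / gamma.
  rewrite /d normrM (gtr0_norm (x := (gamma * l)^-1)) ?invr_gt0 // -mulrA -invfM (mulrC l).
  by rewrite ler_pM2r // invr_gt0.
have dX : `|d| <= X / gamma by apply: (le_trans dl); rewrite ler_pM2r ?invr_gt0.
have dE : scaleA l + scaleb l * s = scaleA l * (1 + d).
  by rewrite /scaleb /d; field; rewrite !gt_eqF.
have sE : gamma * l * d = s by rewrite /d mulrC divfK // gt_eqF.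
have gd : `|gamma * d| <= 2^-1.
  rewrite normrM gtr0_norm // mulrC -ler_pdivlMr //; apply: (le_trans dX).
  by rewrite ler_pM2r ?invr_gt0 //; lra.
have d1 : `|d| <= 2^-1.
  apply: (le_trans dX).
  have : X * (100 / gamma) = 100 * (X / gamma) by ring.
  lra.
have d2 : l * d ^+ 2 = s ^+ 2 / l / gamma ^+ 2.
  by rewrite /d; field; rewrite !gt_eqF.
have d3 : l * d ^+ 2 <= X / gamma ^+ 2.
  rewrite d2 ler_pM2r ?invr_gt0 ?exprn_gt0 // /X ler_pM2r ?invr_gt0 //.
  rewrite -[s ^+ 2]real_normK ?num_real //; apply: sqr_le => //.
rewrite dE -[in expR (- s)]sE; apply: rad_density_window => //.
- exact: scaleA_gt0.
- exact: scaleAE.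
- apply: le_trans X3; rewrite [leRHS]mulrDr; apply: lerD.
    have -> : X * (2 * `|alpha| / gamma) = 2 * `|alpha| * (X / gamma) by ring.
    by rewrite ler_wpM2l // mulr_ge0.
  have -> : X * (2 * (gamma ^+ 2 + gamma) / gamma ^+ 2) = 2 * (gamma ^+ 2 + gamma) * (X / gamma ^+ 2) by ring.
  by rewrite -mulrA ler_wpM2l // mulr_ge0 // addr_ge0 ?sqr_ge0 // ltW.
Unshelve. all: by end_near. Qed.

Variables (d : nat) (f : d.-tuple R -> R).

(** The tail hypothesis in multiplicative form, which is stable under products. *)
Lemma density_ratio (ep : R) : 0 < c -> 0 < ep ->
  gamma_tail R c alpha beta gamma f ->
  exists M, 0 <= M /\ forall y, M < enorm y ->
    expR (- ep) * rad_density c alpha beta gamma (enorm y) <= f y <=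
    expR ep * rad_density c alpha beta gamma (enorm y).
Proof.
move=> c0 ep0 hf.
have del0 : 0 < 1 - expR (- ep) by rewrite subr_gt0 -[ltRHS]expR0 ltr_expR oppr_lt0.
have /cvgrPdist_lt/(_ _ del0) [M _ HM] := hf.
exists `|M|; split => // y My.
have : M < enorm y by apply: le_lt_trans My; exact: ler_norm.
move=> /HM /=; rewrite -/(rad_density c alpha beta gamma (enorm y)).
set rd := rad_density _ _ _ _ _.
have rd0 : 0 < rd.
  by rewrite /rd /rad_density !mulr_gt0 ?expR_gt0 // powR_gt0 // (le_lt_trans _ My).
rewrite ltr_norml => /andP[h1 h2].
have h3 := expR_ge1Dx ep; have h4 := expR_ge1Dx (- ep).
by apply/andP; split; [rewrite -ler_pdivlMr //|rewrite -ler_pdivrMr //]; lra.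
Qed.

Lemma density_window (K ep : R) : 0 < c -> 0 < beta -> 0 < gamma -> 0 < K -> 0 < ep <= 1 ->
  gamma_tail R c alpha beta gamma f ->
  \forall l \near +oo,
    forall y, `|enorm y - scaleA l| <= scaleb l * (K * ln l) ->
      within_factor ep (f y) (peak l * expR (- ((enorm y - scaleA l) / scaleb l))).
Proof.
move=> c0 b0 g0 K0 /andP[ep0 ep1] hf.
have ep20 : 0 < ep / 2 by rewrite divr_gt0.
have [M [M0 HM]] := density_ratio c0 ep20 hf.
have ep2 : 0 < ep / 2 <= 1 by rewrite ep20 /=; lra.
apply: filterS2 (window_near c0 b0 g0 K0 ep2) (near_scaleA_ge (2 * (M + 1)) b0 g0).
move=> l [l0 L1 L2 W] AM y hy; have A0 := scaleA_gt0 b0 l0; have sb0 := scaleb_gt0 b0 g0 l0.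
have bA : scaleb l * (K * ln l) <= scaleA l * 2^-1.
  rewrite /scaleb -mulrA ler_pM2l //.
  have : (gamma * l)^-1 * (K * ln l) <= (gamma * l)^-1 * (K * ln l) ^+ 2.
    by rewrite ler_pM2l ?invr_gt0 ?mulr_gt0 // expr2 ler_peMl // (le_trans ler01).
  lra.
have My : M < enorm y.
  move: hy; rewrite ler_norml => /andP[]; lra.
have /andP[h1 h2] := HM y My.
pose s := (enorm y - scaleA l) / scaleb l.
have sE : scaleA l + scaleb l * s = enorm y.
  by rewrite /s mulrC divfK ?gt_eqF // addrC subrK.
have sL : `|s| <= K * ln l.
  by rewrite /s normrM (gtr0_norm (x := _^-1)) ?invr_gt0 // ler_pdivrMr // mulrC.
have := W s sL; rewrite sE -/s => /andP[h3 h4].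
have e2 (x : R) : expR (x / 2) * expR (x / 2) = expR x.
  by rewrite -expRD -splitr.
apply/andP; split.
  apply: le_trans h1; rewrite -(e2 (- ep)) -mulrA mulNr ler_pM2l ?expR_gt0 //.
apply: (le_trans h2); rewrite -(e2 ep) -mulrA ler_pM2l ?expR_gt0 //.
Qed.

End scales.

(** * Mass of the points far from a given point *)

Section rotation.
Context {R : realType} {d : nat}.
Implicit Types x y z : d.-tuple R.

Definition tcol x : 'cV[R]_d := \col_i tnth x i.

Lemma tcol_inj : injective tcol.
Proof. by move=> x y /colP xy; apply: eq_from_tnth => i; have := xy i; rewrite !mxE. Qed.

Lemma tcol_mxact (Q : 'M[R]_d) x : tcol (mxact Q x) = Q *m tcol x.
Proof.
by apply/colP => i; rewrite !mxE tnth_mktuple; apply: eq_bigr => j _; rewrite mxE.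
Qed.

Lemma tcol_tsub x y : tcol (tsub x y) = tcol x - tcol y.
Proof. by apply/colP => i; rewrite !mxE tnth_mktuple. Qed.

Lemma enorm_tcol x : enorm x ^+ 2 = ((tcol x)^T *m tcol x) 0 0.
Proof.
by rewrite enorm_sq !mxE; apply: eq_bigr => i _; rewrite !mxE expr2.
Qed.

Lemma enorm_eq x y : enorm x ^+ 2 = enorm y ^+ 2 -> enorm x = enorm y.
Proof.
move=> xy; apply/eqP; rewrite -(@eqrXn2 _ 2) ?enorm_ge0 //; exact/eqP.
Qed.

Lemma enorm_mxact (Q : 'M[R]_d) x : Q *m Q^T = 1%:M -> enorm (mxact Q x) = enorm x.
Proof.
move=> QQ; apply: enorm_eq; rewrite !enorm_tcol tcol_mxact trmx_mul -mulmxA.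
by rewrite (mulmxA Q^T) (mulmx1C QQ) mul1mx.
Qed.

Lemma mxact_tsub (Q : 'M[R]_d) x y : mxact Q (tsub x y) = tsub (mxact Q x) (mxact Q y).
Proof. by apply: tcol_inj; rewrite tcol_mxact !tcol_tsub !tcol_mxact mulmxBr. Qed.

(** The reflection exchanging x and z, or the identity if they coincide. *)
Lemma householder x z : enorm x = enorm z ->
  exists2 Q : 'M[R]_d, Q *m Q^T = 1%:M & mxact Q x = z.
Proof.
move=> xz; pose v := tcol x - tcol z.
have vT : v^T = (tcol x)^T - (tcol z)^T by apply/matrixP => i j; rewrite !mxE.
pose S := (v^T *m v) 0 0.
have vv : v^T *m v = S%:M by rewrite [LHS]mx11_scalar.
have [S0|S0] := eqVneq S 0.
  exists 1%:M; first by rewrite trmx1 mulmx1.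
  apply: tcol_inj; rewrite tcol_mxact mul1mx; apply/subr0_eq; rewrite -/v.
  apply/colP => i; rewrite [RHS]mxE; apply/eqP; rewrite -sqrf_eq0.
  move: S0; rewrite /S mxE => /eqP; rewrite psumr_eq0; last first.
    by move=> j _; rewrite mxE -expr2 sqr_ge0.
  by move=> /allP/(_ i); rewrite mem_index_enum => /(_ isT) /=; rewrite mxE -expr2.
pose cc := 2 / S.
pose W := v *m v^T.
have WW : W *m W = S *: W.
  by rewrite /W mulmxA -(mulmxA v) vv mul_mx_scalar scalemxAl.
have WT : W^T = W by rewrite /W trmx_mul trmxK.
exists (1%:M - cc *: W).
  have -> : (1%:M - cc *: W)^T = 1%:M - cc *: W.
    by rewrite -[in RHS]WT; apply/matrixP => i j; rewrite !mxE eq_sym.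
  rewrite mulmxBl mul1mx mulmxBr mulmx1 -scalemxAl -scalemxAr WW !scalerA.
  have -> : cc * cc * S = 2 * cc by rewrite /cc; field.
  by apply/matrixP => i j; move: (1%:M : 'M[R]_d) => I1; rewrite !mxE; ring.
rewrite /W.
apply: tcol_inj; rewrite tcol_mxact mulmxBl mul1mx -scalemxAl -mulmxA.
have vx : v^T *m tcol x = (S / 2)%:M.
  rewrite [LHS]mx11_scalar; congr (_%:M).
  have E1 : ((tcol x)^T *m tcol x) 0 0 = ((tcol z)^T *m tcol z) 0 0 by rewrite -!enorm_tcol xz.
  have E2 : ((tcol x)^T *m tcol z) 0 0 = ((tcol z)^T *m tcol x) 0 0.
    by rewrite !mxE; apply: eq_bigr => i _; rewrite !mxE mulrC.
  have -> : S = 2 * (((tcol x)^T *m tcol x) 0 0 - ((tcol z)^T *m tcol x) 0 0).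
    rewrite /S vT /v mulmxBl !mulmxBr.
    move: E1 E2; rewrite !mxE => E1 E2; rewrite E1 E2; ring.
  by rewrite vT mulmxBl; rewrite !mxE; field.
rewrite vx mul_mx_scalar scalerA.
have -> : cc * (S / 2) = 1 by rewrite /cc; field.
by rewrite scale1r /v opprB addrC subrK.
Qed.

Definition far_region (rS rho : R) x : set (d.-tuple R) :=
  [set y | enorm y < rS /\ rho < enorm (tsub x y)].

Lemma measurable_far_region rS rho x : measurable (far_region rS rho x).
Proof.
apply: measurableI.
  by apply: measurable_ltset; [exact: measurable_enorm|exact: measurable_cst].
apply: measurable_ltset; first exact: measurable_cst.
by apply: (measurableT_comp measurable_enorm); apply: measurable_tsub.
Qed.

(** A rotation taking x to z takes one region to the other. *)
Lemma far_region_rotate disp (T : measurableType disp) (P : probability T R)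
    (Y : {RV P >-> d.-tuple R}) rS rho x z :
  spherically_symmetric P Y -> enorm x = enorm z ->
  distribution P Y (far_region rS rho x) = distribution P Y (far_region rS rho z).
Proof.
move=> sph xz; have [Q QQ Qx] := householder xz.
rewrite -[RHS](sph Q QQ); last exact: measurable_far_region.
congr (distribution P Y _); apply/seteqP; split=> y; rewrite /far_region /= -Qx -mxact_tsub !enorm_mxact //.
Qed.

End rotation.

Section pair_probability.
Context {R : realType} {k : nat}.
Variables (c alpha beta gamma : R) (f : k.+1.-tuple R -> R).
Local Notation lam := (@lebesgue_tuple R).
Local Notation A := (scaleA beta gamma).
Local Notation b := (scaleb beta gamma).
Local Notation pk := (peak c alpha beta gamma).

(** The reference point is on the negative first axis, so that the points far from
    it have a positive first coordinate. *)
Definition antipole (r : R) : k.+1.-tuple R := tcons (- r) [tuple 0 | i < k].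

Lemma enorm_antipole r : 0 <= r -> enorm (antipole r) = r.
Proof.
move=> r0; apply/eqP; rewrite -(@eqrXn2 _ 2) ?enorm_ge0 // enorm_tcons sqrrN enorm_sq big1 ?addr0 //.
by move=> i _; rewrite tnth_mktuple expr0n.
Qed.

Lemma enorm_antipole_sub r t (y : k.-tuple R) :
  enorm (tsub (antipole r) (tcons t y)) ^+ 2 = (r + t) ^+ 2 + enorm y ^+ 2.
Proof.
have -> : tsub (antipole r) (tcons t y) = tcons (- r - t) [tuple - tnth y i | i < k].
  apply: eq_from_tnth => i; rewrite tnth_mktuple /antipole /tcons.
  case: (unliftP ord0 i) => [j ->|->]; last by rewrite !tnth0.
  by rewrite !tnthS !tnth_mktuple sub0r.
rewrite enorm_tcons -opprD sqrrN; congr (_ + _); rewrite !enorm_sq; apply: eq_bigr => i _.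
by rewrite tnth_mktuple sqrrN.
Qed.

(** The exponential integral in the first coordinate gives b l, the Gaussian one
    in the transversal directions gives the power of the square root. *)
Definition cross_mass (l : R) : R := pk l * b l * Num.sqrt (pi * (4 * A l * b l)) ^+ k.

Hypothesis mf : measurable_fun setT f.
Hypothesis f0 : forall y, 0 <= f y.

Let measurable_restr (D : set (k.+1.-tuple R)) : measurable D ->
  measurable_fun setT (fun y => f y * \1_D y).
Proof. by move=> mD; apply: measurable_funM. Qed.

Let integral_restr (D : set (k.+1.-tuple R)) :
  (\int[lam k.+1]_(y in D) (f y)%:E = \int[lam k.+1]_y (f y * \1_D y)%:E)%E.
Proof.
rewrite integral_mkcond; apply: eq_integral => y _; rewrite patchE indicE.
by case: (y \in D); rewrite ?mulr1 ?mulr0.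
Qed.

(** By [geom_upper], the density at a point (t, y) of the region is at most a
    multiple of e ^ (- t / b) e ^ (- |y| ^ 2 / (2 A b)), and the point is above the
    paraboloid; each loss is a factor e ^ ep. *)
Lemma pair_upper (K ep : R) : 0 < c -> 0 < beta -> 0 < gamma -> 0 < K -> 0 < ep <= 1 ->
  gamma_tail R c alpha beta gamma f ->
  \forall l \near +oo, forall s1 w sS,
    `|s1| <= K * ln l -> `|w| <= K * ln l -> `|sS| <= K * ln l ->
    (\int[lam k.+1]_(y in far_region (A l + b l * sS) (2 * A l + b l * w) (antipole (A l + b l * s1))) (f y)%:E
     <= (expR (3 * ep) * cross_mass l * expR (s1 - w))%:E)%E.
Proof.
move=> c0 b0 g0 K0 ep01 hf; have /andP[ep0 ep1] := ep01.
have K2 : 0 < 2 * K by rewrite mulr_gt0.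
apply: filterS2 (@window_near R c alpha beta gamma K ep c0 b0 g0 K0 ep01)
  (density_window c0 b0 g0 K2 ep01 hf) => l [l0 L1 L2 _] W s1 w sS hs1 hw hsS.
have A0 := scaleA_gt0 gamma b0 l0; have sb0 := scaleb_gt0 b0 g0 l0.
set rS := A l + _; set rho := 2 * A l + _; set r := A l + b l * s1.
set Lam := K * ln l in hs1 hw hsS L1 L2.
set e := (gamma * l)^-1 in L2.
have e0 : 0 < e by rewrite invr_gt0 mulr_gt0.
have bE : b l = A l * e by [].
have pk0 : 0 < pk l by rewrite /peak !mulr_gt0 ?expR_gt0 // powR_gt0.
pose z0 := rho - r - ep * b l.
pose C := expR (2 * ep) * pk l * expR (A l / b l).
have C0 : 0 < C by rewrite /C mulr_gt0 ?expR_gt0 // mulr_gt0 ?expR_gt0.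
rewrite integral_restr.
have -> : expR (3 * ep) * cross_mass l * expR (s1 - w) =
    C * b l * expR (- (z0 / b l)) * Num.sqrt (pi * (4 * A l * b l)) ^+ k.
  have -> : expR (- (z0 / b l)) = expR ep * expR (s1 - w) * expR (- (A l / b l)).
    rewrite -!expRD; congr expR; rewrite /z0 /rho /r; field; exact: lt0r_neq0.
  have -> : expR (3 * ep) = expR (2 * ep) * expR ep by rewrite -expRD; congr expR; ring.
  have E : expR (A l / b l) * expR (- (A l / b l)) = 1 by rewrite -expRD subrr expR0.
  rewrite /C /cross_mass.
  transitivity (expR (2 * ep) * expR ep * (pk l * b l * Num.sqrt (pi * (4 * A l * b l)) ^+ k) *
    expR (s1 - w) * (expR (A l / b l) * expR (- (A l / b l)))); first by rewrite E mulr1.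
  ring.
apply: half_space_upper => //.
- exact: ltW.
- by apply: measurable_restr; exact: measurable_far_region.
- by move=> y; rewrite mulr_ge0 // indicE.
move=> t y; set x := tcons t y.
have rhs0 : 0 <= C * expR (- ((b l)^-1 * t)) * expR (- (enorm y ^+ 2 / (2 * A l * b l))).
  by rewrite mulr_ge0 ?expR_ge0 // mulr_ge0 ?expR_ge0 // ltW.
rewrite indicE; case: (boolP (x \in _)) => [/set_mem [/= xS xrho]|_]; last first.
  by rewrite mulr0 mulr_ge0.
rewrite mulr1.
have m0 : 0 < e * Lam by rewrite mulr_gt0 // (lt_le_trans ltr01).
have LL : Lam <= Lam ^+ 2 by rewrite expr2 ler_peMl // (le_trans ler01).
have m1 : 100 * (e * Lam) <= 1.
  apply: le_trans ep1; apply: le_trans L2; rewrite ler_pM2l // ler_pM2l //.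
have m2 : e * Lam <= 2.
  by rewrite (le_trans (le_trans (ler_peMl (ltW m0) (ler1n R 100)) m1)) // ler1n.
have mu0 : 0 < ep * e by rewrite mulr_gt0.
have mue : ep * e <= e * Lam by rewrite mulrC ler_pM2l // (le_trans ep1).
have mum : 100 * (e * Lam) ^+ 2 <= ep * e.
  by have -> : 100 * (e * Lam) ^+ 2 = (100 * (e * Lam ^+ 2)) * e; [ring|rewrite ler_pM2r].
have Y0 : 0 <= enorm y ^+ 2 / A l ^+ 2 by rewrite divr_ge0 ?sqr_ge0.
have q0 : 0 <= enorm x / A l by rewrite divr_ge0 ?enorm_ge0 // ltW.
have qE : (enorm x / A l) ^+ 2 = (t / A l) ^+ 2 + enorm y ^+ 2 / A l ^+ 2.
  by rewrite !expr_div_n enorm_tcons mulrDl.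
have hab s : `|s| <= Lam -> - (e * Lam) <= e * s <= e * Lam.
  by rewrite ler_norml => /andP[h1 h2]; rewrite -mulrN !ler_pM2l // h1.
have /andP[s1a s1b] := hab _ hs1; have /andP[wa wb] := hab _ hw; have /andP[sa sb] := hab _ hsS.
have rE : r / A l = 1 + e * s1 by rewrite /r bE; field; exact: lt0r_neq0.
have rhoE : rho / A l = 2 + e * w by rewrite /rho bE; field; exact: lt0r_neq0.
have rSE : rS / A l = 1 + e * sS by rewrite /rS bE; field; exact: lt0r_neq0.
have [|||| G1 G2 G3] := @geom_upper R (e * Lam) (ep * e) (r / A l) (rho / A l) (t / A l)
  (enorm y ^+ 2 / A l ^+ 2) (enorm x / A l) m0 m1 mu0 mue mum Y0 q0 qE.
- by rewrite rE !lerD2l s1a s1b.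
- by rewrite rhoE lerD2l.
- have : enorm x / A l <= rS / A l by rewrite ler_pM2r ?invr_gt0 // ltW.
  by rewrite rSE => /le_trans; apply; rewrite lerD2l.
- have -> : (r / A l + t / A l) ^+ 2 + enorm y ^+ 2 / A l ^+ 2 =
     (enorm (tsub (antipole r) x) / A l) ^+ 2.
    by rewrite expr_div_n enorm_antipole_sub -mulrDl expr_div_n -mulrDl.
  apply: sqr_lt; last by rewrite ltr_pM2r ?invr_gt0.
  by rewrite rhoE -lerBlDl sub0r (le_trans _ wa) // lerN2.
have H1 : z0 - enorm y ^+ 2 / (4 * A l) < t.
  have := G1; rewrite -(ltr_pM2l A0).
  have -> : A l * (rho / A l - r / A l - ep * e - enorm y ^+ 2 / A l ^+ 2 / 4) =
     z0 - enorm y ^+ 2 / (4 * A l) by rewrite /z0 bE; field; exact: lt0r_neq0.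
  by rewrite [ltRHS]mulrC divfK // gt_eqF.
have H2 : t + enorm y ^+ 2 / (2 * A l) - ep * b l <= enorm x.
  have := G2; rewrite -(ler_pM2l A0).
  have -> : A l * (t / A l + enorm y ^+ 2 / A l ^+ 2 / 2 - ep * e) =
     t + enorm y ^+ 2 / (2 * A l) - ep * b l by rewrite bE; field; exact: lt0r_neq0.
  by rewrite [leRHS]mulrC divfK // gt_eqF.
have H3 : A l - b l * (2 * Lam) <= enorm x.
  have := G3; rewrite -(ler_pM2l A0).
  have -> : A l * (1 - 2 * (e * Lam)) = A l - b l * (2 * Lam) by rewrite bE; ring.
  by rewrite [leRHS]mulrC divfK // gt_eqF.
have /andP[_ fx] : within_factor ep (f x) (pk l * expR (- ((enorm x - A l) / b l))).
  apply: W; rewrite -mulrA -/Lam ler_norml; apply/andP; split; first by rewrite lerBrDl.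
  rewrite lerBlDl (le_trans (ltW xS)) // lerD2l ler_pM2l //.
  apply: (le_trans (le_trans (ler_norm _) hsS)).
  by rewrite ler_peMl ?ler1n // (le_trans ler01).
rewrite H1 mulr1 /C; move: fx pk0; move: (pk l) => p fx p0.
rewrite (le_trans fx) // -!mulrA.
have -> : expR (2 * ep) = expR ep * expR ep by rewrite -expRD; congr expR; ring.
rewrite -!mulrA ler_pM2l ?expR_gt0 // [leRHS]mulrCA ler_pM2l // -!expRD ler_expR.
have : (t + enorm y ^+ 2 / (2 * A l) - ep * b l - A l) / b l <= (enorm x - A l) / b l.
  by rewrite ler_pM2r ?invr_gt0 // lerB.
have -> : (t + enorm y ^+ 2 / (2 * A l) - ep * b l - A l) / b l =
   (b l)^-1 * t + enorm y ^+ 2 / (2 * A l * b l) - ep - A l / b l.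
  by field; rewrite !gt_eqF.
lra.
Qed.

(** The condition on [sS] guarantees that the part of the region close to the
    vertex, where [geom_lower] applies, lies inside the truncation ball. *)
Lemma pair_lower (K ep M : R) : 0 < c -> 0 < beta -> 0 < gamma -> 0 < K -> 0 < ep <= 1 -> 0 < M ->
  gamma_tail R c alpha beta gamma f ->
  \forall l \near +oo, forall s1 w sS,
    `|s1| <= K * ln l -> `|w| <= K * ln l -> `|sS| <= K * ln l ->
    w - s1 + 2 * M + 2 * ep < sS ->
    ((expR (- (3 * ep)) * cross_mass l * expR (s1 - w) *
      ((1 - expR (- M)) * (1 - expR (- (M / 2)) * Num.sqrt 2 ^+ k)))%:E <=
    \int[lam k.+1]_(y in far_region (A l + b l * sS) (2 * A l + b l * w) (antipole (A l + b l * s1))) (f y)%:E)%E.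
Proof.
move=> c0 b0 g0 K0 ep01 M0 hf; have /andP[ep0 ep1] := ep01.
have K3 : 0 < 3 * K by rewrite mulr_gt0.
apply: filterS3 (near_ln_ge (K^-1 * M)) (@window_near R c alpha beta gamma K ep c0 b0 g0 K0 ep01)
  (density_window c0 b0 g0 K3 ep01 hf) => l ML0 [l0 L1 L2 _] W s1 w sS hs1 hw hsS hsw.
have ML : M <= K * ln l by rewrite -ler_pdivrMl.
have A0 := scaleA_gt0 gamma b0 l0; have sb0 := scaleb_gt0 b0 g0 l0.
set rS := A l + _; set rho := 2 * A l + _; set r := A l + b l * s1.
set Lam := K * ln l in hs1 hw hsS L1 L2 ML.
set e := (gamma * l)^-1 in L2.
have e0 : 0 < e by rewrite invr_gt0 mulr_gt0.
have bE : b l = A l * e by [].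
have pk0 : 0 < pk l by rewrite /peak !mulr_gt0 ?expR_gt0 // powR_gt0.
pose z0 := rho - r + ep * b l.
pose C := expR (- (2 * ep)) * pk l * expR (A l / b l).
have C0 : 0 < C by rewrite /C mulr_gt0 ?expR_gt0 // mulr_gt0 ?expR_gt0.
rewrite integral_restr.
have -> : expR (- (3 * ep)) * cross_mass l * expR (s1 - w) *
      ((1 - expR (- M)) * (1 - expR (- (M / 2)) * Num.sqrt 2 ^+ k)) =
    C * b l * expR (- (z0 / b l)) * (1 - expR (- M)) *
   (Num.sqrt (pi * (4 * A l * b l)) ^+ k * (1 - expR (- (M / 2)) * Num.sqrt 2 ^+ k)).
  have -> : expR (- (z0 / b l)) = expR (- ep) * expR (s1 - w) * expR (- (A l / b l)).
    rewrite -!expRD; congr expR; rewrite /z0 /rho /r; field; exact: lt0r_neq0.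
  have -> : expR (- (3 * ep)) = expR (- (2 * ep)) * expR (- ep) by rewrite -expRD; congr expR; ring.
  have E : expR (A l / b l) * expR (- (A l / b l)) = 1 by rewrite -expRD subrr expR0.
  rewrite /C /cross_mass.
  transitivity (expR (- (2 * ep)) * expR (- ep) * (pk l * b l * Num.sqrt (pi * (4 * A l * b l)) ^+ k) *
    expR (s1 - w) * ((1 - expR (- M)) * (1 - expR (- (M / 2)) * Num.sqrt 2 ^+ k)) *
    (expR (A l / b l) * expR (- (A l / b l)))); first by rewrite E mulr1.
  ring.
apply: half_space_lower => //.
- exact: ltW.
- by apply: measurable_funM => //; apply: measurable_indic; exact: measurable_far_region.
- by move=> y; rewrite mulr_ge0 // indicE.
move=> t y YM tz; set x := tcons t y.
have m0 : 0 < e * Lam by rewrite mulr_gt0 // (lt_le_trans ltr01).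
have LL : Lam <= Lam ^+ 2 by rewrite expr2 ler_peMl // (le_trans ler01).
have m1 : 100 * (e * Lam) <= 1.
  apply: le_trans ep1; apply: le_trans L2; rewrite ler_pM2l // ler_pM2l //.
have m2 : e * Lam <= 2.
  by rewrite (le_trans (le_trans (ler_peMl (ltW m0) (ler1n R 100)) m1)) // ler1n.
have mu0 : 0 < ep * e by rewrite mulr_gt0.
have mue : ep * e <= e * Lam by rewrite mulrC ler_pM2l // (le_trans ep1).
have mum : 100 * (e * Lam) ^+ 2 <= ep * e.
  by have -> : 100 * (e * Lam) ^+ 2 = (100 * (e * Lam ^+ 2)) * e; [ring|rewrite ler_pM2r].
have Y0 : 0 <= enorm y ^+ 2 / A l ^+ 2 by rewrite divr_ge0 ?sqr_ge0.
have q0 : 0 <= enorm x / A l by rewrite divr_ge0 ?enorm_ge0 // ltW.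
have qE : (enorm x / A l) ^+ 2 = (t / A l) ^+ 2 + enorm y ^+ 2 / A l ^+ 2.
  by rewrite !expr_div_n enorm_tcons mulrDl.
have hab s : `|s| <= Lam -> - (e * Lam) <= e * s <= e * Lam.
  by rewrite ler_norml => /andP[h1 h2]; rewrite -mulrN !ler_pM2l // h1.
have /andP[s1a s1b] := hab _ hs1; have /andP[wa wb] := hab _ hw; have /andP[sa sb] := hab _ hsS.
have rE : r / A l = 1 + e * s1 by rewrite /r bE; field; exact: lt0r_neq0.
have rhoE : rho / A l = 2 + e * w by rewrite /rho bE; field; exact: lt0r_neq0.
have rSE : rS / A l = 1 + e * sS by rewrite /rS bE; field; exact: lt0r_neq0.
have Ai0 : 0 < (A l)^-1 by rewrite invr_gt0.
have [||||| G1 G2 G4 G3] := @geom_lower R (e * Lam) (ep * e) (e * M) (r / A l) (rho / A l) (t / A l)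
  (enorm y ^+ 2 / A l ^+ 2) (enorm x / A l) m0 m1 mu0 mue mum Y0 q0 qE.
- by rewrite rE !lerD2l s1a s1b.
- by rewrite rhoE !lerD2l wa wb.
- by rewrite mulr_gt0 //= ler_pM2l.
- rewrite ler_pdivrMr ?exprn_gt0 //; apply: ltW; apply: (lt_le_trans YM).
  rewrite bE le_eqVlt; apply/orP; left; apply/eqP; ring.
- move: tz => /andP[t1 t2].
  have E1 : rho / A l - r / A l + ep * e - enorm y ^+ 2 / A l ^+ 2 / 4 =
     (z0 - enorm y ^+ 2 / (4 * A l)) / A l by rewrite /z0 bE; field; exact: lt0r_neq0.
  have E2 : (z0 - enorm y ^+ 2 / (4 * A l)) / A l + e * M =
     (z0 - enorm y ^+ 2 / (4 * A l) + b l * M) / A l by rewrite bE; field; exact: lt0r_neq0.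
  by rewrite E1 E2 ltr_pM2r // ler_pM2r // t1.
have rhoA : 0 <= rho / A l by rewrite rhoE -lerBlDl sub0r (le_trans _ wa) // lerN2.
have rho0 : 0 <= rho by move: rhoA; rewrite pmulr_lge0.
have H1 : rho < enorm (tsub (antipole r) x).
  rewrite -(@ltr_pXn2r _ 2) // ?nnegrE ?enorm_ge0 // enorm_antipole_sub.
  have := G1; rewrite -mulrDl !expr_div_n -mulrDl ltr_pM2r // invr_gt0 exprn_gt0 //.
have H2 : enorm x <= t + enorm y ^+ 2 / (2 * A l) + ep * b l.
  have := G2; rewrite -(ler_pM2l A0).
  have -> : A l * (t / A l + enorm y ^+ 2 / A l ^+ 2 / 2 + ep * e) =
     t + enorm y ^+ 2 / (2 * A l) + ep * b l by rewrite bE; field; exact: lt0r_neq0.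
  by rewrite [leLHS]mulrC divfK // gt_eqF.
have H3 : A l - b l * (3 * Lam) <= enorm x.
  have := G3; rewrite -(ler_pM2l A0).
  have -> : A l * (1 - 3 * (e * Lam)) = A l - b l * (3 * Lam) by rewrite bE; ring.
  by rewrite [leRHS]mulrC divfK // gt_eqF.
have H4 : enorm x < rS.
  suff : enorm x / A l < rS / A l by rewrite ltr_pM2r.
  apply: (le_lt_trans G4); rewrite rhoE rE rSE.
  have : e * (w - s1 + 2 * M + 2 * ep) < e * sS by rewrite ltr_pM2l.
  by rewrite -(ltrD2l 1); congr (_ < _); ring.
have /andP[fx _] : within_factor ep (f x) (pk l * expR (- ((enorm x - A l) / b l))).
  apply: W; rewrite -mulrA -/Lam ler_norml; apply/andP; split; first by rewrite lerBrDl.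
  rewrite lerBlDl (le_trans (ltW H4)) // lerD2l ler_pM2l //.
  apply: (le_trans (le_trans (ler_norm _) hsS)).
  by rewrite ler_peMl ?ler1n // (le_trans ler01).
have -> : \1_(far_region rS rho (antipole r)) x = 1 :> R by rewrite indicE mem_set.
rewrite mulr1 /C; move: fx pk0; move: (pk l) => p fx p0.
rewrite (le_trans _ fx) // -!mulrA.
have -> : expR (- (2 * ep)) = expR (- ep) * expR (- ep) by rewrite -expRD; congr expR; ring.
rewrite -!mulrA ler_pM2l ?expR_gt0 // [leLHS]mulrCA ler_pM2l // -!expRD ler_expR.
have : (enorm x - A l) / b l <= (t + enorm y ^+ 2 / (2 * A l) + ep * b l - A l) / b l.
  by rewrite ler_pM2r ?invr_gt0 // lerB.
have -> : (t + enorm y ^+ 2 / (2 * A l) + ep * b l - A l) / b l =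
   (b l)^-1 * t + enorm y ^+ 2 / (2 * A l * b l) + ep - A l / b l.
  by field; rewrite !gt_eqF.
lra.
Qed.

End pair_probability.

(** * Mass of shells and tails *)

(** Integrals against a measure with a density, for the integrands that occur:
    the layer cake formula for both measures reduces the claim to sets. *)
Lemma density_integral_expR d (E : measurableType d) (R : realType)
    (nu m : {sigma_finite_measure set E -> \bar R}) (f phi : E -> R) (S : set E) :
  measurable_fun setT f -> (forall y, 0 <= f y) -> measurable_fun setT phi ->
  measurable S ->
  (forall B, measurable B -> nu B = \int[m]_(y in B) (f y)%:E)%E ->
  (\int[nu]_(y in S) (expR (- phi y))%:E = \int[m]_(y in S) (f y * expR (- phi y))%:E)%E.
Proof.
move=> mf f0 mphi mS nuE.
have me : measurable_fun setT (fun u : R => expR (- u)).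
  by apply: measurableT_comp => //; exact: measurable_funN.
have mi : measurable_fun setT (\1_S : E -> R) by exact: measurable_indic.
have mfi : measurable_fun setT (fun y => f y * \1_S y) by exact: measurable_funM.
have i0 y : 0 <= \1_S y :> R by rewrite indicE.
have fi0 y : 0 <= f y * \1_S y by rewrite mulr_ge0.
have e0 (u : R) : 0 <= expR (- u) by exact: expR_ge0.
have tail (z : R) : (\int[lebesgue_measure]_(u in `]z, +oo[) (expR (- u))%:E = (expR (- z))%:E)%E.
  have := @integral_expR_tail R 1 z ltr01; rewrite invr1 !mul1r => <-.
  by apply: eq_integral => u _; rewrite mul1r.
have E1 := @layer_cake_weight _ _ _ nu phi _ _ mphi mi me i0 e0.
have E2 := @layer_cake_weight _ _ _ m phi _ _ mphi mfi me fi0 e0.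
transitivity (\int[nu]_y ((\1_S y)%:E * \int[lebesgue_measure]_(u in `](phi y), +oo[) (expR (- u))%:E))%E.
  rewrite integral_mkcond; apply: eq_integral => y _; rewrite patchE indicE tail.
  by case: (y \in S); rewrite ?mul1e ?mul0e.
rewrite E1; transitivity (\int[m]_y ((f y * \1_S y)%:E * \int[lebesgue_measure]_(u in `](phi y), +oo[) (expR (- u))%:E))%E; last first.
  rewrite [RHS]integral_mkcond; apply: eq_integral => y _; rewrite patchE indicE tail -EFinM.
  by case: (y \in S); rewrite ?mulr1 // mulr0 mul0r.
rewrite E2; apply: eq_integral => u _; congr (_ * _)%E.
have mU : measurable [set y | phi y < u] by apply: measurable_ltset.
rewrite integral_indic //; apply: (etrans (nuE _ (measurableI _ _ mS mU))).
rewrite [RHS]integral_mkcond [LHS]integral_mkcond; apply: eq_integral => y _; rewrite !patchE indicE in_setI.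
by case: (y \in S); case: (y \in [set _ | _]); rewrite ?mulr1 ?mulr0.
Qed.

Section shells.
Context {R : realType} {k : nat}.
Variables (c alpha beta gamma : R) (f : k.+1.-tuple R -> R) (v : R).
Local Notation lam := (@lebesgue_tuple R).
Local Notation A := (scaleA beta gamma).
Local Notation b := (scaleb beta gamma).
Local Notation pk := (peak c alpha beta gamma).

Definition shell (qa qb : R) : set (k.+1.-tuple R) := [set x | qa <= enorm x < qb].

Lemma shellE qa qb : shell qa qb = [set x | enorm x < qb] `\` [set x | enorm x < qa].
Proof.
apply/seteqP; split=> x /=; rewrite /shell /=.
  by move=> /andP[h1 h2]; split=> //; apply/negP; rewrite -leNgt.
by move=> [h1 /negP]; rewrite -leNgt => h2; apply/andP.
Qed.

Lemma measurable_shell qa qb : measurable (shell qa qb).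
Proof. by rewrite shellE; apply: measurableD; exact: measurable_ball. Qed.

Hypothesis v0 : 0 < v.
Hypothesis volE : forall r, 0 < r -> lam k.+1 [set x | enorm x < r] = (v * r ^+ k.+1)%:E.

Lemma shell_volume qa qb : 0 < qa -> qa <= qb ->
  lam k.+1 (shell qa qb) = (v * (qb ^+ k.+1 - qa ^+ k.+1))%:E.
Proof.
move=> qa0 qab; have qb0 : 0 < qb by exact: lt_le_trans qab.
pose m : {measure set (k.+1.-tuple R) -> \bar R} := lam k.+1.
have mE r : 0 < r -> m [set x | enorm x < r] = (v * r ^+ k.+1)%:E := @volE r.
have mfin : (m [set x | (enorm x < qb)%R] < +oo)%E by rewrite mE // ltry.
have E : m ([set x | enorm x < qb] `\` [set x | enorm x < qa]) =
    (m [set x | (enorm x < qb)%R] - m ([set x | (enorm x < qb)%R] `&` [set x | (enorm x < qa)%R]))%E.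
  by apply: measureD => //; exact: measurable_ball.
rewrite -[LHS]/(m (shell qa qb)) shellE E.
rewrite (_ : _ `&` _ = [set x | enorm x < qa]).
  by rewrite !mE // -EFinB mulrBr.
by apply/seteqP; split=> x /=; [move=> []|move=> h; split=> //; exact: lt_le_trans qab].
Qed.

(** The volume of a shell of unit width in the normalized radius. *)
Definition sphere_mass (l : R) : R := v * k.+1%:R * A l ^+ k * b l.

Lemma near_log_small (K ep : R) : 0 < gamma -> 0 < K -> 0 < ep ->
  \forall l \near +oo, [/\ 0 < l, 1 <= K * ln l & (gamma * l)^-1 * (K * ln l) <= ep].
Proof.
move=> g0 K0 ep0; near=> l.
have l0 : 0 < l by near: l; exact: nbhs_pinfty_gt.
have L1 : K^-1 <= ln l by near: l; exact: near_ln_ge.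
have L2 : ln l ^+ 2 <= (ep * gamma / K ^+ 2) * l.
  by near: l; apply: near_ln_sqr_le; rewrite !divr_gt0 ?mulr_gt0 // exprn_gt0.
have KL : 1 <= K * ln l by rewrite -ler_pdivrMl // mulr1.
split=> //; rewrite mulrC ler_pdivrMr ?mulr_gt0 //.
apply: (@le_trans _ _ ((K * ln l) ^+ 2)); first by rewrite expr2 ler_peMl // (le_trans ler01).
rewrite exprMn; have -> : ep * (gamma * l) = K ^+ 2 * (ep * gamma / K ^+ 2 * l).
  by field; rewrite gt_eqF.
by rewrite ler_pM2l // exprn_gt0.
Unshelve. all: by end_near. Qed.

(** The difference of powers of the two radii is their difference times a sum of
    k + 1 products, each of which is close to A ^ k. *)
Lemma shell_volume_near (K ep : R) : 0 < beta -> 0 < gamma -> 0 < K -> 0 < ep <= 1 ->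
  \forall l \near +oo, forall sa sb, `|sa| <= K * ln l -> `|sb| <= K * ln l -> sa <= sb ->
  exists2 V, lam k.+1 (shell (A l + b l * sa) (A l + b l * sb)) = V%:E &
    within_factor ep V (sphere_mass l * (sb - sa)).
Proof.
move=> b0 g0 K0 /andP[ep0 ep1].
pose del := ep / (2 * k.+1%:R).
have k0 : 0 < k.+1%:R :> R by rewrite ltr0n.
have del0 : 0 < del by rewrite divr_gt0 // mulr_gt0.
have delk : 2 * (del * k%:R) <= ep.
  rewrite /del; have -> : 2 * (ep / (2 * k.+1%:R) * k%:R) = ep * (k%:R / k.+1%:R).
    by field; rewrite gt_eqF.
  by rewrite ler_piMr ?(ltW ep0) // ler_pdivrMr // mul1r ler_nat.
have del1 : del <= 2^-1.
  rewrite /del ler_pdivrMr ?mulr_gt0 // mulrA mulVf // mul1r (le_trans ep1) // ler1n //.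
near=> l => sa sb hsa hsb sab.
have [l0 L1 L2] : [/\ 0 < l, 1 <= K * ln l & (gamma * l)^-1 * (K * ln l) <= del].
  by near: l; exact: near_log_small.
have A0 := scaleA_gt0 gamma b0 l0; have sb0 := scaleb_gt0 b0 g0 l0.
set m := (gamma * l)^-1 * (K * ln l) in L2.
have bs s : `|s| <= K * ln l -> A l * (1 - m) <= A l + b l * s <= A l * (1 + m).
  rewrite ler_norml => /andP[h1 h2].
  have e0 : 0 < (gamma * l)^-1 by rewrite invr_gt0 mulr_gt0.
  have h3 : (gamma * l)^-1 * s <= m by rewrite ler_pM2l.
  have h4 : - m <= (gamma * l)^-1 * s by rewrite -mulrN ler_pM2l.
  have -> : A l + b l * s = A l * (1 + (gamma * l)^-1 * s) by rewrite /scaleb; ring.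
  by rewrite !ler_pM2l //; apply/andP; split; lra.
have m0 : 0 <= m.
  by rewrite /m ltW //; apply: mulr_gt0; [rewrite invr_gt0 mulr_gt0|exact: lt_le_trans L1].
have mh : 0 < 1 - m by lra.
have /andP[a1 a2] := bs _ hsa; have /andP[b1 b2] := bs _ hsb.
set qa := A l + b l * sa in a1 a2 *; set qb := A l + b l * sb in b1 b2 *.
have qa0 : 0 < qa by apply: lt_le_trans a1; rewrite mulr_gt0.
have qab : qa <= qb by rewrite lerD2l ler_pM2l.
exists (v * (qb ^+ k.+1 - qa ^+ k.+1)); first exact: shell_volume.
have -> : v * (qb ^+ k.+1 - qa ^+ k.+1) =
    v * b l * (sb - sa) * \sum_(i < k.+1) qb ^+ (k - i) * qa ^+ i.
  have dE : qb - qa = b l * (sb - sa) by rewrite /qb /qa; ring.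
  rewrite subrXX dE !mulrA; congr (_ * _).
have c0 : 0 <= v * b l * (sb - sa) by rewrite mulr_ge0 ?subr_ge0 // mulr_ge0 // ltW.
have lowm : expR (- (2 * m)) <= 1 - m.
  have : `|- m| <= 2^-1 by rewrite normrN ger0_norm //; lra.
  move=> /ln1D_bounds/andP[h1 _].
  rewrite -[leRHS]lnK ?posrE // ler_expR (le_trans _ h1) // sqrrN.
  have : m * m <= m * 2^-1 by rewrite ler_wpM2l //; lra.
  rewrite expr2; lra.
have upm : 1 + m <= expR m by exact: expR_ge1Dx.
have term i : (i < k.+1)%N -> expR (- ep) * A l ^+ k <= qb ^+ (k - i) * qa ^+ i <= expR ep * A l ^+ k.
  move=> ik; have kE : A l ^+ k = A l ^+ (k - i) * A l ^+ i by rewrite -exprD subnK.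
  have pw (x : R) : x ^+ k = x ^+ (k - i) * x ^+ i by rewrite -exprD subnK.
  have Am0 : 0 <= A l * (1 - m) by rewrite mulr_ge0 // ltW.
  have qa0' : 0 <= qa by exact: ltW.
  have qb0' : 0 <= qb by exact: le_trans qab.
  have Ap0 : 0 <= A l * (1 + m) by exact: le_trans b2.
  apply/andP; split.
    apply: (@le_trans _ _ ((A l * (1 - m)) ^+ k)).
      rewrite exprMn mulrC ler_pM2l ?exprn_gt0 //.
      apply: (@le_trans _ _ (expR (- (2 * m)) ^+ k)); last by rewrite lerXn2r // nnegrE ?expR_ge0 // ltW.
      rewrite -expRM_natl ler_expR mulrN lerN2.
      have : k%:R * m <= k%:R * del by rewrite ler_wpM2l.
      by move: delk; rewrite (mulrC del); lra.
    by rewrite pw ler_pM ?exprn_ge0 // lerXn2r // nnegrE.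
  apply: (@le_trans _ _ ((A l * (1 + m)) ^+ k)).
    by rewrite pw ler_pM ?exprn_ge0 // lerXn2r // nnegrE.
  rewrite exprMn mulrC ler_pM2r ?exprn_gt0 //.
  apply: (@le_trans _ _ (expR m ^+ k)); first by rewrite lerXn2r // nnegrE ?expR_ge0 // addr_ge0.
  rewrite -expRM_natl ler_expR.
  have : k%:R * m <= k%:R * del by rewrite ler_wpM2l.
  by move: delk; rewrite (mulrC del); lra.
have sumE (x : R) : \sum_(i < k.+1) x = k.+1%:R * x by rewrite sumr_const card_ord mulr_natl.
rewrite /sphere_mass; apply/andP; split.
  have -> : expR (- ep) * (v * k.+1%:R * A l ^+ k * b l * (sb - sa)) =
    v * b l * (sb - sa) * \sum_(i < k.+1) (expR (- ep) * A l ^+ k) by rewrite sumE; ring.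
  by rewrite ler_wpM2l //; apply: ler_sum => i _; have /andP[] := term i (ltn_ord i).
have -> : expR ep * (v * k.+1%:R * A l ^+ k * b l * (sb - sa)) =
    v * b l * (sb - sa) * \sum_(i < k.+1) (expR ep * A l ^+ k) by rewrite sumE; ring.
by rewrite ler_wpM2l //; apply: ler_sum => i _; have /andP[] := term i (ltn_ord i).
Unshelve. all: by end_near. Qed.

Hypothesis mf : measurable_fun setT f.
Hypothesis f0 : forall y, 0 <= f y.

(** The weight e ^ s compensates the decay of the density, so the integral is
    [peak] times the volume of the shell. *)
Lemma shell_integral (K ep : R) : 0 < c -> 0 < beta -> 0 < gamma -> 0 < K -> 0 < ep <= 1 ->
  gamma_tail R c alpha beta gamma f ->
  \forall l \near +oo, forall sa sb, `|sa| <= K * ln l -> `|sb| <= K * ln l -> sa <= sb ->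
  ((expR (- (2 * ep)) * (pk l * sphere_mass l * (sb - sa)))%:E <=
  \int[lam k.+1]_(x in shell (A l + b l * sa) (A l + b l * sb))
     (f x * expR (- (- ((enorm x - A l) / b l))))%:E <=
  (expR (2 * ep) * (pk l * sphere_mass l * (sb - sa)))%:E)%E.
Proof.
move=> c0 b0 g0 K0 ep01 hf; have l0 := nbhs_pinfty_gt (num_real (0 : R)).
apply: filterS3 l0 (density_window c0 b0 g0 K0 ep01 hf) (shell_volume_near b0 g0 K0 ep01).
move=> l l0 W HV sa sb hsa hsb sab.
have [V VE /andP[V1 V2]] := HV _ _ hsa hsb sab.
have A0 := scaleA_gt0 gamma b0 l0; have sb0 := scaleb_gt0 b0 g0 l0.
have pk0 : 0 < pk l by rewrite /peak !mulr_gt0 ?expR_gt0 // powR_gt0.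
set S := shell _ _ in VE *.
have mS : measurable S by exact: measurable_shell.
have wS x : S x -> expR (- ep) * pk l <= f x * expR (- (- ((enorm x - A l) / b l))) <= expR ep * pk l.
  move=> /andP[x1 x2].
  have /W : `|enorm x - A l| <= b l * (K * ln l).
    move: hsa hsb; rewrite !ler_norml => /andP[h1 h2] /andP[h3 h4].
    have : b l * - (K * ln l) <= b l * sa by rewrite ler_pM2l.
    have : b l * sb <= b l * (K * ln l) by rewrite ler_pM2l.
    by rewrite mulrN => *; apply/andP; split; lra.
  set s := (enorm x - A l) / b l.
  have E : expR (- s) * expR (- - s) = 1 by rewrite -expRD subrr expR0.
  have tr (a p u w : R) : u * w = 1 -> a * (p * u) * w = a * p.
    by move=> uw; rewrite mulrA -mulrA uw mulr1.
  move=> /andP[h1 h2]; apply/andP; split.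
    have -> : expR (- ep) * pk l = expR (- ep) * (pk l * expR (- s)) * expR (- - s).
      by rewrite tr.
    by rewrite ler_pM2r ?expR_gt0.
  have -> : expR ep * pk l = expR ep * (pk l * expR (- s)) * expR (- - s).
    by rewrite tr.
  by rewrite ler_pM2r ?expR_gt0.
have mI : measurable_fun S (fun x => (f x * expR (- (- ((enorm x - A l) / b l))))%:E).
  apply/measurable_EFinP; apply: measurable_funTS; apply: measurable_funM => //.
  apply: measurableT_comp => //; apply: measurable_funN; apply: measurable_funN; apply: measurable_funM => //.
  by apply: measurable_funB => //; exact: measurable_enorm.
have e2 (x : R) : expR (2 * x) = expR x * expR x by rewrite -expRD; congr expR; ring.
have cstE (r : R) : (\int[lam k.+1]_(x in S) r%:E = (r * V)%:E)%E.
  by rewrite integral_cst // EFinM; congr (_ * _)%E; exact: VE.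
apply/andP; split.
  apply: (@le_trans _ _ (\int[lam k.+1]_(x in S) (expR (- ep) * pk l)%:E)%E).
    rewrite cstE lee_fin -mulrN e2.
    have -> : expR (- ep) * expR (- ep) * (pk l * sphere_mass l * (sb - sa)) =
      expR (- ep) * pk l * (expR (- ep) * (sphere_mass l * (sb - sa))) by ring.
    by rewrite ler_pM2l // mulr_gt0 ?expR_gt0.
  apply: ge0_le_integral => //.
  - by move=> x _; rewrite lee_fin mulr_ge0 ?expR_ge0 // ltW.
  - by move=> x Sx; rewrite lee_fin; have /andP[] := wS x Sx.
apply: (@le_trans _ _ (\int[lam k.+1]_(x in S) (expR ep * pk l)%:E)%E).
  apply: ge0_le_integral => //.
  - by move=> x _; rewrite lee_fin mulr_ge0 ?expR_ge0.
  - by move=> x Sx; rewrite lee_fin; have /andP[] := wS x Sx.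
rewrite cstE lee_fin e2.
have -> : expR ep * expR ep * (pk l * sphere_mass l * (sb - sa)) =
      expR ep * pk l * (expR ep * (sphere_mass l * (sb - sa))) by ring.
by rewrite ler_pM2l // mulr_gt0 ?expR_gt0.
Qed.

End shells.

Section tail.
Context {R : realType} {k : nat}.
Variables (c alpha beta gamma : R) (f : k.+1.-tuple R -> R) (v : R).
Local Notation lam := (@lebesgue_tuple R).
Local Notation mu := (@lebesgue_measure R).
Local Notation A := (scaleA beta gamma).
Local Notation b := (scaleb beta gamma).
Local Notation pk := (peak c alpha beta gamma).
Local Notation rad := (rad_density c alpha beta gamma).

Hypothesis v0 : 0 < v.
Hypothesis volE : forall r, 0 < r -> lam k.+1 [set x | enorm x < r] = (v * r ^+ k.+1)%:E.

Definition outside (r : R) : set (k.+1.-tuple R) := [set x | r <= enorm x].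

Lemma outsideE r : outside r = ~` [set x | enorm x < r].
Proof.
by apply/seteqP; split=> x; rewrite /outside /= leNgt => /negP.
Qed.

Lemma measurable_outside r : measurable (outside r).
Proof. by rewrite outsideE; apply: measurableC; exact: measurable_ball. Qed.

(** With u = beta q ^ gamma, the density is e ^ (- u) times a power of u, and by
    log (u / u0) <= (u - u0) / u0 this power is beaten by half of the exponent as
    soon as u0 is large. *)
Lemma rad_density_decay (r q : R) : 0 < c -> 0 < beta -> 0 < gamma -> 0 < r -> r <= q ->
  2 * `|alpha| / gamma <= beta * r `^ gamma ->
  rad q <= rad r * expR (- ((beta * q `^ gamma - beta * r `^ gamma) / 2)).
Proof.
move=> c0 b0 g0 r0 rq u0a.
have q0 : 0 < q by exact: lt_le_trans rq.
set u0 := beta * r `^ gamma in u0a *; set u := beta * q `^ gamma.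
have u00 : 0 < u0 by rewrite mulr_gt0 // powR_gt0.
have uu : u0 <= u by rewrite ler_pM2l // ge0_ler_powR ?nnegrE // ltW.
have lnq (x : R) : 0 < x -> x `^ alpha = expR (alpha * ln x) by move=> x0; rewrite /powR gt_eqF.
have lnu : gamma * (ln q - ln r) <= (u - u0) / u0.
  have u0' : 0 < u by exact: lt_le_trans uu.
  have -> : gamma * (ln q - ln r) = ln (u / u0).
    rewrite ln_div ?posrE // /u /u0 !lnM ?posrE ?powR_gt0 // !ln_powR; ring.
  have := @le_ln1Dx R (u / u0 - 1).
  have -> : 1 + (u / u0 - 1) = u / u0 by ring.
  have -> : (u - u0) / u0 = u / u0 - 1 by field; exact: lt0r_neq0.
  by apply; rewrite ltrBrDl subrr divr_gt0.
rewrite /rad_density !mulNr -/u -/u0 !lnq // -!mulrA ler_pM2l // -!expRD ler_expR.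
suff : alpha * (ln q - ln r) <= (u - u0) / 2 by lra.
have d0 : 0 <= ln q - ln r by rewrite subr_ge0 ler_ln ?posrE.
apply: (@le_trans _ _ (`|alpha| * (ln q - ln r))); first by rewrite ler_wpM2r // ler_norm.
have -> : `|alpha| * (ln q - ln r) = `|alpha| / gamma * (gamma * (ln q - ln r)).
  by field; exact: lt0r_neq0.
apply: (@le_trans _ _ (`|alpha| / gamma * ((u - u0) / u0))).
  by rewrite ler_wpM2l // divr_ge0 // ltW.
have -> : `|alpha| / gamma * ((u - u0) / u0) = (2 * `|alpha| / gamma / u0) * ((u - u0) / 2).
  by field; rewrite !gt_eqF.
rewrite ler_piMl ?divr_ge0 ?subr_ge0 // ler_pdivrMr // mul1r //.
Qed.

Lemma expRB1_le (x : R) : expR x - 1 <= x * expR x.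
Proof.
have h := expR_ge1Dx (- x).
have E : expR x * expR (- x) = 1 by rewrite -expRD subrr expR0.
have : expR x * (1 + - x) <= expR x * expR (- x) by rewrite ler_pM2l ?expR_gt0.
rewrite E; nra.
Qed.

(** By layers: the set where (u - u0) / 2 < t is a shell of outer radius
    r (1 + 2 t / u0) ^ (1 / gamma), whose volume is at most of order
    r ^ d (t / u0) e ^ (t / 2). *)
Lemma outside_integral (r : R) : 0 < beta -> 0 < gamma -> 0 < r ->
  8 * k.+1%:R / gamma <= beta * r `^ gamma ->
  (\int[lam k.+1]_(x in outside r)
     (expR (- ((beta * enorm x `^ gamma - beta * r `^ gamma) / 2)))%:E <=
   (v * r ^+ k.+1 * (16 * k.+1%:R / gamma / (beta * r `^ gamma)))%:E)%E.
Proof.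
move=> b0 g0 r0 u0k.
set u0 := beta * r `^ gamma in u0k *.
have u00 : 0 < u0 by rewrite mulr_gt0 // powR_gt0.
pose phi (x : k.+1.-tuple R) := (beta * enorm x `^ gamma - u0) / 2.
have mphi : measurable_fun setT phi.
  apply: measurable_funM => //; apply: measurable_funB => //; apply: measurable_funM => //.
  by apply: (measurableT_comp (measurable_powR _)); exact: measurable_enorm.
have me : measurable_fun setT (fun u : R => expR (- u)).
  by apply: measurableT_comp => //; exact: measurable_funN.
have e0 (u : R) : 0 <= expR (- u) by exact: expR_ge0.
have mo := measurable_outside r.
have mi : measurable_fun setT (\1_(outside r) : k.+1.-tuple R -> R) by exact: measurable_indic.
have i0 y : 0 <= \1_(outside r) y :> R by rewrite indicE.
have tail (a z : R) : 0 < a -> (\int[mu]_(u in `]z, +oo[) (expR (- (a * u)))%:E = (a^-1 * expR (- (a * z)))%:E)%E.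
  by move=> a0; exact: integral_expR_tail.
have E1 := @layer_cake_weight _ _ _ (lam k.+1) phi _ _ mphi mi me i0 e0.
have -> : (\int[lam k.+1]_(x in outside r) (expR (- ((beta * enorm x `^ gamma - u0) / 2)))%:E =
   \int[lam k.+1]_y ((\1_(outside r) y)%:E * \int[mu]_(u in `](phi y), +oo[) (expR (- u))%:E))%E.
  rewrite integral_mkcond; apply: eq_integral => y _; rewrite patchE indicE.
  have -> : (\int[mu]_(u in `](phi y), +oo[) (expR (- u))%:E = (expR (- phi y))%:E)%E.
    have := tail 1 (phi y) ltr01; rewrite invr1 !mul1r => <-.
    by apply: eq_integral => u _; rewrite mul1r.
  by case: (y \in outside r); rewrite ?mul1e ?mul0e.
rewrite E1.
pose CC := v * r ^+ k.+1 * (8 * k.+1%:R / gamma / u0).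
have CC0 : 0 <= CC.
  apply: mulr_ge0; first by rewrite mulr_ge0 ?exprn_ge0 ?(ltW v0) // ltW.
  by rewrite divr_ge0 ?(ltW u00) // divr_ge0 ?(ltW g0) // mulr_ge0.
have h2 : 0 < 2^-1 :> R by rewrite invr_gt0.
have -> : (v * r ^+ k.+1 * (16 * k.+1%:R / gamma / u0))%:E =
  (\int[mu]_(t in `]0%R, +oo[) (CC%:E * (expR (- (2^-1 * t)))%:E))%E.
  rewrite ge0_integralZl //.
  - rewrite tail // mulr0 oppr0 expR0 mulr1 invrK -EFinM /CC; congr EFin; field.
    by rewrite !gt_eqF.
  - apply/measurable_EFinP; apply: measurable_funTS; apply: measurableT_comp => //.
    by apply: measurable_funN => //; exact: measurable_funM.
rewrite [leRHS]integral_mkcond; apply: ge0_le_integral => //.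
- by move=> t _; rewrite mule_ge0 ?lee_fin //; apply: integral_ge0 => y _; rewrite lee_fin.
- apply: emeasurable_funM; first exact/measurable_EFinP.
  have mF : measurable_fun setT (fun p : k.+1.-tuple R * measurableTypeR R =>
     ((\1_(outside r) p.1 * \1_[set p : k.+1.-tuple R * measurableTypeR R | phi p.1 < p.2] p : R)%:E)).
    apply/measurable_EFinP; apply: measurable_funM; first exact: measurableT_comp.
    apply: measurable_indic; apply: measurable_ltset; first exact: measurableT_comp.
    exact: measurable_snd.
  have := measurable_fun_fubini_tonelli_G (m1 := lam k.+1) _ mF.
  move=> /(_ _)/wrap[]; first by move=> p; rewrite lee_fin mulr_ge0 // indicE.
  congr (measurable_fun _ _); apply/funext => t; rewrite /fubini_G [RHS]integral_mkcond.
  apply: eq_integral => y _; rewrite patchE [X in _ * X]indic_lt /=.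
  case: ifPn => [/set_mem /= -> |]; first by rewrite mulr1.
  by case: ltP => // yt; rewrite ?mulr0 // mem_set.
- apply/(measurable_restrictT _ _).1 => //; apply: measurable_funeM.
  apply/measurable_EFinP; apply: measurable_funTS; apply: measurableT_comp => //.
  by apply: measurable_funN => //; exact: measurable_funM.
move=> t _.
have mlt : measurable [set y | phi y < t] by exact: measurable_ltset.
rewrite integral_indic //.
have monou (q : R) : r <= q -> u0 <= beta * q `^ gamma.
  by move=> rq; rewrite ler_pM2l // ge0_ler_powR ?nnegrE ?(le_trans (ltW r0) rq) // ltW.
rewrite patchE; case: ifPn => [/set_mem /=|ht]; last first.
  rewrite (_ : outside r `&` [set y | phi y < t] = set0); first by rewrite measure0 mule0.
  apply/seteqP; split=> // y /= [ry]; rewrite /phi => pt.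
  have := monou _ ry => uy; move: ht; rewrite mem_set //= in_itv /= andbT.
  lra.
rewrite in_itv /= andbT => t0.
pose tau := 2 * t / u0.
have tau0 : 0 < tau by rewrite divr_gt0 // mulr_gt0.
have t10 : 0 < 1 + tau by rewrite addr_gt0.
pose q := r * (1 + tau) `^ gamma^-1.
have q0 : 0 < q by rewrite mulr_gt0 // powR_gt0.
have qr : r <= q.
  have p1 : (1 : R) `^ gamma^-1 = 1 by rewrite powR1.
  rewrite ler_peMr ?(ltW r0) // -[leLHS]p1 ge0_ler_powR ?nnegrE ?invr_ge0 //; lra.
have qE : beta * q `^ gamma = u0 + 2 * t.
  rewrite /q powRM ?powR_ge0 ?(ltW r0) // -powRrM mulVf ?gt_eqF // powRr1 ?(ltW t10) //.
  by rewrite mulrA -/u0 /tau; field; exact: lt0r_neq0.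
have sub : outside r `&` [set y | phi y < t] `<=` shell r q.
  move=> y /= [ry pt]; apply/andP; split => //.
  rewrite ltNge; apply/negP => qy.
  have : beta * q `^ gamma <= beta * enorm y `^ gamma.
    by rewrite ler_pM2l // ge0_ler_powR ?nnegrE ?enorm_ge0 // ltW.
  by rewrite qE; move: pt; rewrite /phi; lra.
apply: (@le_trans _ _ ((expR (- t))%:E * lam k.+1 (shell r q)))%E.
  apply: lee_wpmul2l; first by rewrite lee_fin.
  apply: le_measure; rewrite ?inE //; [exact: measurableI|exact: measurable_shell].
rewrite (shell_volume volE) // -!EFinM lee_fin.
have qd : q ^+ k.+1 <= r ^+ k.+1 * expR (k.+1%:R / gamma * tau).
  rewrite /q exprMn ler_pM2l ?exprn_gt0 // -powR_mulrn ?powR_ge0 // -powRrM.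
  rewrite /powR gt_eqF // ler_expR mulrC [leRHS]mulrC (mulrC gamma^-1).
  rewrite ler_wpM2r //; first by rewrite divr_ge0 // ltW.
  by apply: le_ln1Dx; lra.
have ktau : k.+1%:R / gamma * tau <= t / 4.
  have -> : k.+1%:R / gamma * tau = (8 * k.+1%:R / gamma) / u0 * (t / 4).
    by rewrite /tau; field; rewrite !gt_eqF.
  by rewrite ler_piMl ?divr_ge0 ?(ltW t0) // ler_pdivrMr // mul1r.
have kt0 : 0 <= k.+1%:R / gamma * tau by rewrite mulr_ge0 ?(ltW tau0) // divr_ge0 ?(ltW g0).
have B1 : q ^+ k.+1 - r ^+ k.+1 <= r ^+ k.+1 * (8 * k.+1%:R / gamma / u0 * expR (t / 2)).
  apply: (@le_trans _ _ (r ^+ k.+1 * (expR (k.+1%:R / gamma * tau) - 1))).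
    by rewrite mulrBr mulr1 lerB.
  rewrite ler_pM2l ?exprn_gt0 //; apply: (le_trans (expRB1_le _)).
  apply: (@le_trans _ _ (k.+1%:R / gamma * tau * expR (t / 4))).
    by rewrite ler_wpM2l // ler_expR.
  have -> : k.+1%:R / gamma * tau * expR (t / 4) = 8 * k.+1%:R / gamma / u0 * (t / 4 * expR (t / 4)).
    by rewrite /tau; field; rewrite !gt_eqF.
  have -> : expR (t / 2) = expR (t / 4) * expR (t / 4) by rewrite -expRD; congr expR; field.
  have a0 : 0 <= 8 * k.+1%:R / gamma / u0.
    by rewrite divr_ge0 ?(ltW u00) // divr_ge0 ?(ltW g0) // mulr_ge0.
  apply: ler_wpM2l => //; apply: ler_wpM2r; first exact: expR_ge0.
  have := expR_ge1Dx (t / 4); lra.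
have -> : CC * expR (- (2^-1 * t)) = expR (- t) * (v * (r ^+ k.+1 * (8 * k.+1%:R / gamma / u0 * expR (t / 2)))).
  have -> : expR (- (2^-1 * t)) = expR (- t) * expR (t / 2) by rewrite -expRD; congr expR; field.
  by rewrite /CC; ring.
by rewrite ler_pM2l ?expR_gt0 // ler_pM2l.
Qed.

Hypothesis mf : measurable_fun setT f.
Hypothesis f0 : forall y, 0 <= f y.

(** The factor 1 / l comes from u0 = beta r ^ gamma, which is comparable to l. *)
Lemma tail_bound (K : R) : 0 < c -> 0 < beta -> 0 < gamma -> 0 < K ->
  gamma_tail R c alpha beta gamma f ->
  exists CT, \forall l \near +oo, forall s, `|s| <= K * ln l ->
    (\int[lam k.+1]_(x in outside (A l + b l * s)) (f x)%:E <=
     (CT * (pk l * A l ^+ k.+1 / l * expR (- s)))%:E)%E.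
Proof.
move=> c0 b0 g0 K0 hf.
pose g1 := (2^-1 : R) `^ gamma.
have g10 : 0 < g1 by rewrite powR_gt0 // invr_gt0.
(* the radius lies between A / 2 and 2 A, whence the two powers of 2 *)
exists (expR 2 * (v * 2 ^+ k.+1 * (16 * k.+1%:R / gamma / g1))).
have [M [M0 HM]] := density_ratio c0 ltr01 hf.
have one1 : 0 < (1 : R) <= 1 by rewrite ltr01 lexx.
near=> l => s hs.
have [l0 L1 L2 W] : [/\ 0 < l, 1 <= K * ln l,
    100 * ((gamma * l)^-1 * (K * ln l) ^+ 2) <= 1 &
    forall s, `|s| <= K * ln l ->
      within_factor 1 (rad (A l + b l * s)) (pk l * expR (- s))].
  by near: l; exact: window_near.
have [_ _ L3] : [/\ 0 < l, 1 <= K * ln l & (gamma * l)^-1 * (K * ln l) <= 2^-1].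
  by near: l; apply: near_log_small => //; rewrite invr_gt0.
have AM : 2 * (M + 1) <= A l by near: l; exact: near_scaleA_ge.
have lU : (2 * `|alpha| / gamma + 8 * k.+1%:R / gamma) / g1 <= l by near: l; exact: near_pinfty_ge.
have A0 := scaleA_gt0 gamma b0 l0; have sb0 := scaleb_gt0 b0 g0 l0.
have pk0 : 0 < pk l by rewrite /peak !mulr_gt0 ?expR_gt0 // powR_gt0.
set r := A l + b l * s.
have e0 : 0 < (gamma * l)^-1 by rewrite invr_gt0 mulr_gt0.
have /andP[r1 r2] : A l * 2^-1 <= r <= A l * 2.
  have -> : r = A l * (1 + (gamma * l)^-1 * s) by rewrite /r /scaleb; ring.
  move: hs; rewrite ler_norml => /andP[h1 h2].
  have : (gamma * l)^-1 * s <= (gamma * l)^-1 * (K * ln l) by rewrite ler_pM2l.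
  have : (gamma * l)^-1 * - (K * ln l) <= (gamma * l)^-1 * s by rewrite ler_pM2l.
  by rewrite mulrN => h3 h4; rewrite !ler_pM2l //; apply/andP; split; lra.
have r0 : 0 < r by apply: lt_le_trans r1; rewrite mulr_gt0 // invr_gt0.
have u0l : g1 * l <= beta * r `^ gamma.
  have : (A l * 2^-1) `^ gamma <= r `^ gamma.
    by rewrite ge0_ler_powR ?nnegrE ?(ltW g0) ?(ltW r0) // mulr_ge0 ?invr_ge0 // ltW.
  rewrite powRM ?invr_ge0 ?(ltW A0) // -(ler_pM2l b0) mulrA scaleAE // -/g1.
  by rewrite mulrC.
have a1 : 0 <= 2 * `|alpha| / gamma by rewrite divr_ge0 ?(ltW g0) // mulr_ge0.
have a2 : 0 <= 8 * k.+1%:R / gamma by rewrite divr_ge0 ?(ltW g0) // mulr_ge0.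
have lU' : 2 * `|alpha| / gamma + 8 * k.+1%:R / gamma <= g1 * l.
  by move: lU; rewrite ler_pdivrMr // (mulrC l).
have u1 : 2 * `|alpha| / gamma <= beta * r `^ gamma by lra.
have u2 : 8 * k.+1%:R / gamma <= beta * r `^ gamma by lra.
have u00 : 0 < beta * r `^ gamma by rewrite mulr_gt0 // powR_gt0.
have /andP[_ wr] := W s hs; rewrite -/r in wr.
pose Cf := expR 2 * (pk l * expR (- s)).
have Cf0 : 0 <= Cf by rewrite mulr_ge0 ?expR_ge0 // mulr_ge0 ?expR_ge0 // ltW.
apply: (@le_trans _ _ (\int[lam k.+1]_(x in outside r)
     (Cf%:E * (expR (- ((beta * enorm x `^ gamma - beta * r `^ gamma) / 2)))%:E)))%E.
  have mex : measurable_fun (outside r) (fun x : k.+1.-tuple R => (expR (- ((beta * enorm x `^ gamma - beta * r `^ gamma) / 2)))%:E).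
    apply/measurable_EFinP; apply: measurable_funTS; apply: measurableT_comp => //; apply: measurable_funN.
    apply: measurable_funM => //; apply: measurable_funB => //; apply: measurable_funM => //.
    by apply: (measurableT_comp (measurable_powR _)); exact: measurable_enorm.
  apply: ge0_le_integral => //.
  - exact: measurable_outside.
  - by move=> x _; rewrite lee_fin.
  - by apply/measurable_EFinP; exact: measurable_funTS.
  - exact: measurable_funeM.
  move=> x rx; rewrite -EFinM lee_fin.
  have Mx : M < enorm x by apply: lt_le_trans rx; apply: lt_le_trans r1; lra.
  have /andP[_ fx] := HM x Mx.
  apply: (le_trans fx); have dec := rad_density_decay c0 b0 g0 r0 rx u1.
  have e2 : expR 2 = expR 1 * expR 1 :> R by rewrite -expRD; congr expR; ring.
  rewrite /Cf e2 -[leRHS]mulrA -[leRHS]mulrA ler_pM2l ?expR_gt0 //.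
  apply: (le_trans dec); rewrite mulrA ler_pM2r ?expR_gt0 //.
rewrite ge0_integralZl //; last 2 first.
- exact: measurable_outside.
- apply/measurable_EFinP; apply: measurable_funTS; apply: measurableT_comp => //; apply: measurable_funN.
  apply: measurable_funM => //; apply: measurable_funB => //; apply: measurable_funM => //.
  by apply: (measurableT_comp (measurable_powR _)); exact: measurable_enorm.
apply: (le_trans (lee_wpmul2l _ (outside_integral b0 g0 r0 u2))); first by rewrite lee_fin.
rewrite -EFinM lee_fin /Cf.
have -> : expR 2 * (v * 2 ^+ k.+1 * (16 * k.+1%:R / gamma / g1)) * (pk l * A l ^+ k.+1 / l * expR (- s)) =
  expR 2 * (pk l * expR (- s)) * (v * (A l * 2) ^+ k.+1 * (16 * k.+1%:R / gamma / (g1 * l))).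
  by rewrite exprMn; field; rewrite !gt_eqF.
rewrite ler_wpM2l //; apply: ler_pM.
- by rewrite mulr_ge0 ?exprn_ge0 ?(ltW v0) // ltW.
- by rewrite divr_ge0 ?(ltW u00) // divr_ge0 ?(ltW g0) // mulr_ge0.
- by rewrite ler_pM2l // lerXn2r // nnegrE ?(ltW r0) // mulr_ge0 // ltW.
apply: ler_wpM2l; first by rewrite divr_ge0 ?(ltW g0) // mulr_ge0.
by rewrite lef_pV2 ?posrE // mulr_gt0.
Unshelve. all: by end_near. Qed.

End tail.

(** * Probability that two points are far apart *)

Section link_estimates.
Context {R : realType} {k : nat}.
Variables (c alpha beta gamma : R) (f : k.+1.-tuple R -> R) (v : R).
Variable mu : probability (k.+1.-tuple R) R.
Local Notation lam := (@lebesgue_tuple R).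
Local Notation A := (scaleA beta gamma).
Local Notation b := (scaleb beta gamma).
Local Notation pk := (peak c alpha beta gamma).
Local Notation cm := (@cross_mass R k c alpha beta gamma).
Local Notation sm := (@sphere_mass R k beta gamma v).

Definition far_pairs (rS rho : R) : set (k.+1.-tuple R * k.+1.-tuple R) :=
  [set p | enorm p.1 < rS /\ far_region rS rho p.1 p.2].

Lemma enorm_tsubC n (x y : n.-tuple R) : enorm (tsub x y) = enorm (tsub y x).
Proof.
apply: enorm_eq; rewrite !enorm_sq; apply: eq_bigr => i _.
by rewrite !tnth_mktuple -sqrrN opprB.
Qed.

Lemma far_pairs_sym rS rho x y : far_pairs rS rho (x, y) -> far_pairs rS rho (y, x).
Proof. by move=> [/= h1 [h2 h3]]; split=> //=; split=> //; rewrite enorm_tsubC. Qed.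

Lemma measurable_far_pairs rS rho : measurable (far_pairs rS rho).
Proof.
have m1 : measurable_fun setT (fun p : k.+1.-tuple R * k.+1.-tuple R => enorm p.1).
  exact: (measurableT_comp measurable_enorm).
have m2 : measurable_fun setT (fun p : k.+1.-tuple R * k.+1.-tuple R => enorm p.2).
  exact: (measurableT_comp measurable_enorm).
have m3 : measurable_fun setT (fun p : k.+1.-tuple R * k.+1.-tuple R => enorm (tsub p.1 p.2)).
  apply: (measurableT_comp measurable_enorm); apply: measurable_tsub; [exact: measurable_fst|exact: measurable_snd].
apply: measurableI; first by apply: measurable_ltset.
by apply: measurableI; apply: measurable_ltset.
Qed.

Lemma xsection_far_pairs rS rho x : xsection (far_pairs rS rho) x =
  if enorm x < rS then far_region rS rho x else set0.
Proof.
apply/seteqP; split=> y; rewrite /xsection /=.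
  by move=> /set_mem [/= -> ].
by case: ifP => // xS h; apply/mem_set; split.
Qed.

Lemma enorm_antipole_sub_le r (y : k.+1.-tuple R) : 0 <= r ->
  enorm (tsub (antipole r) y) <= r + enorm y.
Proof.
move=> r0; rewrite -(@ler_pXn2r _ 2) // ?nnegrE ?addr_ge0 ?enorm_ge0 //.
have yE : y = tcons (thead y) [tuple of behead y] by rewrite [LHS]tuple_eta; exact/val_inj.
rewrite {1}yE enorm_antipole_sub.
have qE : enorm y ^+ 2 = thead y ^+ 2 + enorm [tuple of behead y] ^+ 2.
  by rewrite {1}yE enorm_tcons.
have ty : thead y <= enorm y.
  rewrite leNgt; apply/negP => h.
  have := sqr_lt (enorm_ge0 y) h; rewrite qE.
  by have := sqr_ge0 (enorm [tuple of behead y]); lra.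
have : r * thead y <= r * enorm y by rewrite ler_wpM2l.
by move: qE; rewrite !sqrrD; lra.
Qed.

Lemma far_region_antipole0 rS rho r : 0 <= r -> r + rS <= rho ->
  far_region rS rho (antipole r : k.+1.-tuple R) = set0.
Proof.
move=> r0 rr; apply/seteqP; split=> // y [/= yS h].
by have := enorm_antipole_sub_le y r0; lra.
Qed.

Hypothesis mf : measurable_fun setT f.
Hypothesis f0 : forall y, 0 <= f y.
Hypothesis muE : forall B, measurable B -> mu B = (\int[lam k.+1]_(y in B) (f y)%:E)%E.
Hypothesis mu_rot : forall rS rho x z, enorm x = enorm z ->
  mu (far_region rS rho x) = mu (far_region rS rho z).
Hypothesis v0 : 0 < v.
Hypothesis volE : forall r, 0 < r -> lam k.+1 [set x | enorm x < r] = (v * r ^+ k.+1)%:E.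

(** A point with partners has normalized radius at least w - sS by the triangle
    inequality, and at most sS by truncation. *)
Lemma far_pairs_xsection (K ep : R) : 0 < c -> 0 < beta -> 0 < gamma -> 0 < K -> 0 < ep <= 1 ->
  gamma_tail R c alpha beta gamma f ->
  \forall l \near +oo, forall w sS,
    `|w| <= K * ln l -> `|sS| <= K * ln l -> `|w - sS| <= K * ln l ->
    forall x, (mu (xsection (far_pairs (A l + b l * sS) (2 * A l + b l * w)) x) <=
     (fun x => (expR (3 * ep) * cm l * expR (- w) * expR (- (- ((enorm x - A l) / b l))))%:E)
       \_ (shell (A l + b l * (w - sS)) (A l + b l * sS)) x)%E.
Proof.
move=> c0 b0 g0 K0 ep01 hf; have l0 := nbhs_pinfty_gt (num_real (0 : R)).
apply: filterS2 l0 (pair_upper mf f0 c0 b0 g0 K0 ep01 hf) => l l0 PU w sS hw hsS hws x.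
have A0 := scaleA_gt0 gamma b0 l0; have sb0 := scaleb_gt0 b0 g0 l0.
have pk0 : 0 < pk l by rewrite /peak !mulr_gt0 ?expR_gt0 // powR_gt0.
have cm0 : 0 <= cm l by rewrite /cross_mass mulr_ge0 ?exprn_ge0 ?sqrtr_ge0 // mulr_ge0 // ltW.
set s1 := (enorm x - A l) / b l.
have xE : enorm x = A l + b l * s1 by rewrite /s1 mulrC divfK ?gt_eqF // addrC subrK.
rewrite xsection_far_pairs patchE; case: ifPn => xS; last first.
  rewrite measure0; case: ifP => // _; rewrite lee_fin.
  by rewrite mulr_ge0 ?expR_ge0 // mulr_ge0 ?expR_ge0 // mulr_ge0 ?expR_ge0.
have x0 := enorm_ge0 x.
rewrite (@mu_rot _ _ x (antipole (enorm x))) ?enorm_antipole //.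
case: ifPn => [/set_mem /= /andP[h1 _]|hx]; last first.
  rewrite far_region_antipole0 ?measure0 //.
  have : enorm x < A l + b l * (w - sS).
    by rewrite ltNge; apply/negP => h; move: hx; rewrite mem_set //; apply/andP.
  by rewrite mulrBr => h; lra.
rewrite muE; last exact: measurable_far_region.
have hs1 : `|s1| <= K * ln l.
  move: h1 xS; rewrite xE lerD2l ler_pM2l // ltrD2l ltr_pM2l // => h1 h2.
  move: hws hsS; rewrite !ler_norml => /andP[h3 h4] /andP[h5 h6].
  by apply/andP; split; lra.
rewrite {1}xE; apply: (le_trans (PU _ _ _ hs1 hw hsS)).
rewrite opprK lee_fin expRD; move: (cm l) => p.
by rewrite le_eqVlt; apply/orP; left; apply/eqP; ring.
Qed.

Let shell_mu (l sa sb : R) :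
  (\int[mu]_(x in shell (A l + b l * sa) (A l + b l * sb)) (expR (- (- ((enorm x - A l) / b l))))%:E =
   \int[lam k.+1]_(x in shell (A l + b l * sa) (A l + b l * sb))
     (f x * expR (- (- ((enorm x - A l) / b l))))%:E)%E.
Proof.
apply: (@density_integral_expR _ _ _ _ _ f (fun x => - ((enorm x - A l) / b l))) => //.
  apply: measurable_funN => //; apply: measurable_funM => //.
  by apply: measurable_funB => //; exact: measurable_enorm.
exact: measurable_shell.
Qed.

Let mexpn (D : set (k.+1.-tuple R)) (l : R) :
  measurable_fun D (fun x : k.+1.-tuple R => (expR (- (- ((enorm x - A l) / b l))))%:E).
Proof.
apply/measurable_EFinP; apply: measurable_funTS.
apply: measurableT_comp => //; apply: measurable_funN; apply: measurable_funN; apply: measurable_funM => //.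
by apply: measurable_funB => //; exact: measurable_enorm.
Qed.

Let mxs rS rho : measurable_fun setT (fun x => mu (xsection (far_pairs rS rho) x)).
Proof. exact: (measurable_fun_xsection _ (measurable_far_pairs rS rho)). Qed.

(** Integrate the bound of [far_pairs_xsection] over the position of the first
    point. For a star the bound is squared; one of the two factors e ^ s1 is then
    estimated by e ^ sS and the other one is integrated. *)
Lemma link_upper (K ep : R) : 0 < c -> 0 < beta -> 0 < gamma -> 0 < K -> 0 < ep <= 1 ->
  gamma_tail R c alpha beta gamma f ->
  \forall l \near +oo, forall w sS,
    `|w| <= K * ln l -> `|sS| <= K * ln l -> `|w - sS| <= K * ln l -> w <= 2 * sS ->
    link_prob mu (far_pairs (A l + b l * sS) (2 * A l + b l * w)) <=
      expR (5 * ep) * (cm l * (pk l * sm l) * expR (- w) * (2 * sS - w)) /\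
    star_prob mu (far_pairs (A l + b l * sS) (2 * A l + b l * w)) <=
      (expR (3 * ep) * cm l * expR (- w)) ^+ 2 * expR sS *
      (expR (2 * ep) * (pk l * sm l * (2 * sS - w))).
Proof.
move=> c0 b0 g0 K0 ep01 hf; have l0 := nbhs_pinfty_gt (num_real (0 : R)).
apply: filterS3 l0 (far_pairs_xsection c0 b0 g0 K0 ep01 hf)
  (shell_integral v0 volE mf f0 c0 b0 g0 K0 ep01 hf) => l l0 X0 SI w sS hw hsS hws wsS.
have A0 := scaleA_gt0 gamma b0 l0; have sb0 := scaleb_gt0 b0 g0 l0.
have pk0 : 0 < pk l by rewrite /peak !mulr_gt0 ?expR_gt0 // powR_gt0.
have cm0 : 0 <= cm l by rewrite /cross_mass mulr_ge0 ?exprn_ge0 ?sqrtr_ge0 // mulr_ge0 // ltW.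
set G := far_pairs _ _.
have mG : measurable G by exact: measurable_far_pairs.
pose S : set (k.+1.-tuple R) := shell (A l + b l * (w - sS)) (A l + b l * sS).
have mS : measurable S by exact: measurable_shell.
pose C := expR (3 * ep) * cm l * expR (- w).
have C0 : 0 <= C by rewrite mulr_ge0 ?expR_ge0 // mulr_ge0 ?expR_ge0.
have X1 x : (mu (xsection G x) <= (fun x => C%:E * (expR (- (- ((enorm x - A l) / b l))))%:E) \_ S x)%E.
  by have := X0 w sS hw hsS hws x; rewrite !patchE; case: ifP => // _; rewrite -EFinM.
have wS : w - sS <= sS by lra.
have /andP[_ I2] := SI _ _ hws hsS wS.
have bound (D : R) : 0 <= D -> (\int[mu]_x ((fun x => D%:E * (expR (- (- ((enorm x - A l) / b l))))%:E) \_ S x) <=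
    (D * (expR (2 * ep) * (pk l * sm l * (2 * sS - w))))%:E)%E.
  move=> D0; rewrite -integral_mkcond ge0_integralZl //.
  rewrite [leLHS](congr1 (fun X => (D%:E * X)%E) (shell_mu l (w - sS) sS)).
  rewrite EFinM; apply: lee_wpmul2l; first by rewrite lee_fin.
  have -> : 2 * sS - w = sS - (w - sS) by ring.
  exact: I2.
have fineLE (u : \bar R) (r : R) : (0 <= u)%E -> (u <= r%:E)%E -> fine u <= r.
  by move=> u0 ur; rewrite -lee_fin fineK // ge0_fin_numE // (le_lt_trans ur) // ltry.
have mP (D : R) : measurable_fun setT ((fun x : k.+1.-tuple R => D%:E * (expR (- (- ((enorm x - A l) / b l))))%:E)%E \_ S).
  by apply/(measurable_restrictT _ _).1 => //; apply: measurable_funeM; exact: mexpn.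
split.
  apply: fineLE; first by apply: integral_ge0 => x _; exact: measure_ge0.
  have -> : expR (5 * ep) * (cm l * (pk l * sm l) * expR (- w) * (2 * sS - w)) =
     C * (expR (2 * ep) * (pk l * sm l * (2 * sS - w))).
    have -> : expR (5 * ep) = expR (3 * ep) * expR (2 * ep) by rewrite -expRD; congr expR; ring.
    by rewrite /C; move: (pk l) (cm l) (sm l) => p1 p2 p3; ring.
  apply: le_trans (bound C C0); apply: ge0_le_integral => //.
  - exact: mxs.
  - by move=> x _; exact: X1.
apply: fineLE; first by apply: integral_ge0 => x _; exact: measure_ge0.
apply: (le_trans _ (bound (C ^+ 2 * expR sS) _)); last first.
  by rewrite mulr_ge0 ?sqr_ge0 ?expR_ge0.
have xs x : xsection (star_set G) x = xsection G x `*` xsection G x.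
  apply/seteqP; split=> -[y z]; rewrite /xsection /=.
    by move=> /set_mem [h1 h2]; split; exact/mem_set.
  by move=> [/set_mem h1 /set_mem h2]; apply/mem_set.
have mstar x : (mu \x mu)%E (xsection (star_set G) x) = (mu (xsection G x) * mu (xsection G x))%E.
  by rewrite xs product_measure1E //; exact: measurable_xsection.
apply: ge0_le_integral => //.
- rewrite (_ : _ \o _ = fun x => mu (xsection G x) * mu (xsection G x))%E; last first.
    by apply/funext => x /=; rewrite mstar.
  by apply: emeasurable_funM; exact: mxs.
move=> x _; rewrite /= mstar; have := X1 x; rewrite !patchE; case: ifPn => [/set_mem /= /andP[_ xS]|_].
  move=> h; apply: (le_trans (lee_pmul _ _ h h)) => //.
  rewrite -!EFinM lee_fin.
  set s1 := (enorm x - A l) / b l.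
  have s1S : s1 <= sS.
    rewrite /s1 ler_pdivrMr //; move: xS; rewrite mulrC; lra.
  have -> : C * expR (- - s1) * (C * expR (- - s1)) = C ^+ 2 * (expR (- - s1) * expR (- - s1)) by ring.
  rewrite -[leRHS]mulrA ler_wpM2l ?sqr_ge0 // ler_wpM2r ?expR_ge0 // ler_expR opprK //.
move=> h; have -> : mu (xsection G x) = 0%E by apply/eqP; rewrite eq_le h measure_ge0.
by rewrite mul0e.
Qed.

(** The first point is kept in the range where [pair_lower] applies; this shortens
    the interval by a constant, which is negligible compared to its length. *)
Lemma link_lower (K ep M : R) : 0 < c -> 0 < beta -> 0 < gamma -> 0 < K -> 0 < ep <= 1 -> 0 < M ->
  0 <= 1 - expR (- (M / 2)) * Num.sqrt 2 ^+ k ->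
  gamma_tail R c alpha beta gamma f ->
  \forall l \near +oo, forall w sS,
    `|w| <= K * ln l -> `|sS| <= K * ln l -> `|w - sS + 2 * M + 3| <= K * ln l ->
    2 * M + 3 <= 2 * sS - w ->
    expR (- (5 * ep)) * ((1 - expR (- M)) * (1 - expR (- (M / 2)) * Num.sqrt 2 ^+ k)) *
       (cm l * (pk l * sm l) * expR (- w) * (2 * sS - w - 2 * M - 3)) <=
    link_prob mu (far_pairs (A l + b l * sS) (2 * A l + b l * w)).
Proof.
move=> c0 b0 g0 K0 ep01 M0 kM0 hf; have l0 := nbhs_pinfty_gt (num_real (0 : R)).
apply: filterS3 l0 (pair_lower mf f0 c0 b0 g0 K0 ep01 M0 hf)
  (shell_integral v0 volE mf f0 c0 b0 g0 K0 ep01 hf) => l l0 PL SI w sS hw hsS hws wsS.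
have A0 := scaleA_gt0 gamma b0 l0; have sb0 := scaleb_gt0 b0 g0 l0.
have pk0 : 0 < pk l by rewrite /peak !mulr_gt0 ?expR_gt0 // powR_gt0.
have cm0 : 0 <= cm l by rewrite /cross_mass mulr_ge0 ?exprn_ge0 ?sqrtr_ge0 // mulr_ge0 // ltW.
set G := far_pairs _ _.
have mG : measurable G by exact: measurable_far_pairs.
set sa := w - sS + 2 * M + 3 in hws.
pose S : set (k.+1.-tuple R) := shell (A l + b l * sa) (A l + b l * sS).
have mS : measurable S by exact: measurable_shell.
set kM := (1 - expR (- M)) * _.
have kM1 : 0 <= kM.
  by rewrite mulr_ge0 // subr_ge0 -expR0 ler_expR oppr_le0 ltW.
pose C := expR (- (3 * ep)) * cm l * expR (- w) * kM.
have C0 : 0 <= C by rewrite mulr_ge0 // mulr_ge0 ?expR_ge0 // mulr_ge0 ?expR_ge0.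
have saS : sa <= sS by rewrite /sa; lra.
have /andP[I1 _] := SI _ _ hws hsS saS.
have X1 x : ((fun x => C%:E * (expR (- (- ((enorm x - A l) / b l))))%:E) \_ S x <= mu (xsection G x))%E.
  rewrite patchE; case: ifPn => [/set_mem /= /andP[h1 h2]|_]; last exact: measure_ge0.
  rewrite xsection_far_pairs h2.
  have x0 := enorm_ge0 x.
  set s1 := (enorm x - A l) / b l.
  have xE : enorm x = A l + b l * s1 by rewrite /s1 mulrC divfK ?gt_eqF // addrC subrK.
  rewrite (@mu_rot _ _ x (antipole (enorm x))) ?enorm_antipole //.
  move: h1 h2; rewrite {1 2}xE lerD2l ler_pM2l // ltrD2l ltr_pM2l // => h1 h2.
  have hs1 : `|s1| <= K * ln l.
    move: hws hsS; rewrite !ler_norml => /andP[h3 h4] /andP[h5 h6].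
    by apply/andP; split; lra.
  have hs2 : w - s1 + 2 * M + 2 * ep < sS.
    by have /andP[_ ep1] := ep01; move: h1; rewrite /sa; lra.
  rewrite muE; last exact: measurable_far_region.
  rewrite xE; apply: le_trans (PL _ _ _ hs1 hw hsS hs2).
  rewrite -EFinM lee_fin opprK expRD /C /kM.
  by move: (cm l) => p; rewrite le_eqVlt; apply/orP; left; apply/eqP; ring.
have pfin : (mu \x mu)%E G \is a fin_num.
  pose mu2 : probability (k.+1.-tuple R * k.+1.-tuple R)%type R := (mu \x mu)%E.
  exact: (fin_num_measure mu2 G mG).
have fineGE (u : \bar R) (r : R) : u \is a fin_num -> (r%:E <= u)%E -> r <= fine u.
  by move=> ur ru; rewrite -lee_fin fineK.
apply: fineGE => //.
have -> : expR (- (5 * ep)) * kM * (cm l * (pk l * sm l) * expR (- w) * (2 * sS - w - 2 * M - 3)) =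
   C * (expR (- (2 * ep)) * (pk l * sm l * (sS - sa))).
  have -> : expR (- (5 * ep)) = expR (- (3 * ep)) * expR (- (2 * ep)) by rewrite -expRD; congr expR; ring.
  by rewrite /C /sa; move: (pk l) (cm l) (sm l) => p1 p2 p3; ring.
rewrite EFinM; apply: (le_trans (lee_wpmul2l _ I1)); first by rewrite lee_fin.
rewrite -shell_mu -ge0_integralZl //.
rewrite integral_mkcond; apply: ge0_le_integral => //.
- move=> x _; rewrite patchE; case: ifP => // _.
  by rewrite -EFinM lee_fin mulr_ge0 ?expR_ge0.
- by apply/(measurable_restrictT _ _).1 => //; apply: measurable_funeM; exact: mexpn.
- exact: mxs.
Qed.

End link_estimates.

(** * Calibration of the threshold *)

Section calibration.
Context {R : realType} {j : nat}.
Local Notation k := j.+1.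
Local Notation d := j.+2.
Variables (c alpha beta gamma x v : R).
Local Notation A := (scaleA beta gamma).
Local Notation b := (scaleb beta gamma).
Local Notation pk := (peak c alpha beta gamma).
Local Notation cm := (@cross_mass R k c alpha beta gamma).
Local Notation sm := (@sphere_mass R k beta gamma v).

Definition shape : R := (alpha + d%:R) / gamma.
Definition level_const : R :=
  ln (cprime d * beta `^ (- (2 * (alpha + d%:R) / gamma)) * gamma `^ (- ((d%:R + 3) / 2)) * c ^+ 2).
(** The normalized threshold: for l = log n the centring of the theorem plus [x]
    is 2 gamma l + level l. *)
Definition level (l : R) : R :=
  x + (2 * shape - (d%:R + 3) / 2) * ln l + ln (ln l) + level_const.
(** The normalized radius of the largest of n points is about
    (shape - 1) log l. The additional term makes larger radii unlikely, and is
    small enough to leave the stars negligible. *)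
Definition cutoff (l : R) : R := (shape - 1) * ln l + ln (ln l) / 2.

Lemma cutoff_level l : 2 * cutoff l - level l = k%:R / 2 * ln l - (x + level_const).
Proof. by rewrite /cutoff /level -[d]addn1 natrD; field. Qed.

Hypothesis hc : 0 < c.
Hypothesis hb : 0 < beta.
Hypothesis hg : 0 < gamma.
Hypothesis hv : 0 < v.
Hypothesis vE : v * (d%:R / 2 * Gamma (d%:R / 2)) = Num.sqrt pi ^+ d.

Let ln_scaleA l : 0 < l -> ln (A l) = (ln l - ln beta) / gamma.
Proof. by move=> l0; rewrite /scaleA ln_powR ln_div ?posrE // mulrC. Qed.

Let ln_scaleb l : 0 < l -> ln (b l) = ln (A l) - ln gamma - ln l.
Proof.
move=> l0; rewrite /scaleb ln_div ?posrE ?scaleA_gt0 ?mulr_gt0 // lnM ?posrE //; ring.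
Qed.

Let pk_gt0 l : 0 < l -> 0 < pk l.
Proof. by move=> l0; rewrite /peak mulr_gt0 ?expR_gt0 // mulr_gt0 // powR_gt0 // scaleA_gt0. Qed.

Let ln_pk l : 0 < l -> ln (pk l) = ln c + alpha * ln (A l) - l.
Proof.
move=> l0; have pA : 0 < A l `^ alpha by rewrite powR_gt0 // scaleA_gt0.
by rewrite /peak lnM ?posrE ?expR_gt0 ?mulr_gt0 // lnM ?posrE // ln_powR expRK.
Qed.

Let ln_sqrt (r : R) : 0 < r -> ln (Num.sqrt r) = ln r / 2.
Proof. by move=> r0; rewrite -powR12_sqrt ?ltW // ln_powR mulrC. Qed.

Let sqrt_arg_gt0 l : 0 < l -> 0 < pi * (4 * A l * b l).
Proof. by move=> l0; rewrite mulr_gt0 ?pi_gt0 // mulr_gt0 ?scaleb_gt0 // mulr_gt0 // scaleA_gt0. Qed.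

Let cm_gt0 l : 0 < l -> 0 < cm l.
Proof.
move=> l0; rewrite /cross_mass mulr_gt0 ?exprn_gt0 ?sqrtr_gt0 ?sqrt_arg_gt0 //.
by rewrite mulr_gt0 ?pk_gt0 // scaleb_gt0.
Qed.

Let ln_cm l : 0 < l -> ln (cm l) = ln (pk l) + ln (b l) +
  k%:R * ((ln pi + 2 * ln 2 + ln (A l) + ln (b l)) / 2).
Proof.
move=> l0; rewrite /cross_mass lnM ?posrE; last 2 first.
- by rewrite mulr_gt0 ?pk_gt0 // scaleb_gt0.
- by rewrite exprn_gt0 // sqrtr_gt0 sqrt_arg_gt0.
rewrite lnM ?posrE ?pk_gt0 ?scaleb_gt0 //; congr (_ + _).
rewrite lnXn ?sqrtr_gt0 ?sqrt_arg_gt0 // ln_sqrt ?sqrt_arg_gt0 // -[LHS]mulr_natl; congr (_ * (_ / _)).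
have A0 := scaleA_gt0 gamma hb l0; have b0 := scaleb_gt0 hb hg l0.
have ln4 : ln 4 = 2 * ln 2 :> R.
  have -> : 4 = 2 ^+ 2 :> R by ring.
  by rewrite lnXn // mulr_natl.
have A4 : 0 < 4 * A l by rewrite mulr_gt0.
have A4b : 0 < 4 * A l * b l by rewrite mulr_gt0.
by rewrite lnM ?posrE ?pi_gt0 // (lnM A4 b0) (lnM _ A0) ?posrE // ln4; ring.
Qed.

Let sm_gt0 l : 0 < l -> 0 < sm l.
Proof.
move=> l0; rewrite /sphere_mass mulr_gt0 ?scaleb_gt0 // mulr_gt0 ?exprn_gt0 ?scaleA_gt0 //.
by rewrite mulr_gt0 // ltr0n.
Qed.

Let ln_sm l : 0 < l -> ln (sm l) = ln v + ln d%:R + k%:R * ln (A l) + ln (b l).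
Proof.
move=> l0; have A0 := scaleA_gt0 gamma hb l0; have b0 := scaleb_gt0 hb hg l0.
have d0 : 0 < d%:R :> R by rewrite ltr0n.
have vd : 0 < v * d%:R by rewrite mulr_gt0.
have Ak : 0 < A l ^+ k by rewrite exprn_gt0.
have vA : 0 < v * d%:R * A l ^+ k by rewrite mulr_gt0.
by rewrite /sphere_mass (lnM vA b0) (lnM vd Ak) (lnM hv d0) lnXn // -[ln (A l) *+ _]mulr_natl.
Qed.

Let Gamma_gt0 : 0 < Gamma (d%:R / 2 : R).
Proof.
have p0 : 0 < Num.sqrt (pi : R) ^+ d by rewrite exprn_gt0 // sqrtr_gt0 pi_gt0.
move: p0; rewrite -vE pmulr_rgt0 // pmulr_rgt0 // divr_gt0 // ltr0n.
Qed.

Let ln_v : ln v = d%:R * ln pi / 2 - ln d%:R + ln 2 - ln (Gamma (d%:R / 2)).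
Proof.
have d0 : 0 < d%:R :> R by rewrite ltr0n.
have d2 : 0 < d%:R / 2 :> R by rewrite divr_gt0.
have dG : 0 < d%:R / 2 * Gamma (d%:R / 2) :> R by rewrite mulr_gt0.
have := congr1 (@ln R) vE; rewrite (lnM hv dG) (lnM d2 Gamma_gt0) ln_div ?posrE //.
rewrite lnXn ?sqrtr_gt0 ?pi_gt0 // ln_sqrt ?pi_gt0 // -[ln pi / 2 *+ _]mulr_natl; lra.
Qed.

Let level_constE : level_const = ln k%:R + j%:R * ln 2 + (d%:R - 2^-1) * ln pi - ln (Gamma (d%:R / 2))
  - (2 * (alpha + d%:R) / gamma) * ln beta - (d%:R + 3) / 2 * ln gamma + 2 * ln c.
Proof.
have k0 : 0 < k%:R :> R by rewrite ltr0n.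
have dk : d%:R - 1 = k%:R :> R by rewrite -[d]addn1 natrD addrK.
have pid : 0 < (pi : R) `^ (d%:R - 2^-1) by rewrite powR_gt0 // pi_gt0.
have k2 : 0 < k%:R * 2 ^+ j :> R by rewrite mulr_gt0 // exprn_gt0.
have cN : 0 < k%:R * 2 ^+ j * (pi : R) `^ (d%:R - 2^-1) by rewrite mulr_gt0.
have cE : cprime d = k%:R * 2 ^+ j * (pi : R) `^ (d%:R - 2^-1) / Gamma (d%:R / 2).
  by rewrite /cprime dk subn2.
have c1 : 0 < cprime d :> R by rewrite cE divr_gt0.
have p1 : 0 < beta `^ (- (2 * (alpha + d%:R) / gamma)) by rewrite powR_gt0.
have p2 : 0 < gamma `^ (- ((d%:R + 3) / 2)) by rewrite powR_gt0.
have p3 : 0 < c ^+ 2 by rewrite exprn_gt0.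
have p4 : 0 < cprime d * beta `^ (- (2 * (alpha + d%:R) / gamma)) by rewrite mulr_gt0.
have p5 : 0 < cprime d * beta `^ (- (2 * (alpha + d%:R) / gamma)) * gamma `^ (- ((d%:R + 3) / 2)).
  by rewrite mulr_gt0.
rewrite /level_const (lnM p5 p3) (lnM p4 p2) (lnM c1 p1) !ln_powR lnXn // -[ln c *+ _]mulr_natl.
have two0 : 0 < 2 ^+ j :> R by rewrite exprn_gt0.
rewrite cE (ln_div cN Gamma_gt0) (lnM k2 pid) (lnM k0 two0) ln_powR lnXn // -[ln 2 *+ _]mulr_natl.
ring.
Qed.

(** All factors are powers of l, log l and constants: taking logarithms reduces
    the identity to field arithmetic. It expresses how the constants of the
    theorem were chosen. *)
Lemma mass_level l : 1 < l ->
  expR (2 * l) * (cm l * (pk l * sm l)) * expR (- level l) = 4 / k%:R * expR (- x) / ln l.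
Proof.
move=> l1; have l0 : 0 < l by exact: lt_trans l1.
have ll0 : 0 < ln l by exact: ln_gt0.
have k0 : 0 < k%:R :> R by rewrite ltr0n.
have c0 := cm_gt0 l0; have p0 := pk_gt0 l0; have s0 := sm_gt0 l0.
apply: (@ln_inj R); rewrite ?posrE.
- by rewrite mulr_gt0 ?expR_gt0 // mulr_gt0 ?expR_gt0 // mulr_gt0 // mulr_gt0.
- by rewrite divr_gt0 // mulr_gt0 ?expR_gt0 // divr_gt0.
have ps : 0 < pk l * sm l by rewrite mulr_gt0.
have cps : 0 < cm l * (pk l * sm l) by rewrite mulr_gt0.
have ecps : 0 < expR (2 * l) * (cm l * (pk l * sm l)) by rewrite mulr_gt0 ?expR_gt0.
have k4 : 0 < 4 / k%:R :> R by rewrite divr_gt0.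
have kx : 0 < 4 / k%:R * expR (- x) by rewrite mulr_gt0 ?expR_gt0.
rewrite (lnM ecps (expR_gt0 _)) (lnM (expR_gt0 _) cps) (lnM c0 ps) (lnM p0 s0) !expRK.
rewrite (ln_div kx ll0) (lnM k4 (expR_gt0 _)) ln_div ?posrE // expRK.
rewrite ln_cm // ln_pk // ln_sm // ln_scaleb // ln_scaleA //.
have ln4 : ln 4 = 2 * ln 2 :> R.
  have -> : 4 = 2 ^+ 2 :> R by ring.
  by rewrite lnXn // mulr_natl.
rewrite ln4 /level /shape level_constE ln_v -[d]addn2 -[k]addn1 !natrD.
field; exact: lt0r_neq0.
Qed.

Definition cutoff_const : R := ln c + ln v + ln d%:R - ln gamma - shape * ln beta.

(** Among e ^ l points, the expected number per unit of normalized radius, at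
    normalized radius [cutoff l], is a constant times (log l) ^ (- 1 / 2). *)
Lemma expR_cutoff l : 1 < l ->
  expR (cutoff l) = expR l * (pk l * sm l) * expR (- cutoff_const) * expR (ln (ln l) / 2).
Proof.
move=> l1; have l0 : 0 < l by exact: lt_trans l1.
have p0 := pk_gt0 l0; have s0 := sm_gt0 l0.
have -> : pk l * sm l = expR (ln (pk l) + ln (sm l)) by rewrite expRD !lnK.
rewrite -!expRD; congr expR.
rewrite ln_pk // ln_sm // ln_scaleb // ln_scaleA // /cutoff /cutoff_const /shape.
rewrite -[d]addn2 -[k]addn1 !natrD; field; exact: lt0r_neq0.
Qed.

Lemma tail_cutoff l : 1 < l ->
  expR l * (pk l * A l ^+ d / l * expR (- cutoff l)) =
  expR (ln c - shape * ln beta) * expR (- (ln (ln l) / 2)).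
Proof.
move=> l1; have l0 : 0 < l by exact: lt_trans l1.
have p0 := pk_gt0 l0; have A0 := scaleA_gt0 gamma hb l0.
have -> : pk l * A l ^+ d / l = expR (ln (pk l) + d%:R * ln (A l) - ln l).
  rewrite !expRD expRN !lnK ?posrE //; congr (_ * _ / _).
  by rewrite expRM_natl lnK.
rewrite -!expRD; congr expR.
rewrite ln_pk // ln_scaleA // /cutoff /shape; field; exact: lt0r_neq0.
Qed.

Let K : R := 3 * `|shape| + (d%:R + 3) / 2 + 6.

(** Everything takes place at normalized radii of order log l. *)
Lemma level_bounds (M : R) : 0 <= M -> \forall l \near +oo,
  [/\ 1 < l, 1 <= ln l, `|level l| <= K * ln l, `|cutoff l| <= K * ln l &
   `|level l - cutoff l + M| <= K * ln l /\ M <= 2 * cutoff l - level l].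
Proof.
move=> M0; near=> l.
have l1 : 1 < l by near: l; exact: nbhs_pinfty_gt.
have l0 : 0 < l by exact: lt_trans l1.
have L1 : 1 <= ln l by near: l; exact: near_ln_ge.
have LL0 : 0 <= ln (ln l) by near: l; exact: near_lnln_ge.
have LL1 : ln (ln l) <= ln l.
  have := @le_ln1Dx R (ln l - 1); rewrite addrCA subrr addr0 => h.
  have : ln (ln l) <= ln l - 1 by apply: h; lra.
  lra.
have L2 : `|x + level_const| <= ln l by near: l; exact: near_ln_ge.
have L3 : M <= ln l by near: l; exact: near_ln_ge.
have L4 : 2 * (M + `|x + level_const|) <= ln l by near: l; exact: near_ln_ge.
have d0 : 0 <= (d%:R + 3) / 2 :> R by rewrite divr_ge0 // addr_ge0.
have S1 : - (`|shape| * ln l) <= shape * ln l <= `|shape| * ln l.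
  by rewrite -ler_norml normrM (ger0_norm (x := ln l)) // (le_trans ler01).
have S0 : 0 <= `|shape| * ln l by rewrite mulr_ge0 // (le_trans ler01).
have D0 : 0 <= (d%:R + 3) / 2 * ln l by rewrite mulr_ge0 // (le_trans ler01).
move: S1 => /andP[S1 S2].
have X0 : - ln l <= x + level_const <= ln l by rewrite -ler_norml.
move: X0 => /andP[X1 X2].
have wE : level l = (x + level_const) + 2 * (shape * ln l) - (d%:R + 3) / 2 * ln l + ln (ln l).
  by rewrite /level; ring.
have sE : cutoff l = shape * ln l - ln l + ln (ln l) / 2 by rewrite /cutoff; ring.
have KE : K * ln l = 3 * (`|shape| * ln l) + (d%:R + 3) / 2 * ln l + 6 * ln l by rewrite /K; ring.
move: d0 S1 S2 S0 D0 KE wE sE.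
move: (`|shape| * ln l) (shape * ln l) ((d%:R + 3) / 2 * ln l) => n1 n2 n3 d0 S1 S2 S0 D0 KE wE sE.
split => //.
- by rewrite ler_norml KE wE; apply/andP; split; lra.
- by rewrite ler_norml KE sE; apply/andP; split; lra.
split.
  by rewrite ler_norml KE wE sE; apply/andP; split; lra.
rewrite cutoff_level.
have k1 : 1 <= k%:R :> R by rewrite ler1n.
have : ln l <= k%:R * ln l by rewrite ler_peMl // (le_trans ler01).
have := ler_norm (x + level_const); lra.
Unshelve. all: by end_near. Qed.

Variables (f : d.-tuple R -> R) (mu : probability (d.-tuple R) R).
Local Notation lam := (@lebesgue_tuple R).
Hypothesis mf : measurable_fun setT f.
Hypothesis f0 : forall y, 0 <= f y.
Hypothesis muE : forall B, measurable B -> mu B = (\int[lam d]_(y in B) (f y)%:E)%E.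
Hypothesis mu_rot : forall rS rho x z, enorm x = enorm z ->
  mu (far_region rS rho x) = mu (far_region rS rho z).
Hypothesis volE : forall r, 0 < r -> lam d [set x | enorm x < r] = (v * r ^+ d)%:E.
Hypothesis hf : gamma_tail R c alpha beta gamma f.

Definition level_pairs (l : R) : set (d.-tuple R * d.-tuple R) :=
  far_pairs (A l + b l * cutoff l) (2 * A l + b l * level l).

Let K0 : 0 < K.
Proof. by rewrite /K addr_gt0 // addr_ge0 ?mulr_ge0 // divr_ge0 // addr_ge0. Qed.

Lemma threshold_ge0 : \forall l \near +oo, 0 <= 2 * A l + b l * level l.
Proof.
apply: filterS2 (level_bounds (lexx 0)) (near_log_small hg K0 ltr01) => l [l1 L1 B1 _ _] [l0 _ L3].
have -> : 2 * A l + b l * level l = A l * (2 + (gamma * l)^-1 * level l) by rewrite /scaleb; ring.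
rewrite mulr_ge0 ?(ltW (scaleA_gt0 gamma hb l0)) // -lerBlDl sub0r.
have gl : 0 <= (gamma * l)^-1 by rewrite invr_ge0 mulr_ge0 // ltW.
apply: (@le_trans _ _ (- 1)); first by rewrite lerN2 ler1n.
rewrite lerNl; apply: le_trans L3; rewrite -mulrN ler_wpM2l //.
by apply: le_trans B1; rewrite -normrN ler_norm.
Qed.

(** The interval of length 2 cutoff - level = (d - 1) / 2 log l + O(1) turns
    [mass_level] into 2 e ^ (- x). For the stars, the additional factor is of order
    (log l) ^ (- 1 / 2). *)
Lemma level_link_upper (ep : R) : 0 < ep <= 1 -> \forall l \near +oo,
  expR (2 * l) * link_prob mu (level_pairs l) <= expR (6 * ep) * (2 * expR (- x)) /\
  expR (3 * l) * star_prob mu (level_pairs l) <= ep.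
Proof.
move=> ep01; have /andP[ep0 ep1] := ep01.
have k0 : 0 < k%:R :> R by rewrite ltr0n.
pose C3 := expR 8 * (expR 6 * (2 * expR (- x))) * (4 / k%:R * expR (- x) * expR (- cutoff_const)).
have C30 : 0 < C3.
  by rewrite /C3 !mulr_gt0 ?expR_gt0 // invr_gt0.
apply: filterS3 (link_upper mf f0 muE mu_rot hv volE hc hb hg K0 ep01 hf) (level_bounds (lexx 0))
  (filterI (near_ln_ge (2 / k%:R * `|x + level_const| / ep)) (near_lnln_ge (- (2 * ln (ep / C3))))).
move=> l U [l1 L1 B1 B2 [B3 B4]] [L2 L3].
rewrite addr0 in B3; have B5 : level l <= 2 * cutoff l by rewrite -subr_ge0.
have [U1 U2] := U _ _ B1 B2 B3 B5.
have l0 : 0 < l by exact: lt_trans l1.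
have ll0 : 0 < ln l by exact: lt_le_trans L1.
have c0 := cm_gt0 l0; have p0 := pk_gt0 l0; have s0 := sm_gt0 l0.
have ml := mass_level l1.
set X := cm l * (pk l * sm l) in U1 ml.
have main : expR (2 * l) * (X * expR (- level l) * (2 * cutoff l - level l)) <= expR ep * (2 * expR (- x)).
  have -> : expR (2 * l) * (X * expR (- level l) * (2 * cutoff l - level l)) =
     expR (2 * l) * X * expR (- level l) * (2 * cutoff l - level l) by ring.
  rewrite ml cutoff_level.
  have -> : 4 / k%:R * expR (- x) / ln l * (k%:R / 2 * ln l - (x + level_const)) =
    (1 - 2 / k%:R * (x + level_const) / ln l) * (2 * expR (- x)).
    by field; rewrite !gt_eqF.
  rewrite ler_pM2r; last by rewrite mulr_gt0 ?expR_gt0.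
  apply: le_trans (expR_ge1Dx ep); rewrite lerD2l.
  rewrite -mulNr ler_pdivrMr //; apply: (@le_trans _ _ (2 / k%:R * `|x + level_const|)).
    by rewrite -mulrN ler_wpM2l ?divr_ge0 // -normrN ler_norm.
  by move: L2; rewrite ler_pdivrMr // [ln l * _]mulrC.
have e6 : expR (6 * ep) = expR (5 * ep) * expR ep by rewrite -expRD; congr expR; ring.
split.
  apply: (le_trans (ler_wpM2l (expR_ge0 _) U1)).
  by rewrite [leLHS]mulrCA e6 -[leRHS]mulrA ler_wpM2l ?expR_ge0.
apply: (le_trans (ler_wpM2l (expR_ge0 _) U2)).
have ec := expR_cutoff l1.
have -> : expR (3 * l) * ((expR (3 * ep) * cm l * expR (- level l)) ^+ 2 * expR (cutoff l) *
     (expR (2 * ep) * (pk l * sm l * (2 * cutoff l - level l)))) =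
   expR (8 * ep) * (expR (2 * l) * (X * expR (- level l) * (2 * cutoff l - level l))) *
   ((expR (2 * l) * X * expR (- level l)) * expR (- cutoff_const) * expR (ln (ln l) / 2)).
  have E8 : expR (8 * ep) = expR (3 * ep) * expR (3 * ep) * expR (2 * ep) by rewrite -!expRD; congr expR; ring.
  have E3 : expR (3 * l) * expR l = expR (2 * l) * expR (2 * l) by rewrite -!expRD; congr expR; ring.
  rewrite ec E8 /X; move: (cm l) (pk l) (sm l) => q1 q2 q3.
  transitivity ((expR (3 * l) * expR l) * (expR (3 * ep) * expR (3 * ep) * expR (2 * ep)) * (q1 * expR (- level l)) ^+ 2 *
    (q2 * q3) ^+ 2 * (expR (- cutoff_const) * expR (ln (ln l) / 2)) * (2 * cutoff l - level l)); first by ring.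
  by rewrite E3; ring.
rewrite ml.
have -> : 4 / k%:R * expR (- x) / ln l * expR (- cutoff_const) * expR (ln (ln l) / 2) =
   4 / k%:R * expR (- x) * expR (- cutoff_const) * expR (- (ln (ln l) / 2)).
  have -> : (ln l)^-1 = expR (- (ln (ln l) / 2)) * expR (- (ln (ln l) / 2)).
    rewrite -expRD -opprD -splitr expRN lnK //.
  have E : expR (- (ln (ln l) / 2)) * expR (ln (ln l) / 2) = 1 by rewrite -expRD addNr expR0.
  transitivity (4 / k%:R * expR (- x) * expR (- cutoff_const) * expR (- (ln (ln l) / 2)) *
    (expR (- (ln (ln l) / 2)) * expR (ln (ln l) / 2))); first by ring.
  by rewrite E mulr1.
have le8 : expR (8 * ep) <= expR 8 by rewrite ler_expR ler_piMr.
have le6 : expR ep <= expR 6 by rewrite ler_expR (le_trans ep1) // ler1n.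
have B : expR (- (ln (ln l) / 2)) <= ep / C3.
  by rewrite -[leRHS]lnK ?posrE ?divr_gt0 // ler_expR lerNl ler_pdivlMr // mulNr mulrC.
have x20 : 0 < 2 * expR (- x) by rewrite mulr_gt0 ?expR_gt0.
apply: (@le_trans _ _ (expR 8 * (expR 6 * (2 * expR (- x))) *
   (4 / k%:R * expR (- x) * expR (- cutoff_const) * (ep / C3)))).
  have cc0 : 0 <= 4 / k%:R * expR (- x) * expR (- cutoff_const).
    by rewrite mulr_ge0 ?expR_ge0 // mulr_ge0 ?expR_ge0 // divr_ge0.
  apply: ler_pM.
  - rewrite mulr_ge0 ?expR_ge0 // mulr_ge0 ?expR_ge0 // mulr_ge0 // mulr_ge0 ?expR_ge0 //.
    by rewrite mulr_ge0 ?(ltW c0) // mulr_ge0 ?(ltW p0) // ltW.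
  - by rewrite mulr_ge0 ?expR_ge0.
  - apply: ler_pM; rewrite ?expR_ge0 //.
      rewrite mulr_ge0 ?expR_ge0 // mulr_ge0 // mulr_ge0 ?expR_ge0 //.
      by rewrite mulr_ge0 ?(ltW c0) // mulr_ge0 ?(ltW p0) // ltW.
    by apply: (le_trans main); rewrite ler_pM2r.
  - by rewrite ler_wpM2l.
have -> : expR 8 * (expR 6 * (2 * expR (- x))) *
   (4 / k%:R * expR (- x) * expR (- cutoff_const) * (ep / C3)) = C3 * (ep / C3) by rewrite /C3; ring.
by rewrite mulrC divfK // gt_eqF.
Qed.

Lemma level_link_lower (ep : R) : 0 < ep <= 1 -> \forall l \near +oo,
  expR (- (7 * ep)) * (2 * expR (- x)) <= expR (2 * l) * link_prob mu (level_pairs l).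
Proof.
move=> ep01; have /andP[ep0 ep1] := ep01.
have k0 : 0 < k%:R :> R by rewrite ltr0n.
pose del := 1 - expR (- (ep / 2)).
have del0 : 0 < del by rewrite subr_gt0 -[ltRHS]expR0 ltr_expR oppr_lt0 divr_gt0.
have del1 : del < 1 by rewrite ltrBlDr ltrDl expR_gt0.
pose s : R := Num.sqrt 2 ^+ k.
have s0 : 0 < s by rewrite exprn_gt0 // sqrtr_gt0.
(* M is chosen to make both truncation losses of [link_lower] at most del *)
pose M : R := 2 * ln ((s + 1) / del).
have sd0 : 0 < (s + 1) / del by rewrite divr_gt0 // addr_gt0.
have sd1 : 1 < (s + 1) / del by rewrite ltr_pdivlMr // mul1r; lra.
have M0 : 0 < M by rewrite mulr_gt0 // ln_gt0.
have eM2 : expR (- (M / 2)) = del / (s + 1).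
  have -> : M / 2 = ln ((s + 1) / del) by rewrite /M; field.
  by rewrite expRN lnK ?posrE // invf_div.
have eM : expR (- M) = expR (- (M / 2)) * expR (- (M / 2)) by rewrite -expRD; congr expR; field.
have s10 : 0 < s + 1 by rewrite addr_gt0.
have h1 : expR (- (M / 2)) * s <= del.
  by rewrite eM2 mulrAC ler_pdivrMr // ler_pM2l //; lra.
have h3 : expR (- (M / 2)) <= del.
  by rewrite eM2 ler_pdivrMr // ler_peMr ?(ltW del0) //; lra.
have h2 : expR (- M) <= del.
  rewrite eM; apply: (@le_trans _ _ (del * 1)); last by rewrite mulr1.
  by apply: ler_pM; rewrite ?expR_ge0 // (le_trans h3) // ltW.
have dE : 1 - del = expR (- (ep / 2)) by rewrite /del; ring.
have kM1 : expR (- ep) <= (1 - expR (- M)) * (1 - expR (- (M / 2)) * s).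
  have -> : expR (- ep) = (1 - del) * (1 - del) by rewrite dE -expRD; congr expR; field.
  by apply: ler_pM; rewrite ?subr_ge0 ?(ltW del1) //; lra.
have kM0 : 0 <= 1 - expR (- (M / 2)) * s by rewrite subr_ge0 (le_trans h1) // ltW.
have M30 : 0 <= 2 * M + 3 by rewrite addr_ge0 // mulr_ge0 // ltW.
apply: filterS3 (link_lower mf f0 muE mu_rot hv volE hc hb hg K0 ep01 M0 kM0 hf) (level_bounds M30)
  (near_ln_ge (2 / k%:R * `|x + level_const + (2 * M + 3)| / (ep / 2))).
move=> l U [l1 L1 B1 B2 [B3 B4]] L2.
rewrite addrA in B3.
have U1 := U _ _ B1 B2 B3 B4; rewrite -/s in U1.
have l0 : 0 < l by exact: lt_trans l1.
have ll0 : 0 < ln l by exact: lt_le_trans L1.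
have c0 := cm_gt0 l0; have p0 := pk_gt0 l0; have s0' := sm_gt0 l0.
have ml := mass_level l1.
set X := cm l * (pk l * sm l) in U1 ml.
have X0 : 0 < X by rewrite mulr_gt0 // mulr_gt0.
have main : expR (- ep) * (2 * expR (- x)) <= expR (2 * l) * (X * expR (- level l) * (2 * cutoff l - level l - 2 * M - 3)).
  have -> : expR (2 * l) * (X * expR (- level l) * (2 * cutoff l - level l - 2 * M - 3)) =
     expR (2 * l) * X * expR (- level l) * (2 * cutoff l - level l - 2 * M - 3) by ring.
  rewrite ml cutoff_level.
  have -> : 4 / k%:R * expR (- x) / ln l * (k%:R / 2 * ln l - (x + level_const) - 2 * M - 3) =
    (1 - 2 / k%:R * (x + level_const + (2 * M + 3)) / ln l) * (2 * expR (- x)).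
    by field; rewrite !gt_eqF.
  rewrite ler_pM2r; last by rewrite mulr_gt0 ?expR_gt0.
  apply: (le_trans (expRN_le ep01)).
  rewrite lerD2l lerN2 ler_pdivrMr //; apply: (@le_trans _ _ (2 / k%:R * `|x + level_const + (2 * M + 3)|)).
    by rewrite ler_wpM2l ?divr_ge0 // ler_norm.
  by move: L2; rewrite ler_pdivrMr ?divr_gt0 // [ln l * _]mulrC.
have pos : 0 <= X * expR (- level l) * (2 * cutoff l - level l - 2 * M - 3).
  apply: mulr_ge0; first by rewrite mulr_ge0 ?expR_ge0 // ltW.
  by rewrite -addrA -opprD subr_ge0.
apply: (le_trans _ (ler_wpM2l (expR_ge0 (2 * l)) U1)).
have e7 : expR (- (7 * ep)) = expR (- (5 * ep)) * expR (- ep) * expR (- ep) by rewrite -!expRD; congr expR; ring.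
rewrite e7 -mulrA [leRHS]mulrCA.
apply: ler_pM; [| | |exact: main].
- exact: mulr_ge0 (expR_ge0 _) (expR_ge0 _).
- exact: mulr_ge0 (expR_ge0 _) (mulr_ge0 (ler0n _ 2) (expR_ge0 _)).
by rewrite ler_pM2l ?expR_gt0.
Qed.

(** By [tail_cutoff] the expected number of truncated points is of order
    (log l) ^ (- 1 / 2). *)
Lemma level_tail (ep : R) : 0 < ep -> \forall l \near +oo,
  (mu (outside (A l + b l * cutoff l)) <= (ep * expR (- l))%:E)%E.
Proof.
move=> ep0.
have [CT HT] := @tail_bound R k c alpha beta gamma f v hv volE mf f0 K hc hb hg K0 hf.
pose C4 := (`|CT| + 1) * expR (ln c - shape * ln beta).
have C40 : 0 < C4 by rewrite mulr_gt0 ?expR_gt0 // ltr_wpDl.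
apply: filterS3 HT (level_bounds (lexx 0)) (near_lnln_ge (- (2 * ln (ep / C4)))).
move=> l U [l1 L1 B1 B2 _] L3.
have l0 : 0 < l by exact: lt_trans l1.
have p0 := pk_gt0 l0; have A0 := scaleA_gt0 gamma hb l0.
rewrite muE; last exact: measurable_outside.
apply: (le_trans (U _ B2)); rewrite lee_fin.
have tc := tail_cutoff l1.
set Y := pk l * A l ^+ d / l * expR (- cutoff l) in tc *.
have Y0 : 0 <= Y by rewrite mulr_ge0 ?expR_ge0 // divr_ge0 ?(ltW l0) // mulr_ge0 ?(ltW p0) // exprn_ge0 // ltW.
apply: (@le_trans _ _ ((`|CT| + 1) * Y)).
  by rewrite ler_wpM2r // (le_trans (ler_norm _)) // lerDl.
have YE : Y = expR (- l) * (expR (ln c - shape * ln beta) * expR (- (ln (ln l) / 2))).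
  by rewrite -tc mulrA -expRD addNr expR0 mul1r.
have B : expR (- (ln (ln l) / 2)) <= ep / C4.
  by rewrite -[leRHS]lnK ?posrE ?divr_gt0 // ler_expR lerNl ler_pdivlMr // mulNr mulrC.
have -> : (`|CT| + 1) * Y = C4 * expR (- (ln (ln l) / 2)) * expR (- l) by rewrite YE /C4; ring.
rewrite ler_pM2r ?expR_gt0 //; move: B; rewrite ler_pdivlMr // mulrC //.
Qed.

End calibration.

(** * Convergence in distribution *)

Section maximal_distance.
Context {disp : measure_display} {T : measurableType disp} {R : realType} {k : nat}.
Variables (P : probability T R) (X : nat -> {RV P >-> k.+1.-tuple R}).

(** The two events differ only when some point is outside of the truncation ball;
    this is a union bound. *)
Lemma max_dist_far_pairs n (rS rho t : R) : 0 <= rho ->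
  (forall i, (P (X i @^-1` outside rS) <= t%:E)%E) ->
  `|fine (P [set w | max_dist P X n w <= rho]) -
    fine (P [set w | forall i j, (i < j < n)%N -> ~ far_pairs rS rho (X i w, X j w)])|
  <= n%:R * t.
Proof.
move=> rho0 ht.
set E1 := [set w | max_dist P X n w <= rho].
set E2 := [set w | forall i j, _ -> _].
have mE1 : measurable E1.
  rewrite -[E1]setTI; apply: measurable_fun_le => //; exact: measurable_max_dist.
have mE2 : measurable E2.
  have -> : E2 = \bigcap_i \bigcap_j
      (if (i < j < n)%N then ~` ((fun w => (X i w, X j w)) @^-1` far_pairs rS rho) else setT).
    apply/seteqP; split=> w /= hw.
      by move=> i _ j _; case: ifP => // ij; exact: hw.
    by move=> i j ij; have := hw i I j I; rewrite ij.
  apply: bigcapT_measurable => i; apply: bigcapT_measurable => j; case: ifP => // _.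
  apply: measurableC; rewrite -[X in measurable X]setTI.
  by apply: (measurable_fun_pair (measurable_funPT (X i)) (measurable_funPT (X j))) => //; exact: measurable_far_pairs.
pose U := \big[setU/set0]_(i < n) (X i @^-1` outside rS).
have mX i : measurable (X i @^-1` outside rS).
  by rewrite -[X in measurable X]setTI; apply: (measurable_funPT (X i)) => //; exact: measurable_outside.
have mU : measurable U by apply: bigsetU_measurable => i _; exact: mX.
have E1P w : E1 w <-> forall i j, (i < j < n)%N -> enorm (tsub (X i w) (X j w)) <= rho.
  rewrite /E1 /= /max_dist; split.
    move=> /bigmax_leP[_ h] i j /andP[ij jn].
    exact: (h (Ordinal (ltn_trans ij jn), Ordinal jn)).
  by move=> h; apply/bigmax_leP; split=> // -[i j] /= ij; apply: h; rewrite ij ltn_ord.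
have E12 : E1 `<=` E2.
  move=> w /E1P h i j /h; rewrite leNgt => /negP h1 [_ [_ h2]]; exact: h1.
have E21 : E2 `<=` E1 `|` U.
  move=> w hw; have [Uw|nU] := pselect (U w); [by right|left].
  have out i : (i < n)%N -> enorm (X i w) < rS.
    move=> iN; rewrite ltNge; apply/negP => h; apply: nU.
    by rewrite /U -(bigcup_mkord n (fun i => X i @^-1` outside rS)); exists i.
  apply/E1P => i j ij; rewrite leNgt; apply/negP => h; apply: (hw i j ij).
  by move: ij => /andP[ij jn]; split; [exact: out (ltn_trans ij jn)|split=> //; exact: out].
have PU : (P U <= (n%:R * t)%:E)%E.
  apply: (le_trans (Boole_inequality P (fun i _ => mX i))).
  apply: (@le_trans _ _ (\sum_(i < n) t%:E)%E); first by apply: lee_sum => i _; exact: ht.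
  by rewrite sumEFin sumr_const card_ord mulr_natl.
have f1 := fin_num_measure P E1 mE1; have f2 := fin_num_measure P E2 mE2.
have fU := fin_num_measure P U mU.
have le12 : fine (P E1) <= fine (P E2) by apply: fine_le => //; apply: le_measure; rewrite ?inE.
have le21 : fine (P E2) <= fine (P E1) + n%:R * t.
  have h : (P E2 <= P E1 + P U)%E.
    apply: (@le_trans _ _ (P (E1 `|` U))).
      by apply: le_measure; rewrite ?inE //; exact: measurableU.
    by apply: measureU2.
  have : (P E2 <= P E1 + (n%:R * t)%:E)%E by apply: (le_trans h); rewrite leeD2l.
  by rewrite -(fineK f1) -(fineK f2) -EFinD lee_fin.
rewrite distrC ger0_norm ?subr_ge0 // lerBlDl //.
Qed.

End maximal_distance.

Section sequences.
Context {R : realType}.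

Lemma near_ln_nat (Q : R -> Prop) :
  (\forall l \near +oo, Q l) -> \forall n \near \oo, Q (ln n%:R).
Proof.
move=> [M [_ HM]]; near=> n; apply: HM.
rewrite -[M]expRK ltr_ln ?posrE ?expR_gt0 //; last first.
  by apply: lt_trans (expR_gt0 M) _; near: n; exact: nbhs_infty_gtr.
by near: n; exact: nbhs_infty_gtr.
Unshelve. all: by end_near. Qed.

Lemma cvg_expR_window (u : nat -> R) (z : R) : 0 < z ->
  (forall ep, 0 < ep <= 1 -> \forall n \near \oo,
    expR (- (7 * ep)) * z <= u n <= expR (6 * ep) * z) ->
  u n @[n --> \oo] --> z.
Proof.
move=> z0 H; apply/cvgrPdist_le => e e0.
(* for ep = log (1 + del) / 7, both factors of z are within del of 1 *)
pose del := Num.min 1 (e / z).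
have d0 : 0 < del by rewrite lt_min ltr01 divr_gt0.
have d1 : del <= 1 by rewrite ge_min lexx.
have dz : del * z <= e by rewrite -ler_pdivlMr // ge_min lexx orbT.
have D0 : 0 < ln (1 + del) by rewrite ln_gt0 // ltrDl.
have D1 : ln (1 + del) <= 1 by apply: le_trans d1; apply: le_ln1Dx; apply: lt_trans d0; rewrite oppr_lt0.
have ep01 : 0 < ln (1 + del) / 7 <= 1 by apply/andP; split; [rewrite divr_gt0|lra].
have E7 : expR (7 * (ln (1 + del) / 7)) = 1 + del by rewrite mulrC divfK // lnK // posrE addr_gt0.
near=> n.
have /andP[h1 h2] : expR (- (7 * (ln (1 + del) / 7))) * z <= u n <= expR (6 * (ln (1 + del) / 7)) * z.
  by near: n; exact: H.
have h3 : expR (6 * (ln (1 + del) / 7)) <= 1 + del.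
  by rewrite -[leRHS]E7 ler_expR; lra.
have h4 : 1 - del <= expR (- (7 * (ln (1 + del) / 7))).
  rewrite expRN E7 -div1r ler_pdivlMr; last by lra.
  have := sqr_ge0 del; rewrite expr2; lra.
rewrite ler_norml; apply/andP; split.
  have : expR (6 * (ln (1 + del) / 7)) * z <= (1 + del) * z by rewrite ler_wpM2r // ltW.
  lra.
have : (1 - del) * z <= expR (- (7 * (ln (1 + del) / 7))) * z by rewrite ler_wpM2r // ltW.
lra.
Unshelve. all: by end_near. Qed.

End sequences.

Section normalization.
Context {R : realType}.

Lemma scaleb_inv (beta gamma l : R) : 0 < beta -> 0 < gamma -> 0 < l ->
  beta `^ gamma^-1 * gamma * l `^ (1 - gamma^-1) = (scaleb beta gamma l)^-1.
Proof.
move=> b0 g0 l0; rewrite /scaleb invf_div /scaleA /powR !gt_eqF ?divr_gt0 //.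
rewrite ln_div ?posrE // -[X in _ * X / _](lnK (x := l)) ?posrE // -expRN.
rewrite mulrAC -expRD mulrC -mulrA -expRD; congr (_ * expR _); ring.
Qed.

Lemma threshold_affine (a b B rho x y : R) : 0 < b -> B + x = 2 * a / b + rho ->
  (b^-1 * y - B <= x) = (y <= 2 * a + b * rho).
Proof.
move=> b0 e; rewrite lerBlDl e mulrC ler_pdivrMr // mulrDl divfK ?gt_eqF //.
by rewrite [rho * b]mulrC.
Qed.

Lemma bin2_sqr (n : nat) : (0 < n)%N -> 'C(n, 2)%:R = n%:R ^+ 2 * ((1 - n%:R^-1) / 2) :> R.
Proof.
case: n => // n _; have := mul_bin_diag n.+1 1; rewrite bin1 => /(congr1 (fun m => m%:R : R)).
rewrite !natrM /= => h.
have n0 : n.+1%:R != 0 :> R by rewrite pnatr_eq0.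
have -> : n.+1%:R ^+ 2 * ((1 - n.+1%:R^-1) / 2) = n.+1%:R * (n.+1%:R - 1) / 2 :> R by field.
have e : n.+1%:R - 1 = n%:R :> R by rewrite -natr1 addrK.
by rewrite e h mulrAC mulfV ?mul1r // pnatr_eq0.
Qed.

End normalization.

Unset Implicit Arguments.

Theorem theorem1p5 (R : realType) (d : nat) (hd : (2 <= d)%N)
  (disp : measure_display) (T : measurableType disp) (P : probability T R)
  (X : nat -> {RV P >-> d.-tuple R}) (f : d.-tuple R -> R)
  (c alpha beta gamma : R)
  (hindep : mutually_independent P X)
  (hident : identically_distributed P X)
  (hsph : spherically_symmetric P (X 0%N))
  (hdens : has_density P (X 0%N) f)
  (hc : 0 < c) (hbeta : 0 < beta) (hgamma : 0 < gamma)
  (hf : f x / (c * enorm x `^ alpha * expR (- beta * enorm x `^ gamma))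
          @[x --> @enorm_infty R d] --> (1 : R))
  (disp' : measure_display) (T' : measurableType disp') (Q : probability T' R)
  (V : {RV Q >-> R}) (hV : gumbel_distributed Q V) :
  cvg_in_distribution P Q
    (fun n =>
       affine_fun
         (beta `^ gamma^-1 * gamma * ln n%:R `^ (1 - gamma^-1))
         (2 * gamma * ln n%:R
          + (2 * ((alpha + d%:R) / gamma) - (d%:R + 3) / 2) * ln (ln n%:R)
          + ln (ln (ln n%:R))
          + ln (cprime d * beta `^ (- (2 * (alpha + d%:R) / gamma))
                * gamma `^ (- ((d%:R + 3) / 2)) * c ^+ 2))
         (max_dist P X n))
    V.

Proof.
move=> x _; rewrite hV.
case: d hd X f hindep hident hsph hdens hf => [|[|j]] // _ X f hindep hident hsph [mf f0 muE] hf.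
pose mu : probability (j.+2.-tuple R) R := distribution P (X 0%N).
have [v v0 [volE vE]] := @ball_volume R j.+2 isT.
have mX i : measurable_fun setT (X i) by exact: measurable_funPT.
have lawX i A : measurable A -> P (X i @^-1` A) = mu A by move=> mA; exact: (hident i 0%N).
have mu_rot rS rho y z : enorm y = enorm z ->
    mu (far_region rS rho y) = mu (far_region rS rho z).
  by move=> yz; exact: far_region_rotate hsph yz.
pose G l : set (j.+2.-tuple R * j.+2.-tuple R) := level_pairs c alpha beta gamma x l.
pose p n := link_prob mu (G (ln n%:R)).
pose q n := star_prob mu (G (ln n%:R)).
pose S n : R := n%:R ^+ 2 * p n.
have expn m n : (0 < n)%N -> expR (m%:R * ln n%:R) = n%:R ^+ m :> R.
  by move=> n0; rewrite expRM_natl lnK // posrE ltr0n.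
have S2 : S n @[n --> \oo] --> 2 * expR (- x).
  apply: cvg_expR_window; first by rewrite mulr_gt0 ?expR_gt0.
  move=> ep ep01.
  have U := near_ln_nat (level_link_upper x hc hbeta hgamma v0 vE mf f0 muE mu_rot volE hf ep01).
  have L := near_ln_nat (level_link_lower x hc hbeta hgamma v0 vE mf f0 muE mu_rot volE hf ep01).
  near=> n; have n0 : (0 < n)%N by near: n; exact: nbhs_infty_gt.
  rewrite /S -expn //; apply/andP; split; first by near: n.
  have [] // : expR (2 * ln n%:R) * p n <= expR (6 * ep) * (2 * expR (- x)) /\
    expR (3 * ln n%:R) * q n <= ep by near: n.
have inv0 : (n%:R : R)^-1 @[n --> \oo] --> (0 : R).
  have np : \forall n \near \oo, 0 < n%:R :> R.
    by near=> n; rewrite ltr0n; near: n; exact: nbhs_infty_gt.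
  exact: ((gtr0_cvgV0 np).2 cvgr_idn).
have Cl : 'C(n, 2)%:R * p n @[n --> \oo] --> expR (- x).
  have -> : expR (- x) = 2 * expR (- x) * ((1 - 0) / 2) by field.
  have : S n * ((1 - n%:R^-1) / 2) @[n --> \oo] --> 2 * expR (- x) * ((1 - 0) / 2).
    by apply: cvgM => //; apply: cvgMl; apply: cvgB => //; exact: cvg_cst.
  apply: cvg_trans; apply: near_eq_cvg; near=> n.
  have n0 : (0 < n)%N by near: n; exact: nbhs_infty_gt.
  by rewrite /S bin2_sqr // mulrAC.
have Pl : expR (- ('C(n, 2)%:R * p n)) @[n --> \oo] --> expR (- expR (- x)).
  by apply: continuous_cvg; [exact: continuous_expR|exact: cvgN].
have S0 : S n ^+ 2 * n%:R^-1 @[n --> \oo] --> (0 : R).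
  rewrite -[X in _ --> X](mulr0 ((2 * expR (- x)) ^+ 2)); apply: cvgM => //.
  by rewrite expr2; under eq_cvg do rewrite expr2; exact: cvgM.
pose l n : R := ln n%:R.
pose rho n : R := 2 * scaleA beta gamma (l n) + scaleb beta gamma (l n) * @level R j c alpha beta gamma x (l n).
pose rS n : R := scaleA beta gamma (l n) + scaleb beta gamma (l n) * @cutoff R j alpha gamma (l n).
pose E n := [set w | max_dist P X n w <= rho n].
have mE n : measurable (E n).
  by rewrite -[E n]setTI; apply: measurable_fun_le => //; exact: measurable_max_dist.
have lgt M : \forall n \near \oo, M < l n.
  by apply: (near_ln_nat (Q := fun t => M < t)); apply: nbhs_pinfty_gt; exact: num_real.
pose a n : R := beta `^ gamma^-1 * gamma * l n `^ (1 - gamma^-1).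
pose B n : R := 2 * gamma * l n + (2 * ((alpha + j.+2%:R) / gamma) - (j.+2%:R + 3) / 2) * ln (l n)
  + ln (ln (l n)) + @level_const R j c alpha beta gamma.
have cdfE : \forall n \near \oo,
    cdf (P := P) (affine_fun (a n) (B n) (max_dist P X n)) x = P (E n).
  near=> n; have l0 : 0 < l n by near: n; exact: lgt.
  rewrite /cdf /distribution /pushforward; congr (P _).
  suff h w : (affine_fun (a n) (B n) (max_dist P X n) w <= x) = (max_dist P X n w <= rho n).
    by apply/seteqP; split=> w; rewrite /E /= in_itv /= h.
  rewrite /affine_fun /a scaleb_inv //; apply: threshold_affine; first exact: scaleb_gt0.
  have A0 := scaleA_gt0 gamma hbeta l0.
  rewrite /B /scaleb /level /shape; field; rewrite !gt_eqF //.
suff h : fine (P (E n)) @[n --> \oo] --> expR (- expR (- x)).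
  apply/fine_cvgP; split.
    near=> n; have : P (E n) \is a fin_num by exact: fin_num_measure.
    by rewrite -(near cdfE n).
  apply: cvg_trans h; apply: near_eq_cvg; near=> n => /=.
  by rewrite -(near cdfE n).
apply/cvgrPdist_le => e e0.
(* e / 4 for the Poisson parameter, 2 * (e / 4) for the two error terms of the
   Poisson approximation, and the rest for the truncation *)
pose ep := Num.min 1 (e / 16).
have ep0 : 0 < ep by rewrite lt_min ltr01 divr_gt0.
have ep1 : ep <= 1 by rewrite ge_min lexx.
have ep2 : ep <= e / 16 by rewrite ge_min lexx orbT.
have ep01 : 0 < ep <= 1 by rewrite ep0.
have U := near_ln_nat (level_link_upper x hc hbeta hgamma v0 vE mf f0 muE mu_rot volE hf ep01).
have Tl := near_ln_nat (level_tail x hc hbeta hgamma v0 mf f0 muE volE hf ep0).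
have LB := near_ln_nat (@threshold_ge0 R j c alpha beta gamma x hbeta hgamma).
have e4 : 0 < e / 4 by rewrite divr_gt0.
have e16 : 0 < e / 16 by rewrite divr_gt0.
have Pl4 := ((@cvgrPdist_le _ _ _ _ _ _ _).1 Pl) _ e4.
have S16 := ((@cvgrPdist_le _ _ _ _ _ _ _).1 S0) _ e16.
near=> n.
have n0 : (0 < n)%N by near: n; exact: nbhs_infty_gt.
have n0R : 0 < n%:R :> R by rewrite ltr0n.
have l0 : 0 < l n by near: n; exact: lgt.
have h1 : `|expR (- expR (- x)) - expR (- ('C(n, 2)%:R * p n))| <= e / 4.
  by near: n; exact: Pl4.
have h2 : S n ^+ 2 * n%:R^-1 <= e / 16.
  have : `|0 - S n ^+ 2 * n%:R^-1| <= e / 16 by near: n; exact: S16.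
  by rewrite sub0r normrN; exact: le_trans (ler_norm _).
have h3 : n%:R ^+ 3 * q n <= ep.
  rewrite -expn //.
  have [] // : expR (2 * ln n%:R) * p n <= expR (6 * ep) * (2 * expR (- x)) /\
    expR (3 * ln n%:R) * q n <= ep by near: n.
have h4 : (mu (outside (rS n)) <= (ep * expR (- l n))%:E)%E by near: n; exact: Tl.
have h5 := poisson_random_graph mX lawX hindep (measurable_far_pairs (rS n) (rho n)) (@far_pairs_sym R j.+1 (rS n) (rho n)) n.
have rho0 : 0 <= rho n by near: n; exact: LB.
have h6 : `|fine (P (E n)) - fine (P [set w | forall i k, (i < k < n)%N ->
    ~ far_pairs (rS n) (rho n) (X i w, X k w)])| <= n%:R * (ep * expR (- l n)).
  apply: max_dist_far_pairs => // i; apply: le_trans h4.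
  by rewrite lawX //; exact: measurable_outside.
have h7 : n%:R * (ep * expR (- l n)) = ep.
  by rewrite mulrCA expRN lnK ?posrE // mulfV ?mulr1 // gt_eqF.
have h8 : 4 * n%:R ^+ 3 * (p n ^+ 2 + q n) = 4 * (S n ^+ 2 * n%:R^-1) + 4 * (n%:R ^+ 3 * q n).
  by rewrite /S; field; rewrite gt_eqF.
rewrite h7 in h6.
have h9 : `|fine (P [set w | forall i k, (i < k < n)%N ->
    ~ far_pairs (rS n) (rho n) (X i w, X k w)]) - expR (- ('C(n, 2)%:R * p n))| <= e / 2.
  apply: (le_trans h5); rewrite -/(p n) -/(q n); apply: (@le_trans _ _ (4 * (S n ^+ 2 * n%:R^-1) + 4 * (n%:R ^+ 3 * q n))).
    by rewrite -h8.
  lra.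
rewrite -(subrK (expR (- ('C(n, 2)%:R * p n))) (expR _)) -addrA (le_trans (ler_normD _ _)) //.
have -> : e = e / 4 + 3 / 4 * e by field.
rewrite lerD //; rewrite distrC.
rewrite -(subrK (fine (P [set w | forall i k, (i < k < n)%N ->
    ~ far_pairs (rS n) (rho n) (X i w, X k w)])) (fine _)) -addrA (le_trans (ler_normD _ _)) //.
lra.
Unshelve. all: by end_near. Qed.
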